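(* Let $K$ be a normal subgroup of a finite group $H$, $G=H/K$, let $b$ be a block of $\mathcal{O}K$ with defect group $P\le K$, and let $b_1$ be the Brauer correspondent of $b$ in $\mathcal{O}N_K(P)$. Then the three extensions $$(1')\quad 1\to \hat{k}_1^{*}\to \operatorname{hU}(\bar{C})\to G[b]\to 1,$$ $$(2')\quad 1\to \hat{k}_2^{*}\to \operatorname{hU}(\bar{E})\to G[b_1]\to 1,$$ $$(3')\quad 1\to \hat{k}_3^{*}\to \operatorname{hU}(\bar{D})\to \overline{C_H(P)}[\bar{b}]\to 1$$ defined in the context are isomorphic. Moreover, under the natural identifications, $G[b]=G[\bar b]=G[b_1]=\overline{N_H(P)_b}[\bar b]=\overline{C_H(P)}[\bar b]$.
   Context: Base ring. $p$ is a prime; $\mathcal{O}$ is a discrete valuation ring with residue field $k$ of characteristic $p$ (the case $\mathcal{O}=k$ is also allowed); no assumption is made on the size of $\mathcal{O}$ and $k$. $J(\cdot)$ is the Jacobson radical. For a group $X$ acting on $B$, $B^X$ denotes the fixed elements; groups act on group algebras by conjugation. For a graded algebra $B$, $\operatorname{hU}(B)$ is the group of homogeneous units, with the degree map to the grading group. A block of $\mathcal{O}K$ is a primitive idempotent of $Z(\mathcal{O}K)=(\mathcal{O}K)^K$. $\operatorname{Br}_P:(\mathcal{O}H)^P\to kC_H(P)$ is the Brauer homomorphism (truncation to $C_H(P)$ followed by reduction to $k$), and similarly on $(\mathcal{O}N_H(P))^P$. A defect group of $b$ is a $p$-subgroup $P\le K$ such that $b$ lies in the image of the relative trace $\operatorname{Tr}_P^K:(\mathcal{O}K)^P\to(\mathcal{O}K)^K$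 and $\operatorname{Br}_P(b)\ne0$. The Brauer correspondent $b_1$ of $b$ is the block of $\mathcal{O}N_K(P)$ with defect group $P$ such that $\operatorname{Br}_P(b_1)=\operatorname{Br}_P(b)=:\bar b$. One has $N_H(P)_b=N_H(P)_{\bar b}=N_H(P)_{b_1}$ for the stabilizers in $N_H(P)$; $G_b$ is the stabilizer of $b$ in $G$, $C_H(P)_{\bar b}$ the stabilizer of $\bar b$ in $C_H(P)$. For a coset $\sigma$, $\mathcal{O}\sigma$ is the $\mathcal{O}$-span of $\sigma$, and similarly over $k$. Extension (1'). For $\sigma\in G_b$ put $C_\sigma=b(\mathcal{O}\sigma)^K$; $G[b]=\{\sigma\in G_b\mid C_\sigma C_{\sigma^{-1}}=C_1\}$; $C=\bigoplus_{\sigma\in G[b]}C_\sigma$, $\hat k_1=C_1/J(C_1)$, $\bar C=C/CJ(C_1)$, a crossed product of $\hat k_1$ with $G[b]$. Extension (2'). For $\sigma\in N_H(P)_{b_1}/N_K(P)$ put $E_\sigma=b_1(\mathcal{O}\sigma)^{N_K(P)}$; $G[b_1]=\{\sigma\in N_H(P)_{b_1}/N_K(P)\mid E_\sigma E_{\sigma^{-1}}=E_1\}$; $E=\bigoplus_{\sigma\in G[b_1]}E_\sigma$, $\hat k_2=E_1/J(E_1)$, $\bar E=E/EJ(E_1)$, a crossed product of $\hat k_2$ with $G[b_1]$. Extension (3'). For $\tau\in C_H(P)_{\bar b}/C_K(P)$ put $D_\tau=\bar b(k\tau)^{N_K(P)}$; $\overline{C_H(P)}[\bar b]=\{\tau\in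 C_H(P)_{\bar b}/C_K(P)\mid D_\tau D_{\tau^{-1}}=D_1\}$; $D=\bigoplus_{\tau\in\overline{C_H(P)}[\bar b]}D_\tau$, $\hat k_3=D_1/J(D_1)$, $\bar D=D/DJ(D_1)$. Other groups. For $\sigma\in G$ let $F_\sigma=\bar b\,(k[\sigma\cap C_H(P)])^{N_K(P)}$ (here $k[\sigma\cap C_H(P)]$ is the $k$-span, zero if $\sigma\cap C_H(P)$ is empty). Then $G[\bar b]=\{\sigma\in G_b\mid F_\sigma F_{\sigma^{-1}}=F_1\}$ and $\overline{N_H(P)_b}[\bar b]=\{\sigma\in N_H(P)_bK/K\mid F_\sigma F_{\sigma^{-1}}=F_1\}$. Natural identifications: $C_H(P)/C_K(P)\simeq C_H(P)K/K\le G$ and $N_H(P)/N_K(P)\simeq N_H(P)K/K\le G$. *)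

(* Defs.v *)
From HB Require Import structures.
From mathcomp Require Import all_boot all_order all_fingroup all_solvable.
From mathcomp Require Import all_algebra.
From mathcomp Require Import boolp classical_sets functions.

Set Implicit Arguments.
Unset Strict Implicit.
Unset Printing Implicit Defensive.

Import GRing.Theory.

Local Open Scope group_scope.
Local Open Scope classical_set_scope.
Local Open Scope ring_scope.

(* The group algebra of gT over R: functions on gT with convolution. For a
   subgroup H of gT, the algebra RH is the subset [gspan R H] below. *)
Definition galg (R : nzRingType) (gT : finGroupType) : Type := {ffun gT -> R}.

Section GroupAlgebra.
Variables (R : nzRingType) (gT : finGroupType).
Notation A := (galg R gT).

HB.instance Definition _ := GRing.Zmodule.on A.

Definition galg_one : A := [ffun g => (g == 1%g)%:R].
Definition galg_mul (a b : A) : A :=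
  [ffun g => \sum_(h : gT) a h * b (h^-1 * g)%g].

Fact galg_mulA : associative galg_mul.
Proof.
move=> a b c; apply/ffunP=> g; rewrite !ffunE.
under eq_bigr => u _ do rewrite ffunE big_distrr /=.
rewrite exchange_big [RHS](eq_bigr (fun h => \sum_u
  a u * b (u^-1 * h)%g * c (h^-1 * g)%g)); last first.
  by move=> h _; rewrite ffunE big_distrl.
rewrite exchange_big [RHS]exchange_big /=; apply: eq_bigr => u _.
rewrite (reindex_inj (mulgI u^-1%g)); apply: eq_bigr => h _ /=.
by rewrite mulrA invMg invgK mulgA mulgK.
Qed.

Fact galg_mul1 : left_id galg_one galg_mul.
Proof.
move=> a; apply/ffunP=> g; rewrite ffunE (bigD1 1%g) //= ffunE eqxx mul1r.
rewrite big1 ?addr0 ?invg1 ?mul1g // => h h1.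
by rewrite ffunE (negPf h1) mul0r.
Qed.

Fact galg_mulr1 : right_id galg_one galg_mul.
Proof.
move=> a; apply/ffunP=> g; rewrite ffunE (bigD1 g) //= ffunE mulVg eqxx mulr1.
rewrite big1 ?addr0 // => h hg; rewrite ffunE -eq_mulVg1 (negPf hg).
by rewrite mulr0.
Qed.

Fact galg_mulDl : left_distributive galg_mul +%R.
Proof.
move=> a b c; apply/ffunP=> g; rewrite !ffunE -big_split /=.
by apply: eq_bigr => h _; rewrite ffunE mulrDl.
Qed.

Fact galg_mulDr : right_distributive galg_mul +%R.
Proof.
move=> a b c; apply/ffunP=> g; rewrite !ffunE -big_split /=.
by apply: eq_bigr => h _; rewrite ffunE mulrDr.
Qed.

Fact galg_one_neq0 : galg_one != 0.
Proof.
by apply/eqP=> /ffunP/(_ 1%g)/eqP; rewrite !ffunE eqxx oner_eq0.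
Qed.

HB.instance Definition _ := GRing.Zmodule_isNzRing.Build A
  galg_mulA galg_mul1 galg_mulr1 galg_mulDl galg_mulDr galg_one_neq0.

(* The right conjugation action: the basis element g is sent to g ^ x. *)
Definition gconj (a : A) (x : gT) : A := [ffun g => a (g ^ x^-1)%g].

Definition gspan (S : {set gT}) : set A :=
  [set a | forall g, g \notin S -> a g = 0].

(* (R S)^X *)
Definition gfix (S X : {set gT}) : set A :=
  [set a | gspan S a /\ forall x, x \in X -> gconj a x = a].

(* e (R S)^X *)
Definition gcomp (e : A) (S X : {set gT}) : set A :=
  [set e * a | a in gfix S X].

Definition gstab (X : {set gT}) (a : A) : {set gT} :=
  [set x in X | gconj a x == a]%SET.

(* Tr_P^K; on P-fixed a, the summand does not depend on the representative
   of the right coset. *)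
Definition rtrace (P K : {set gT}) (a : A) : A :=
  \sum_(X in rcosets P K) gconj a (repr X).

(* A primitive idempotent of (R K)^K = Z(R K). *)
Definition is_block (K : {set gT}) (b : A) : Prop :=
  [/\ gfix K K b, b * b = b, b != 0
    & forall e f, gfix K K e -> gfix K K f -> e * e = e -> f * f = f ->
        e * f = 0 -> b = e + f -> e = 0 \/ f = 0].

End GroupAlgebra.

(* The Brauer homomorphism Br_P, with res the reduction to the residue field;
   on elements supported in H, the result is supported in C_H(P). *)
Definition brauer (O k : nzRingType) (res : {rmorphism O -> k})
    (gT : finGroupType) (P : {set gT}) (a : galg O gT) : galg k gT :=
  [ffun g => if g \in 'C(P) then res (a g) else 0].

Definition is_defect_group (O k : nzRingType) (res : {rmorphism O -> k})
    (p : nat) (gT : finGroupType) (K P : {set gT}) (b : galg O gT) : Prop :=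
  [/\ p.-group P, P \subset K, (rtrace P K @` gfix K P) b
    & brauer res P b != 0].

(* Below, a subring B of A is a subset with its own identity element e, which
   need not be that of A. *)
Section Subrings.
Variable A : nzRingType.
Implicit Types (B I J L X Y : set A) (e : A).

(* Sums of products. *)
Definition setprod X Y : set A :=
  [set z | exists n (x y : 'I_n -> A),
    [/\ forall i, X (x i), forall i, Y (y i) & z = \sum_i x i * y i]].

Definition left_ideal B L : Prop :=
  [/\ L `<=` B, L 0, forall x y, L x -> L y -> L (x - y)
    & forall a x, B a -> L x -> L (a * x)].

Definition max_left_ideal B L : Prop :=
  [/\ left_ideal B L, L <> B
    & forall L', left_ideal B L' -> L `<=` L' -> L' = L \/ L' = B].

Definition jacobson B : set A :=
  [set x | B x /\ forall L, max_left_ideal B L -> L x].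

(* The quotient B / I, as a set of cosets x + I. *)
Definition qcls I (x : A) : set A := [set x + i | i in I].

Definition qmul I X Y : set A :=
  [set z | exists x y i, [/\ X x, Y y, I i & z = x * y + i]].

Definition quot B I : set (set A) := [set qcls I x | x in B].

Definition qunits B e I : set (set A) :=
  [set X | quot B I X /\ exists Y,
    [/\ quot B I Y, qmul I X Y = qcls I e & qmul I Y X = qcls I e]].

(* The map B / J -> B' / I, x + J |-> x + I, for B in B' and J in I. *)
Definition qlift I X : set A := [set z | exists x i, [/\ X x, I i & z = x + i]].

End Subrings.

(* Groups whose carrier is a set, so that unit groups of quotient rings can be
   used without bundling. *)
Definition is_group_on (T : Type) (G : set T) (mul : T -> T -> T) : Prop :=
  [/\ forall x y, G x -> G y -> G (mul x y),
      forall x y z, G x -> G y -> G z -> mul x (mul y z) = mul (mul x y) z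
    & exists u, [/\ G u, forall x, G x -> mul u x = x /\ mul x u = x
      & forall x, G x -> exists y, [/\ G y, mul x y = u & mul y x = u]]].

Definition is_hom_on (T U : Type) (G : set T) (mulT : T -> T -> T)
    (mulU : U -> U -> U) (f : T -> U) : Prop :=
  forall x y, G x -> G y -> f (mulT x y) = mulU (f x) (f y).

(* Data of a sequence 1 -> ker -> mid -> quo -> 1. *)
Record ext_data (T : Type) (gT : finGroupType) := ExtData {
  ext_ker : set T;
  ext_kmul : T -> T -> T;
  ext_mid : set T;
  ext_mmul : T -> T -> T;
  ext_quo : {set gT};
  ext_inj : T -> T;
  ext_proj : T -> gT
}.

Definition is_extension (T : Type) (gT : finGroupType) (e : ext_data T gT) :
    Prop :=
  [/\ [/\ is_group_on (ext_ker e) (ext_kmul e),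
          is_group_on (ext_mid e) (ext_mmul e) & group_set (ext_quo e)],
      is_hom_on (ext_ker e) (ext_kmul e) (ext_mmul e) (ext_inj e),
      is_hom_on (ext_mid e) (ext_mmul e) (fun x y => x * y)%g (ext_proj e),
      set_inj (ext_ker e) (ext_inj e)
    & ext_inj e @` ext_ker e = [set x | ext_mid e x /\ ext_proj e x = 1%g] /\
      ext_proj e @` ext_mid e = [set` ext_quo e]].

(* An isomorphism of extensions inducing the given map q on the quotients. *)
Definition ext_iso (T1 T2 : Type) (gT1 gT2 : finGroupType)
    (e1 : ext_data T1 gT1) (e2 : ext_data T2 gT2) (q : gT1 -> gT2) : Prop :=
  [/\ set_bij [set` ext_quo e1] [set` ext_quo e2] q,
      is_hom_on [set` ext_quo e1] (fun x y => x * y)%g (fun x y => x * y)%g q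
    & exists (f : T1 -> T2) (g : T1 -> T2),
      [/\ set_bij (ext_ker e1) (ext_ker e2) f /\
            is_hom_on (ext_ker e1) (ext_kmul e1) (ext_kmul e2) f,
          set_bij (ext_mid e1) (ext_mid e2) g /\
            is_hom_on (ext_mid e1) (ext_mmul e1) (ext_mmul e2) g,
          forall x, ext_ker e1 x -> g (ext_inj e1 x) = ext_inj e2 (f x)
        & forall x, ext_mid e1 x -> ext_proj e2 (g x) = q (ext_proj e1 x)]].

Section GradedExtension.
Variables (A : nzRingType) (gT : finGroupType).
(* B s is the component of degree s, e the identity element of B 1, and St the
   group of degrees under consideration. *)
Variables (e : A) (B : gT -> set A) (St : {set gT}).

(* {s in St | B_s B_(s^-1) = B_1} *)
Definition gr_supp : {set gT} :=
  [set s in St | `[< setprod (B s) (B s^-1%g) = B 1%g >]]%SET.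

Definition gr_sum : set A :=
  [set x | exists c : gT -> A,
    (forall s, s \in gr_supp -> B s (c s)) /\ x = \sum_(s in gr_supp) c s].

Definition gr_ideal : set A := setprod gr_sum (jacobson (B 1%g)).

Definition gr_homog (s : gT) (X : set A) : Prop :=
  s \in gr_supp /\ exists2 c, B s c & X = qcls gr_ideal c.

Definition gr_hU : set (set A) :=
  [set X | qunits gr_sum e gr_ideal X /\ exists s, gr_homog s X].

Definition gr_deg (X : set A) : gT := xget 1%g [set s | gr_homog s X].

(* 1 -> (B_1/J(B_1))^* -> hU(B/B J(B_1)) -> gr_supp -> 1 *)
Definition gr_ext : ext_data (set A) gT :=
  {| ext_ker := qunits (B 1%g) e (jacobson (B 1%g));
     ext_kmul := qmul (jacobson (B 1%g));
     ext_mid := gr_hU;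
     ext_mmul := qmul gr_ideal;
     ext_quo := gr_supp;
     ext_inj := qlift gr_ideal;
     ext_proj := gr_deg |}.

End GradedExtension.

Section BlockExtensions.
Variables (R : nzRingType) (gT : finGroupType) (H K P : {group gT}).
Implicit Type b : galg R gT.

(* Cosets in H / K coerce to subsets of gT. *)

(* Conjugation by K fixes b in (R K)^K, so the stabiliser of b in H / K is
   the image of its stabiliser in H. *)
Definition Ccomp b (s : coset_of K) : set (galg R gT) := gcomp b s K.
Definition G_b b : {set coset_of K} := (gstab H b / K)%g.
Definition ext1 b := gr_ext b (Ccomp b) (G_b b).

Definition Ecomp b (s : coset_of 'N_K(P)) : set (galg R gT) :=
  gcomp b s 'N_K(P).
Definition NH_b b : {set coset_of 'N_K(P)} := (gstab 'N_H(P) b / 'N_K(P))%g.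
Definition ext2 b := gr_ext b (Ecomp b) (NH_b b).

Definition Dcomp b (t : coset_of 'C_K(P)) : set (galg R gT) :=
  gcomp b t 'N_K(P).
Definition CH_b b : {set coset_of 'C_K(P)} := (gstab 'C_H(P) b / 'C_K(P))%g.
Definition ext3 b := gr_ext b (Dcomp b) (CH_b b).

Definition Fcomp b (s : coset_of K) : set (galg R gT) :=
  gcomp b (s :&: 'C_H(P)) 'N_K(P).

End BlockExtensions.

(* For L in K, the natural map x L |-> x K from cosets of L to cosets of K; it
   is independent of the representative x when x normalises L and K. *)
Definition nat_coset (gT : finGroupType) (L K : {set gT}) (t : coset_of L) :
  coset_of K := coset K (repr t).

(* A local principal ideal domain that is not a field. *)
Definition is_dvr (O : idomainType) : Prop :=
  [/\ forall I, left_ideal [set: O] I ->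
        exists a, I = [set x * a | x in [set: O]],
      exists! m, max_left_ideal [set: O] m
    & exists x : O, x != 0 /\ x \isn't a GRing.unit].

(* Main.v *)
From HB Require Import structures.
Require Import Defs.
From mathcomp Require Import all_boot all_order all_fingroup all_solvable.
From mathcomp Require Import all_algebra.
From mathcomp Require Import all_field all_character.
From mathcomp Require Import boolp classical_sets functions.
Set Implicit Arguments.
Unset Strict Implicit.
Unset Printing Implicit Defensive.
Local Open Scope group_scope.
Local Open Scope ring_scope.
Import GRing.Theory.
Local Open Scope classical_set_scope.

(** The Brauer homomorphism Br_P truncates the group algebra to C_H(P) and
    reduces the coefficients to k; it is multiplicative on P-fixed elements.
    It induces graded maps from C, the algebra of the first extension, and from
    E, the algebra of the second, to the algebra with components F_s, and it
    maps each component onto the corresponding one of D, the algebra of the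
    third extension ([brauer_gcomp]: since b is a relative trace Tr_P^K(a), the
    element Tr_P^K(a y) lies above bbar Br_P(y)). If moreover the kernel in
    degree 1 lies in the Jacobson radical, then nothing about the extensions is
    lost: a component product B_s B_(s^-1) is the whole of B_1 exactly when its
    image is ([mem_supp_image]), the radicals correspond ([image_jacobson]), and
    the quotients by the ideals they generate are isomorphic as graded rings
    ([gr_ext_iso]). A degree whose component F_s generates F_1 meets C_H(P), so
    that all supports come from C_H(P); this gives the equalities of groups.

    That the sequences are exact at the grading group needs a unit in every
    degree of the support. As O need not be complete, C_1 need not be local;
    over the field k, units are found by enlarging idempotents of the form u v,
    u of degree s and v of degree s^-1 ([crossed_pair]), and they are lifted
    along Br_P ([lift_crossed]).

    The main point is the position of the kernel ([brauer_ker_jacobson]). When O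
    is complete, b Z(OK) is local and there is nothing to prove. In general b
    may split over k into several blocks of kK, and one has to know that they
    all survive under Br_P. It is enough to treat the sum c of a class of K that
    does not meet C(P) ([class_sum_jacobson]). For m prime to |K| the sum of the
    m-th powers of that class is also in the kernel of Br_P. Galois conjugation
    permutes the values of these elements under each central character of K,
    hence the coefficients of the polynomial prod_m (X - c_m) take rational
    integer values under all central characters ([zclass_poly_rational]) and
    are annihilated by products of factors X - r with r an integer
    ([zclass_poly_coef_root]). Splitting the integers r into those that vanish
    in k and those that do not gives an idempotent in b Z(OK), without any
    lifting; as b is primitive, b times each non-leading coefficient is in the
    radical ([rational_ker_jacobson]). So a power of b c is in the radical, and
    then b c is. *)

(** * Subrings given by subsets *)

Section Subrings.
Variable A : nzRingType.
Implicit Types (B I J L X Y S : set A) (e x y : A).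

Record unital_subring S e : Prop := UnitalSubring {
  usr_sub : forall x y, S x -> S y -> S (x - y);
  usr_mul : forall x y, S x -> S y -> S (x * y);
  usr_one : S e;
  usr_mul1 : forall x, S x -> e * x = x;
  usr_mulr1 : forall x, S x -> x * e = x }.

Definition commutative_on S := forall x y, S x -> S y -> x * y = y * x.

Record two_sided S I : Prop := TwoSided {
  ts_incl : I `<=` S;
  ts_0 : I 0;
  ts_sub : forall x y, I x -> I y -> I (x - y);
  ts_left : forall a x, S a -> I x -> I (a * x);
  ts_right : forall a x, S a -> I x -> I (x * a) }.

Lemma closed_opp X : X 0 -> (forall x y, X x -> X y -> X (x - y)) ->
  forall x, X x -> X (- x).
Proof. by move=> X0 XB x Xx; rewrite -sub0r; apply: XB. Qed.

Lemma closed_add X : X 0 -> (forall x y, X x -> X y -> X (x - y)) ->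
  forall x y, X x -> X y -> X (x + y).
Proof.
by move=> X0 XB x y Xx Xy; rewrite -[y]opprK; apply: (XB) => //; apply: (closed_opp X0 XB).
Qed.

Lemma closed_sum X (I : Type) (r : seq I) (P : pred I) (F : I -> A) :
  X 0 -> (forall x y, X x -> X y -> X (x - y)) ->
  (forall i, P i -> X (F i)) -> X (\sum_(i <- r | P i) F i).
Proof. by move=> X0 XB XF; apply: big_ind => //; apply: (closed_add X0 XB). Qed.

Lemma usr_0 S e : unital_subring S e -> S 0.
Proof. by case=> SB _ S1 _ _; rewrite -(subrr e); apply: SB. Qed.

Lemma usr_add S e : unital_subring S e -> forall x y, S x -> S y -> S (x + y).
Proof. by move=> rS; apply: (closed_add (usr_0 rS)); case: rS. Qed.

Lemma usr_opp S e : unital_subring S e -> forall x, S x -> S (- x).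
Proof. by move=> rS; apply: (closed_opp (usr_0 rS)); case: rS. Qed.

Lemma ts_add S I : two_sided S I -> forall x y, I x -> I y -> I (x + y).
Proof. by case=> _ I0 IB _ _; apply: (closed_add I0 IB). Qed.

Lemma ts_opp S I : two_sided S I -> forall x, I x -> I (- x).
Proof. by case=> _ I0 IB _ _; apply: (closed_opp I0 IB). Qed.

(** ** Sums of products *)

Lemma setprod_mul X Y x y : X x -> Y y -> setprod X Y (x * y).
Proof.
by move=> Xx Yy; exists 1%N, (fun=> x), (fun=> y); split=> //; rewrite big_ord1.
Qed.

Lemma setprod_ind X Y (V : set A) : V 0 ->
  (forall x y, V x -> V y -> V (x + y)) ->
  (forall x y, X x -> Y y -> V (x * y)) -> setprod X Y `<=` V.
Proof.
by move=> V0 VD VM _ [n [x [y [Xx Yy ->]]]]; apply: big_ind => // i _; apply: VM.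
Qed.

Lemma setprod0 X Y : setprod X Y 0.
Proof.
exists 0%N, (fun=> 0), (fun=> 0).
by split=> [[]|[]|] //; rewrite big_ord0.
Qed.

Lemma setprod_add X Y z t :
  setprod X Y z -> setprod X Y t -> setprod X Y (z + t).
Proof.
move=> [n [x [y [Xx Yy ->]]]] [m [u [v [Xu Yv ->]]]].
exists (n + m)%N, (fun i => match fintype.split i with inl j => x j | inr j => u j end),
  (fun i => match fintype.split i with inl j => y j | inr j => v j end).
split=> [i|i|]; try by case: (fintype.split i).
rewrite big_split_ord /=; congr (_ + _); apply: eq_bigr => i _.
  by case: split_ordP => j /eqP; rewrite ?eq_shift // => /eqP <-.
by case: split_ordP => j /eqP; rewrite ?eq_shift // => /eqP <-.
Qed.

Lemma setprod_opp X Y z :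
  (forall x, X x -> X (- x)) -> setprod X Y z -> setprod X Y (- z).
Proof.
move=> XN [n [x [y [Xx Yy ->]]]]; exists n, (fun i => - x i), y.
split=> // [i|]; first exact: XN.
by rewrite -sumrN; apply: eq_bigr => i _; rewrite mulNr.
Qed.

Lemma setprod_sub X Y z t : (forall x, X x -> X (- x)) ->
  setprod X Y z -> setprod X Y t -> setprod X Y (z - t).
Proof. by move=> XN Xz Xt; apply: setprod_add => //; apply: setprod_opp. Qed.

(** ** The Jacobson radical of a commutative subring *)

(** Zorn's lemma; the empty set is admitted in the ordered family because the
    union of the empty chain has to belong to it. *)
Lemma max_left_ideal_exists S e L : unital_subring S e -> left_ideal S L ->
  ~ L e -> exists2 M, max_left_ideal S M & L `<=` M /\ ~ M e.
Proof.
move=> rS iL Le.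
pose Q X := X = set0 \/ [/\ left_ideal S X, L `<=` X & ~ X e].
have [F FQ totF|M [[M0|[iM LM Me]] maxM]] := Zorn_bigcup (P := Q).
- have [[Y FY Y0]|F0] := pselect (exists2 Y, F Y & Y !=set0).
    have QF Z : F Z -> Z !=set0 ->
      [/\ left_ideal S Z, L `<=` Z & ~ Z e].
      by move=> FZ [z Zz]; case: (FQ _ FZ) => // Z0; move: Zz; rewrite Z0.
    have [[YS Y_0 YB YM] LY Ye] := QF _ FY Y0; right; split=> [|x /LY Yx|].
    + split=> [x [Z FZ Zx]||x y [Z FZ Zx] [T FT Ty]|a x Sa [Z FZ Zx]].
      * have Zn : Z !=set0 by exists x.
        by have [[ZS _ _ _] _ _] := QF _ FZ Zn; apply: ZS.
      * by exists Y.
      * have Zn : Z !=set0 by exists x.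
        have Tn : T !=set0 by exists y.
        have [ZT|TZ] := totF _ _ FZ FT.
          have [[_ _ TB _] _ _] := QF _ FT Tn.
          by exists T => //; apply: TB => //; apply: ZT.
        have [[_ _ ZB _] _ _] := QF _ FZ Zn.
        by exists Z => //; apply: ZB => //; apply: TZ.
      * have Zn : Z !=set0 by exists x.
        by have [[_ _ _ ZM] _ _] := QF _ FZ Zn; exists Z => //; apply: ZM.
    + by exists Y.
    + case=> Z FZ Ze; have Zn : Z !=set0 by exists e.
      by have [_ _] := QF _ FZ Zn.
  left; rewrite -subset0 => x [Z FZ Zx]; apply: F0; exists Z => //.
  by exists x.
- exfalso; apply: (maxM L); last by right; split.
  by rewrite M0; split=> [x//|/(_ 0)]; case: iL => _ L0 _ _; apply.
exists M; last by split.
split=> // [MS|L' iL' ML']; first by apply: Me; rewrite MS; exact: (usr_one rS).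
have [L'M|L'M] := pselect (L' `<=` M); first by left; apply/seteqP.
right; apply: contrapT => L'S; apply: (maxM L'); first by split.
right; split=> // [x /LM/ML'//|L'e]; apply: L'S; apply/seteqP.
case: iL' => L'1 _ _ L'M'; split=> // x Sx.
by rewrite -(usr_mulr1 rS Sx); apply: L'M'.
Qed.

(** If e - a x has no left inverse, the left ideal that it generates lies in a
    maximal one, which cannot contain x. Conversely, if a maximal left ideal L
    does not contain x, then e = l + a x for some l in L, and l = e - a x
    is invertible. *)
Lemma jacobsonP S e x : unital_subring S e -> commutative_on S ->
  jacobson S x <->
  S x /\ forall a, S a -> exists2 w, S w & w * (e - a * x) = e.
Proof.
move=> rS cS; split=> [[Sx Jx]|[Sx Jx]].
  split=> // a Sa.
  apply: contrapT => nw; pose L := [set w * (e - a * x) | w in S].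
  have Sy : S (e - a * x) by apply: (usr_sub rS (usr_one rS)); apply: (usr_mul rS).
  have iL : left_ideal S L.
    split=> [_ [w Sw <-]||_ _ [w Sw <-] [v Sv <-]|c _ Sc [w Sw <-]].
    - exact: (usr_mul rS).
    - by exists 0; rewrite ?mul0r //; apply: usr_0 rS.
    - by exists (w - v); rewrite ?mulrBl //; apply: (usr_sub rS).
    - by exists (c * w); rewrite ?mulrA //; apply: (usr_mul rS).
  have Le : ~ L e by case=> w Sw we; apply: nw; exists w.
  have [M maxM [LM Me]] := max_left_ideal_exists rS iL Le.
  have Mx := Jx _ maxM; case: maxM => -[MS M0 MB MM] _ _; apply: Me.
  rewrite -[e](subrK (a * x)); apply: (closed_add M0 MB); last exact: MM.
  by apply: LM; exists e; [exact: (usr_one rS) | rewrite (usr_mul1 rS)].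
split=> // L maxL; have [[LS L0 LB LM] LneS maxL'] := maxL.
apply: contrapT => Lx; pose L' := [set z | exists l a, [/\ L l, S a & z = l + a * x]].
have iL' : left_ideal S L'.
  split=> [_ [l [a [Ll Sa ->]]]||_ _ [l [a [Ll Sa ->]]] [m [c [Lm Sc ->]]]|].
  - apply: (usr_add rS); first exact: LS.
    exact: (usr_mul rS).
  - by exists 0, 0; rewrite mul0r addr0; split=> //; apply: usr_0 rS.
  - exists (l - m), (a - c); split; [exact: LB|exact: (usr_sub rS)|].
    by rewrite mulrBl opprD addrACA.
  - move=> c _ Sc [l [a [Ll Sa ->]]]; exists (c * l), (c * a).
    by split; [exact: LM|exact: (usr_mul rS)|rewrite mulrDr mulrA].
have [] := maxL' L' iL'.
- by move=> l Ll; exists l, 0; rewrite mul0r addr0; split=> //; apply: usr_0 rS.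
- move=> L'L; apply: Lx; rewrite -L'L; exists 0, e.
  by rewrite add0r (usr_mul1 rS) //; split=> //; apply: (usr_one rS).
move=> L'S; have: L' e by rewrite L'S; exact: (usr_one rS).
move=> [l [a [Ll Sa el]]]; have [w Sw we] := Jx a Sa; apply: LneS.
have Le : L e by rewrite -we el addrK; apply: LM.
by apply/seteqP; split=> // y Sy; rewrite -(usr_mulr1 rS Sy); apply: LM.
Qed.

Lemma jacobson_ideal S e : unital_subring S e -> commutative_on S ->
  two_sided S (jacobson S).
Proof.
move=> rS cS.
have JM a x : S a -> jacobson S x -> jacobson S (a * x).
  move=> Sa [Sx Jx]; split; first exact: (usr_mul rS).
  by move=> L mL; have [[_ _ _ LM] _ _] := mL; apply: LM => //; apply: Jx.
split=> // [x []//||x y [Sx Jx] [Sy Jy]|a x Sa Jx].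
- split=> [|L [[]]//]; exact: usr_0 rS.
- split=> [|L mL]; first exact: (usr_sub rS).
  by have [[_ _ LB _] _ _] := mL; apply: LB; [apply: Jx|apply: Jy].
- by have [Sx _] := Jx; rewrite cS //; apply: JM.
Qed.

(** In a commutative ring 1 - y divides 1 - y ^+ n.+1. *)
Lemma jacobson_root S e x n : unital_subring S e -> commutative_on S ->
  S x -> jacobson S (x ^+ n.+1) -> jacobson S x.
Proof.
move=> rS cS Sx /(jacobsonP _ rS cS) [_ Jx]; apply/(jacobsonP _ rS cS).
split=> // a Sa; set y := a * x; have Sy : S y by apply: (usr_mul rS).
have SX z m : S z -> S (z ^+ m.+1).
  by move=> Sz; elim: m => [|m IHm]; rewrite ?expr1 // exprS; apply: (usr_mul rS).
have SeX m : S (e * y ^+ m).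
  case: m => [|m]; first by rewrite mulr1; apply: (usr_one rS).
  by apply: (usr_mul rS); [apply: (usr_one rS)|apply: SX].
have [w Sw we] := Jx _ (SX a n Sa).
have yn : y ^+ n.+1 = a ^+ n.+1 * x ^+ n.+1.
  by apply: exprMn_comm; apply: cS.
pose g := e * \sum_(i < n.+1) y ^+ i.
have Sg : S g.
  by rewrite /g mulr_sumr; apply: (closed_sum _ (usr_0 rS) (usr_sub rS)).
exists (w * g); first exact: (usr_mul rS).
rewrite -mulrA -[RHS]we -yn; congr (w * _).
have -> : g * (e - y) = g * (1 - y) by rewrite !mulrBr (usr_mulr1 rS Sg) mulr1.
have comy : GRing.comm y (\sum_(i < n.+1) y ^+ i).
  by apply: commr_sum => i _; apply: commrX.
have yN : (\sum_(i < n.+1) y ^+ i) * (1 - y) = 1 - y ^+ n.+1.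
  by rewrite -[RHS]opprB subrX1 -(mulNr (y - 1)) opprB mulrBr mulrBl mul1r mulr1 -comy.
by rewrite /g -mulrA yN mulrBr mulr1 (usr_mul1 rS) //; apply: SX.
Qed.

(** ** Quotient rings as sets of cosets *)

Section Quotient.
Variables (S I : set A) (e : A).
Hypotheses (rS : unital_subring S e) (tI : two_sided S I).

Let I0 := ts_0 tI.
Let ID := ts_add tI.
Let IB := ts_sub tI.

Lemma qclsE x z : qcls I x z = I (z - x).
Proof.
apply: propext; split=> [[i Ii <-]|Iz]; first by rewrite addrAC subrr add0r.
by exists (z - x) => //; rewrite addrC subrK.
Qed.

Lemma qcls_refl x : qcls I x x.
Proof. by rewrite qclsE subrr. Qed.

Lemma qcls_eqP x y : qcls I x = qcls I y <-> I (x - y).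
Proof.
split=> [xy|Ixy]; first by rewrite -qclsE -xy; apply: qcls_refl.
apply/seteqP; split=> z; rewrite !qclsE => Iz.
  by rewrite -(subrK x z) -addrA; apply: ID.
by rewrite -(subrK y z) -addrA -(opprB x y); apply: IB.
Qed.

Lemma qmul_qcls x y : S x -> S y ->
  qmul I (qcls I x) (qcls I y) = qcls I (x * y).
Proof.
move=> Sx Sy; apply/seteqP; split=> z; rewrite qclsE.
  move=> [x' [y' [i [Xx Yy Ii ->]]]]; move: Xx Yy; rewrite !qclsE => Ix Iy.
  have -> : x' * y' + i - x * y = (x' - x) * (y' - y) + (x' - x) * y
      + x * (y' - y) + i.
    by rewrite -mulrDr subrK mulrBr mulrBl addrA subrK addrAC.
  apply: (ID) => //; apply: (ID); last exact: (ts_left tI).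
  apply: (ID); last exact: (ts_right tI).
  by apply: (ts_left tI) => //; apply: (ts_incl tI).
move=> Iz; exists x, y, (z - x * y).
by split=> //; try exact: qcls_refl; rewrite addrC subrK.
Qed.

Lemma quotP X : quot S I X <-> exists2 x, S x & X = qcls I x.
Proof. by split=> [[x Sx <-]|[x Sx ->]]; exists x. Qed.

Lemma qunitsP X : qunits S e I X <->
  exists x y, [/\ S x, S y, X = qcls I x, I (x * y - e) & I (y * x - e)].
Proof.
split=> [[[x Sx <-] [_ [[y Sy <-] xy yx]]]|[x [y [Sx Sy -> xy yx]]]].
  exists x, y; split=> //; apply/qcls_eqP; first by rewrite -qmul_qcls.
  by rewrite -qmul_qcls.
split; first by exists x.
exists (qcls I y); split; first by exists y.
  by rewrite qmul_qcls //; apply/qcls_eqP.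
by rewrite qmul_qcls //; apply/qcls_eqP.
Qed.

Lemma qmul_inv_closed x y z t : S x -> S y -> S z -> S t ->
  I (x * y - e) -> I (z * t - e) -> I ((x * z) * (t * y) - e).
Proof.
move=> Sx Sy Sz St xy zt.
have -> : (x * z) * (t * y) - e = x * (z * t - e) * y + (x * y - e).
  by rewrite mulrBr (usr_mulr1 rS Sx) mulrBl addrA subrK !mulrA.
apply: (ID) => //; apply: (ts_right tI) => //; exact: (ts_left tI).
Qed.

(** Stated for any subgroup of the unit group of the quotient, so that it
    applies to the homogeneous units. *)
Lemma quot_subgroup (G : set (set A)) : G `<=` qunits S e I ->
  G (qcls I e) ->
  (forall x y, S x -> S y -> G (qcls I x) -> G (qcls I y) -> G (qcls I (x * y))) ->
  (forall x y, S x -> S y -> I (x * y - e) -> I (y * x - e) ->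
     G (qcls I x) -> G (qcls I y)) ->
  is_group_on G (qmul I).
Proof.
move=> GU G1 GM GV; split.
- move=> X Y GX GY; have /qunitsP [x [_ [Sx _ eX _ _]]] := GU _ GX.
  have /qunitsP [y [_ [Sy _ eY _ _]]] := GU _ GY.
  by rewrite eX eY qmul_qcls //; apply: GM; rewrite -?eX -?eY.
- move=> X Y Z /GU /qunitsP [x [_ [Sx _ -> _ _]]] /GU /qunitsP [y [_ [Sy _ -> _ _]]].
  move=> /GU /qunitsP [z [_ [Sz _ -> _ _]]].
  by rewrite !qmul_qcls ?mulrA //; apply: (usr_mul rS).
have Se := usr_one rS.
exists (qcls I e); split=> // [_ /GU /qunitsP [x [_ [Sx _ -> _ _]]]|X GX].
  by rewrite !qmul_qcls // (usr_mul1 rS) // (usr_mulr1 rS).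
have /qunitsP [x [y [Sx Sy eX xy yx]]] := GU _ GX.
exists (qcls I y); split; first by apply: (GV x) => //; rewrite -eX.
  by rewrite eX qmul_qcls //; apply/qcls_eqP.
by rewrite eX qmul_qcls //; apply/qcls_eqP.
Qed.

Lemma qunits_qcls x : S x -> qunits S e I (qcls I x) <->
  exists2 y, S y & I (x * y - e) /\ I (y * x - e).
Proof.
move=> Sx; split=> [/qunitsP [z [y [Sz Sy /qcls_eqP xz zy yz]]]|[y Sy [xy yx]]].
  exists y => //; split.
    rewrite -(subrK (z * y) (x * y)) -addrA -mulrBl.
    by apply: (ID) => //; apply: (ts_right tI).
  rewrite -(subrK (y * z) (y * x)) -addrA -mulrBr.
  by apply: (ID) => //; apply: (ts_left tI).
by apply/qunitsP; exists x, y.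
Qed.

Lemma qunits_group : is_group_on (qunits S e I) (qmul I).
Proof.
have Se := usr_one rS; apply: quot_subgroup => //.
- by apply/qunits_qcls => //; exists e; rewrite ?(usr_mul1 rS) // subrr.
- move=> x y Sx Sy /(qunits_qcls Sx) [z Sz [xz zx]].
  move=> /(qunits_qcls Sy) [t St [yt ty]].
  apply/qunits_qcls; first exact: (usr_mul rS).
  by exists (t * z); [apply: (usr_mul rS)|split; apply: qmul_inv_closed].
- by move=> x y Sx Sy xy yx _; apply/qunits_qcls => //; exists x.
Qed.

End Quotient.
End Subrings.

(** * Comparing two quotient rings over a common image *)

(** Multiplicativity is required on S only: the Brauer homomorphism is
    multiplicative on fixed points, not on the whole group algebra. *)
Record reduction (A A3 : nzRingType) (S I : set A) (phi : A -> A3) : Prop :=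
  Reduction {
    red_sub : forall x y, S x -> S y -> phi (x - y) = phi x - phi y;
    red_mul : forall x y, S x -> S y -> phi (x * y) = phi x * phi y;
    red_ker : forall x, S x -> phi x = 0 -> I x }.

(** If phi1 and phi2 have the same image on S1 and S2 and on the ideals I1 and
    I2, which contain the kernels, then S1 / I1 and S2 / I2 are both isomorphic to
    the quotient of the common images, and this is the composite isomorphism. *)
Definition transfer (A1 A2 A3 : Type) (S2 : set A2) (phi1 : A1 -> A3)
    (phi2 : A2 -> A3) (X : set A1) : set A2 :=
  [set y | S2 y /\ exists2 x, X x & phi1 x = phi2 y].

Section Transfer.
Variables (A1 A2 A3 : nzRingType) (S1 I1 : set A1) (S2 I2 : set A2).
Variables (e1 : A1) (e2 : A2) (phi1 : A1 -> A3) (phi2 : A2 -> A3).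
Hypotheses (rS1 : unital_subring S1 e1) (rS2 : unital_subring S2 e2).
Hypotheses (tI1 : two_sided S1 I1) (tI2 : two_sided S2 I2).
Hypotheses (r1 : reduction S1 I1 phi1) (r2 : reduction S2 I2 phi2).
Hypotheses (eqS : phi1 @` S1 = phi2 @` S2) (eqI : phi1 @` I1 = phi2 @` I2).
Hypothesis eqe : phi1 e1 = phi2 e2.

Let tr := transfer S2 phi1 phi2.

Lemma match12 x : S1 x -> exists2 y, S2 y & phi1 x = phi2 y.
Proof.
move=> Sx; have [y Sy xy] : (phi2 @` S2) (phi1 x) by rewrite -eqS; exists x.
by exists y.
Qed.

Lemma transfer_qcls x y : S1 x -> S2 y -> phi1 x = phi2 y ->
  tr (qcls I1 x) = qcls I2 y.
Proof.
move=> Sx Sy xy; apply/seteqP; split=> z.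
  move=> [Sz [x' + xz]]; rewrite !qclsE => Ix.
  have Sx' : S1 x' by rewrite -(subrK x x'); apply: (usr_add rS1) => //; apply: (ts_incl tI1).
  have [i Ii zi] : (phi2 @` I2) (phi2 (z - y)).
    by rewrite -eqI; exists (x' - x) => //; rewrite (red_sub r1) // (red_sub r2) // xz xy.
  rewrite -(subrK i (z - y)); apply: (ts_add tI2) => //.
  have Si := ts_incl tI2 Ii; have Szy := usr_sub rS2 Sz Sy.
  apply: (red_ker r2); first exact: (usr_sub rS2).
  by rewrite (red_sub r2) // zi subrr.
rewrite qclsE => Iz.
have Sz : S2 z by rewrite -(subrK y z); apply: (usr_add rS2) => //; apply: (ts_incl tI2).
split=> //; have [i Ii zi] : (phi1 @` I1) (phi2 (y - z)).
  by rewrite eqI; exists (y - z) => //; rewrite -opprB; apply: (ts_opp tI2).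
exists (x - i); first by rewrite qclsE addrAC subrr add0r; apply: (ts_opp tI1).
by rewrite (red_sub r1) //; [rewrite zi (red_sub r2) // xy subKr | apply: (ts_incl tI1)].
Qed.

Lemma transfer_quot X : quot S1 I1 X -> quot S2 I2 (tr X).
Proof.
move=> [x Sx <-]; have [y Sy xy] := match12 Sx.
by rewrite (transfer_qcls Sx Sy xy); exists y.
Qed.

Lemma transfer_qmul X Y : quot S1 I1 X -> quot S1 I1 Y ->
  tr (qmul I1 X Y) = qmul I2 (tr X) (tr Y).
Proof.
move=> [x Sx <-] [y Sy <-]; rewrite (qmul_qcls tI1) //.
have [x' Sx' xx] := match12 Sx; have [y' Sy' yy] := match12 Sy.
rewrite (transfer_qcls Sx Sx' xx) (transfer_qcls Sy Sy' yy) (qmul_qcls tI2) //.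
apply: transfer_qcls; [exact: (usr_mul rS1)|exact: (usr_mul rS2)|].
by rewrite (red_mul r1) // (red_mul r2) // xx yy.
Qed.

Lemma transfer_qunits X : qunits S1 e1 I1 X -> qunits S2 e2 I2 (tr X).
Proof.
move=> [qX [Y [qY XY YX]]]; split; first exact: transfer_quot.
have tre : tr (qcls I1 e1) = qcls I2 e2.
  by apply: transfer_qcls => //; [case: rS1|case: rS2].
exists (tr Y); split; first exact: transfer_quot.
  by rewrite -transfer_qmul // XY.
by rewrite -transfer_qmul // YX.
Qed.

End Transfer.

Section TransferBij.
Variables (A1 A2 A3 : nzRingType) (S1 I1 : set A1) (S2 I2 : set A2).
Variables (e1 : A1) (e2 : A2) (phi1 : A1 -> A3) (phi2 : A2 -> A3).
Hypotheses (rS1 : unital_subring S1 e1) (rS2 : unital_subring S2 e2).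
Hypotheses (tI1 : two_sided S1 I1) (tI2 : two_sided S2 I2).
Hypotheses (r1 : reduction S1 I1 phi1) (r2 : reduction S2 I2 phi2).
Hypotheses (eqS : phi1 @` S1 = phi2 @` S2) (eqI : phi1 @` I1 = phi2 @` I2).

Lemma transferK X : quot S1 I1 X ->
  transfer S1 phi2 phi1 (transfer S2 phi1 phi2 X) = X.
Proof.
move=> [x Sx <-]; have [y Sy xy] := match12 eqS Sx.
rewrite (transfer_qcls rS1 rS2 tI1 tI2 r1 r2 eqI Sx Sy xy).
by rewrite (transfer_qcls rS2 rS1 tI2 tI1 r2 r1 (esym eqI) Sy Sx (esym xy)).
Qed.

End TransferBij.

Lemma transfer_bij (A1 A2 A3 : nzRingType) (S1 I1 : set A1) (S2 I2 : set A2)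
    (e1 : A1) (e2 : A2) (phi1 : A1 -> A3) (phi2 : A2 -> A3)
    (G1 : set (set A1)) (G2 : set (set A2)) :
  unital_subring S1 e1 -> unital_subring S2 e2 ->
  two_sided S1 I1 -> two_sided S2 I2 ->
  reduction S1 I1 phi1 -> reduction S2 I2 phi2 ->
  phi1 @` S1 = phi2 @` S2 -> phi1 @` I1 = phi2 @` I2 ->
  G1 `<=` quot S1 I1 -> G2 `<=` quot S2 I2 ->
  (forall X, G1 X -> G2 (transfer S2 phi1 phi2 X)) ->
  (forall X, G2 X -> G1 (transfer S1 phi2 phi1 X)) ->
  set_bij G1 G2 (transfer S2 phi1 phi2).
Proof.
move=> rS1 rS2 tI1 tI2 r1 r2 eqS eqI GS1 GS2 G12 G21; split=> //.
  move=> X Y /set_mem GX /set_mem GY XY.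
  rewrite -(transferK rS1 rS2 tI1 tI2 r1 r2 eqS eqI (GS1 _ GX)) XY.
  exact: (transferK rS1 rS2 tI1 tI2 r1 r2 eqS eqI (GS1 _ GY)).
move=> Y GY; exists (transfer S1 phi2 phi1 Y); first exact: G21.
exact: (transferK rS2 rS1 tI2 tI1 r2 r1 (esym eqS) (esym eqI) (GS2 _ GY)).
Qed.

(** * Graded rings whose identity component is commutative *)

(** Only the degrees in St are constrained, since components of the block
    extensions at degrees that do not stabilise the block need not multiply
    into each other. *)
Record grading (A : nzRingType) (gT : finGroupType) (e : A) (B : gT -> set A)
    (St : {set gT}) : Prop := Grading {
  gr_0 : forall s, s \in St -> B s 0;
  gr_sub : forall s x y, s \in St -> B s x -> B s y -> B s (x - y);
  gr_mul : forall s t x y, s \in St -> t \in St -> B s x -> B t y ->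
    B (s * t)%g (x * y);
  gr_one : B 1%g e;
  gr_mul1 : forall s x, s \in St -> B s x -> e * x = x;
  gr_mulr1 : forall s x, s \in St -> B s x -> x * e = x;
  gr_comm : commutative_on (B 1%g);
  gr_direct : forall c : gT -> A, (forall s, s \in St -> B s (c s)) ->
    \sum_(s in St) c s = 0 -> forall s, s \in St -> c s = 0 }.

Section Grading.
Variables (A : nzRingType) (gT : finGroupType) (e : A) (B : gT -> set A).
Variable St : {group gT}.
Hypothesis gB : grading e B St.

Let supp := gr_supp B St.
Let J := jacobson (B 1%g).
Let T := gr_sum B St.
Let I := gr_ideal B St.

Lemma gr_opp s x : s \in St -> B s x -> B s (- x).
Proof. by move=> Ss Bx; rewrite -sub0r; apply: (gr_sub gB) => //; apply: (gr_0 gB). Qed.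

Lemma gr_add s x y : s \in St -> B s x -> B s y -> B s (x + y).
Proof. by move=> Ss Bx By; rewrite -[y]opprK; apply: (gr_sub gB) => //; apply: gr_opp. Qed.

Lemma gr_mulV s x y : s \in St -> B s x -> B s^-1%g y -> B 1%g (x * y).
Proof. by move=> Ss Bx By; rewrite -(mulgV s); apply: (gr_mul gB); rewrite ?groupV. Qed.

Lemma gr_Vmul s x y : s \in St -> B s^-1%g x -> B s y -> B 1%g (x * y).
Proof. by move=> Ss Bx By; rewrite -(mulVg s); apply: (gr_mul gB); rewrite ?groupV. Qed.

Lemma gr_act s x y : s \in St -> B 1%g x -> B s y -> B s (x * y).
Proof. by move=> Ss Bx By; rewrite -(mul1g s); apply: (gr_mul gB). Qed.

Lemma gr_ract s x y : s \in St -> B 1%g x -> B s y -> B s (y * x).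
Proof. by move=> Ss Bx By; rewrite -(mulg1 s); apply: (gr_mul gB). Qed.

Lemma gr1_subring : unital_subring (B 1%g) e.
Proof.
split; first by move=> x y; apply: (gr_sub gB).
- by move=> x y; apply: (gr_act).
- exact: (gr_one gB).
- by move=> x; apply: (gr_mul1 gB).
- by move=> x; apply: (gr_mulr1 gB).
Qed.
Let rB := gr1_subring.

Lemma gr_jacobson_ideal : two_sided (B 1%g) J.
Proof. exact: jacobson_ideal rB (gr_comm gB). Qed.
Let tJ := gr_jacobson_ideal.

(** The products of B s and B s^-1 span an ideal of B 1, which is the whole of
    B 1 as soon as it contains e. *)
Lemma mem_gr_supp s : (s \in supp) <-> s \in St /\ setprod (B s) (B s^-1%g) e.
Proof.
rewrite inE; split=> [/andP[Ss /asboolP ->]|[Ss Be]].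
  by split=> //; exact: (gr_one gB).
rewrite Ss; apply/asboolP/seteqP; split.
  apply: setprod_ind => [|x y|x y]; first exact: (usr_0 rB).
    exact: (usr_add rB).
  exact: gr_mulV.
move=> z Bz; rewrite -(gr_mulr1 gB (group1 St) Bz).
move: Be => [n [x [y [Bx By ->]]]]; exists n, (fun i => z * x i), y; split=> //.
  by move=> i; apply: gr_act.
by rewrite mulr_sumr; apply: eq_bigr => i _; rewrite mulrA.
Qed.

Lemma supp_sub s : s \in supp -> s \in St.
Proof. by rewrite inE => /andP[]. Qed.

Lemma gr_supp_group_set : group_set supp.
Proof.
apply/group_setP; split.
  apply/mem_gr_supp; split=> //; rewrite invg1 -[X in setprod _ _ X](gr_mul1 gB (group1 St) (gr_one gB)).
  by apply: setprod_mul; apply: (gr_one gB).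
move=> s t /mem_gr_supp [Ss es] /mem_gr_supp [St' et]; apply/mem_gr_supp.
split; first exact: groupM.
pose V := setprod (B (s * t)%g) (B (s * t)^-1%g).
have VM x z y : B s x -> B s^-1%g y -> setprod (B t) (B t^-1%g) z -> V (x * z * y).
  move=> Bx By; apply: (@setprod_ind _ _ _ [set z | V (x * z * y)]) => /=.
  - by rewrite mulr0 mul0r; apply: setprod0.
  - by move=> z1 z2 V1 V2; rewrite mulrDr mulrDl; apply: setprod_add.
  - move=> u v Bu Bv; rewrite mulrA -mulrA; apply: setprod_mul.
      exact: (gr_mul gB).
    by rewrite invMg; apply: (gr_mul gB); rewrite ?groupV.
move: es; apply: setprod_ind; [exact: setprod0|by move=> *; apply: setprod_add|].
move=> x y Bx By; rewrite -(gr_mulr1 gB Ss Bx); exact: VM.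
Qed.
Let suppG := Group gr_supp_group_set.

Lemma supp1 : 1%g \in supp. Proof. exact: (group1 suppG). Qed.
Lemma suppM s t : s \in supp -> t \in supp -> (s * t)%g \in supp.
Proof. exact: (@groupM _ suppG). Qed.
Lemma suppV s : s \in supp -> s^-1%g \in supp.
Proof. by move=> ss; rewrite (@groupV _ suppG). Qed.

(** ** The sum of the components *)

Lemma gr_sum_in s x : s \in supp -> B s x -> T x.
Proof.
move=> ss Bx; exists (fun t => if t == s then x else 0); split=> [t st|].
  by case: eqP => [->//|_]; apply: (gr_0 gB); apply: supp_sub.
rewrite (bigD1 s) //= eqxx big1 ?addr0 // => t /andP[_ /negPf ->] //.
Qed.

Lemma gr_sum_0 : T 0.
Proof. by apply: (gr_sum_in supp1); apply: (gr_0 gB). Qed.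

Lemma gr_sum_sub x y : T x -> T y -> T (x - y).
Proof.
move=> [c [Bc ->]] [d [Bd ->]]; exists (fun s => c s - d s); split=> [s ss|].
  by apply: (gr_sub gB (supp_sub ss)); [apply: Bc|apply: Bd].
by rewrite sumrB.
Qed.

Lemma gr_sum_ind (V : set A) : V 0 -> (forall x y, V x -> V y -> V (x + y)) ->
  (forall s x, s \in supp -> B s x -> V x) -> T `<=` V.
Proof.
move=> V0 VD VB _ [c [Bc ->]]; apply: big_ind => // s ss.
by apply: (VB s) => //; apply: Bc.
Qed.

Lemma gr_sum_subring : unital_subring T e.
Proof.
split; first exact: gr_sum_sub.
- move=> x y Tx; move: y; apply: gr_sum_ind => [|y z|t y st By].
  + by rewrite mulr0; apply: gr_sum_0.
  + by rewrite mulrDr; apply: (closed_add gr_sum_0 gr_sum_sub).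
  + move: x Tx; apply: gr_sum_ind => [|x z|s x ss Bx].
    * by rewrite mul0r; apply: gr_sum_0.
    * by rewrite mulrDl; apply: (closed_add gr_sum_0 gr_sum_sub).
    * by apply: (gr_sum_in (suppM ss st)); apply: (gr_mul gB) => //; apply: supp_sub.
- by apply: (gr_sum_in supp1); apply: (gr_one gB).
- apply: gr_sum_ind => [|x y ex ey|s x ss Bx]; first by rewrite mulr0.
    by rewrite mulrDr ex ey.
  by apply: (gr_mul1 gB _ Bx); apply: supp_sub.
- apply: gr_sum_ind => [|x y ex ey|s x ss Bx]; first by rewrite mul0r.
    by rewrite mulrDl ex ey.
  by apply: (gr_mulr1 gB _ Bx); apply: supp_sub.
Qed.
Let rT := gr_sum_subring.

Lemma gr_components (c d : gT -> A) :
  (forall s, s \in supp -> B s (c s)) -> (forall s, s \in supp -> B s (d s)) ->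
  \sum_(s in supp) c s = \sum_(s in supp) d s -> {in supp, c =1 d}.
Proof.
move=> Bc Bd cd s ss; apply/eqP; rewrite -subr_eq0; apply/eqP.
pose f t := if t \in supp then c t - d t else 0.
have <- : f s = c s - d s by rewrite /f ss.
apply: (gr_direct gB) => [t Stt||]; last exact: supp_sub.
  rewrite /f; case: ifP => st; last exact: (gr_0 gB).
  by apply: (gr_sub gB) => //; [apply: Bc|apply: Bd].
rewrite /f -big_mkcondr /= (eq_bigl (mem supp)) => [|t]; last first.
  by rewrite /= andb_idl //; apply: supp_sub.
by rewrite sumrB cd subrr.
Qed.

(** ** The ideal generated by the radical of the identity component *)

(** For x of degree s and v of degree s^-1, if w is an inverse of e - v x, then
    e + x w v is an inverse of e - x v. *)
Lemma jacobson_conj s u j v : s \in St -> B s u -> J j -> B s^-1%g v ->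
  J (u * j * v).
Proof.
move=> Ss Bu Jj Bv; have [Bj uj] := (jacobsonP _ rB (gr_comm gB)).1 Jj.
have SV : s^-1%g \in St by rewrite groupV.
apply/(jacobsonP _ rB (gr_comm gB)); split=> [|a Ba].
  by apply: (gr_mulV Ss) => //; apply: gr_ract.
pose x := a * u * j.
have Bau : B s (a * u) by apply: gr_act.
have Bx : B s x by apply: gr_ract.
have [w Bw we] := uj _ (gr_Vmul Ss Bv Bau).
have {}we : w * (e - v * x) = e by rewrite -[RHS]we /x !mulrA.
have Bxw : B s (x * w) by apply: gr_ract.
have B1e := gr_one gB.
exists (e + x * w * v); first exact: (usr_add rB B1e (gr_mulV Ss Bxw Bv)).
rewrite !mulrA -/x mulrBr mulrDl (gr_mul1 gB _ B1e) //.
rewrite (gr_mulr1 gB _ (gr_mulV Ss Bxw Bv)) //.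
have -> : (e + x * w * v) * (x * v) = x * v + x * (w * (v * x)) * v.
  by rewrite mulrDl (gr_mul1 gB _ (gr_mulV Ss Bx Bv)) // !mulrA.
move: we; rewrite mulrBr (gr_mulr1 gB _ Bw) // => /(canRL (subrK _)) we.
rewrite {1}we mulrDr mulrDl (gr_mulr1 gB Ss Bx).
by rewrite opprD addrA [x * v + _]addrC addrA !addrK.
Qed.

Lemma gr_ideal_two_sided : two_sided T I.
Proof.
have TN := usr_opp rT.
have I0 : I 0 by apply: setprod0.
have IB x y : I x -> I y -> I (x - y) by apply: setprod_sub.
have ID x y : I x -> I y -> I (x + y) by apply: setprod_add.
have JT x : J x -> T x by move=> Jx; apply: (gr_sum_in supp1); apply: (ts_incl tJ).
split=> //.
- apply: setprod_ind => [|x y|x y Tx /JT Ty]; first exact: (usr_0 rT).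
    exact: (usr_add rT).
  exact: (usr_mul rT).
- move=> a x Ta; move: x; apply: setprod_ind => [|x y Ix Iy|x j Tx Jj].
  + by rewrite mulr0.
  + by rewrite mulrDr; apply: ID.
  + by rewrite mulrA; apply: setprod_mul => //; apply: (usr_mul rT).
- move=> a x Ta; move: x; apply: setprod_ind => [|x y Ix Iy|x j Tx Jj].
  + by rewrite mul0r.
  + by rewrite mulrDl; apply: ID.
  + rewrite -mulrA; move: a Ta; apply: gr_sum_ind => [|a b Ia Ib|s a ss Ba].
    * by rewrite !mulr0.
    * by rewrite !mulrDr; apply: ID.
    * have Ss := supp_sub ss; have Bj := ts_incl tJ Jj.
      rewrite -(gr_mul1 gB Ss (gr_act Ss Bj Ba)).
      have [_ se] := (mem_gr_supp s).1 ss; move: se.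
      apply: (@setprod_ind _ _ _ [set z | I (x * (z * (j * a)))]) => /=.
      - by rewrite mul0r mulr0.
      - by move=> z t Iz It; rewrite mulrDl mulrDr; apply: ID.
      - move=> u v Bu Bv; rewrite -mulrA mulrA; apply: setprod_mul.
          by apply: (usr_mul rT) => //; apply: (gr_sum_in ss).
        rewrite mulrA; apply: (@jacobson_conj s^-1%g); rewrite ?invgK //.
        by rewrite groupV.
Qed.
Let tI := gr_ideal_two_sided.

(** The ideal is graded, with component setprod (B s) J in degree s. *)
Lemma gr_ideal_components z : I z -> exists c : gT -> A,
  (forall s, s \in supp -> setprod (B s) J (c s)) /\ z = \sum_(s in supp) c s.
Proof.
apply: (@setprod_ind _ _ _ [set z | exists c : gT -> A,
  (forall s, s \in supp -> setprod (B s) J (c s)) /\ z = \sum_(s in supp) c s]).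
- by exists (fun=> 0); rewrite big1 //; split=> // *; apply: setprod0.
- move=> x y [c [Ic ->]] [d [Id ->]]; exists (fun s => c s + d s).
  by rewrite big_split; split=> // s ss; apply: setprod_add; [apply: Ic|apply: Id].
- move=> _ j [c [Bc ->]] Jj; exists (fun s => c s * j).
  by rewrite mulr_suml; split=> // s ss; apply: setprod_mul => //; apply: Bc.
Qed.

Lemma setprod_jacobson_sub s : s \in supp -> setprod (B s) J `<=` B s.
Proof.
move=> ss; have Ss := supp_sub ss.
apply: setprod_ind => [|x y|x j Bx Jj]; first exact: (gr_0 gB).
  exact: gr_add.
by apply: gr_ract => //; apply: (ts_incl tJ).
Qed.

Lemma gr_ideal_homog s z : s \in supp -> B s z -> I z -> setprod (B s) J z.
Proof.
move=> ss Bz /gr_ideal_components [c [Ic zc]].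
pose d t := if t == s then z else 0.
have dz : z = \sum_(t in supp) d t.
  by rewrite (bigD1 s) //= /d eqxx big1 ?addr0 // => t /andP[_ /negPf ->].
have Bc t : t \in supp -> B t (c t).
  by move=> st; apply: (setprod_jacobson_sub st); apply: Ic.
have Bd t : t \in supp -> B t (d t).
  move=> st; rewrite /d; case: eqP => [->//|_].
  by apply: (gr_0 gB); apply: supp_sub.
have := gr_components Bd Bc; rewrite -dz -zc => /(_ erefl s ss).
by rewrite /d eqxx => ->; apply: Ic.
Qed.

Lemma gr_ideal_1 z : B 1%g z -> I z <-> J z.
Proof.
move=> Bz; split=> [/(gr_ideal_homog supp1 Bz)|Jz].
  apply: setprod_ind => [|x y|x j Bx Jj]; first exact: (ts_0 tJ).
    exact: (ts_add tJ).
  exact: (ts_left tJ).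
rewrite -(gr_mul1 gB (group1 St) Bz); apply: setprod_mul => //.
by apply: (gr_sum_in supp1); apply: (gr_one gB).
Qed.

(** ** Homogeneous units *)

Lemma gr_ideal_component (d : gT -> A) : (forall s, s \in supp -> B s (d s)) ->
  I (\sum_(s in supp) d s) -> forall s, s \in supp -> I (d s).
Proof.
move=> Bd /gr_ideal_components [c [Ic dc]] s ss.
have Bc t : t \in supp -> B t (c t).
  by move=> st; apply: (setprod_jacobson_sub st); apply: Ic.
rewrite (gr_components Bd Bc dc ss); move: (Ic s ss).
apply: setprod_ind => [|x y|x j Bx Jj]; first exact: (ts_0 tI).
  exact: (ts_add tI).
by apply: setprod_mul => //; apply: (gr_sum_in ss).
Qed.

(** The inverse of a homogeneous unit of degree s can be replaced by its
    component of degree s^-1. *)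
Lemma homog_unit_inverse s c : s \in supp -> B s c -> qunits T e I (qcls I c) ->
  exists v, [/\ B s^-1%g v, J (c * v - e) & J (v * c - e)].
Proof.
move=> ss Bc /(qunits_qcls e tI (gr_sum_in ss Bc)) [_ [y [By ->]] [cy yc]].
have Ss := supp_sub ss.
pose d (t : gT) := if t == 1%g then e else 0.
have Bd t : t \in supp -> B t (d t).
  move=> st; rewrite /d; case: eqP => [->|_]; first exact: (gr_one gB).
  by apply: (gr_0 gB); apply: supp_sub.
have ed : e = \sum_(t in supp) d t.
  rewrite (bigD1 1%g) ?supp1 //= /d eqxx big1 ?addr0 // => t.
  by case/andP=> _ /negPf ->.
have sV := suppV ss; exists (y s^-1%g); split; first exact: By.
- have Bf t : t \in supp -> B t (c * y (s^-1 * t)%g - d t).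
    move=> st; apply: (gr_sub gB (supp_sub st)); last exact: Bd.
    rewrite -[X in B X _](mulKVg s); apply: (gr_mul gB) => //.
      by apply: supp_sub; apply: suppM.
    by apply: By; apply: suppM.
  have := gr_ideal_component Bf _ supp1; rewrite mulg1 /d eqxx => If.
  apply/gr_ideal_1.
    by apply: (gr_sub gB) => //; [apply: (gr_mulV Ss) => //; apply: By|apply: (gr_one gB)].
  apply: If; rewrite sumrB -ed; congr (I (_ - e)): cy.
  rewrite mulr_sumr (reindex_inj (mulgI s^-1%g)) /=; apply: eq_bigl => t.
  exact: (@groupMl _ suppG _ _ sV).
- have Bf t : t \in supp -> B t (y (t * s^-1)%g * c - d t).
    move=> st; apply: (gr_sub gB (supp_sub st)); last exact: Bd.
    rewrite -[X in B X _](mulgKV s); apply: (gr_mul gB) => //.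
      by apply: supp_sub; apply: suppM.
    by apply: By; apply: suppM.
  have := gr_ideal_component Bf _ supp1; rewrite mul1g /d eqxx => If.
  apply/gr_ideal_1.
    by apply: (gr_sub gB) => //; [apply: (gr_Vmul Ss) => //; apply: By|apply: (gr_one gB)].
  apply: If; rewrite sumrB -ed; congr (I (_ - e)): yc.
  rewrite mulr_suml (reindex_inj (mulIg s^-1%g)) /=; apply: eq_bigl => t.
  exact: (@groupMr _ suppG _ _ sV).
Qed.

Lemma homog_unit_intro s c v : s \in supp -> B s c -> B s^-1%g v ->
  J (c * v - e) -> J (v * c - e) -> gr_hU e B St (qcls I c).
Proof.
move=> ss Bc Bv cv vc; have Ss := supp_sub ss; have B1e := gr_one gB.
split; last by exists s; split=> //; exists c.
apply/(qunits_qcls e tI (gr_sum_in ss Bc)).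
exists v; first by apply: (gr_sum_in (suppV ss)).
split; apply/gr_ideal_1 => //; apply: (gr_sub gB) => //.
  exact: (gr_mulV Ss).
exact: (gr_Vmul Ss).
Qed.

Lemma homog_unitP X : gr_hU e B St X -> exists s c v,
  [/\ s \in supp, B s c, B s^-1%g v, X = qcls I c & J (c * v - e) /\ J (v * c - e)].
Proof.
move=> [UX [s [ss [c Bc XE]]]].
have XE' : X = qcls I c by [].
rewrite XE' in UX; have [v [Bv cv vc]] := homog_unit_inverse ss Bc UX.
by exists s, c, v.
Qed.

Hypothesis e0 : e <> 0.

Lemma not_jacobson_one : ~ J e.
Proof.
move=> /(jacobsonP _ rB (gr_comm gB)) [B1e /(_ e B1e) [w _]].
by rewrite (usr_mul1 rB B1e) subrr mulr0 => /esym.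
Qed.

(** A difference of two elements of distinct degrees lies in the graded ideal
    only if both of them do, and units do not. *)
Lemma gr_homog_inj X s t : gr_hU e B St X ->
  gr_homog B St s X -> gr_homog B St t X -> s = t.
Proof.
move=> [UX _] [ss [c Bc XE]] [st [c' Bc' XE']].
apply: contrapT => /eqP sNt; apply: not_jacobson_one.
have XE1 : X = qcls I c by [].
rewrite XE1 in UX; have [v [Bv cv _]] := homog_unit_inverse ss Bc UX.
pose d u := if u == s then c else if u == t then - c' else 0.
have Bd u : u \in supp -> B u (d u).
  move=> su; have Su := supp_sub su; rewrite /d; case: eqP => [->//|_].
  by case: eqP => [->|_]; [apply: gr_opp => //; apply: supp_sub|apply: (gr_0 gB)].
have Icc' : I (c - c').
  by apply/(qcls_eqP tI); rewrite -XE1 XE'.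
have := gr_ideal_component Bd _ ss; rewrite /d eqxx => Ic.
have {}Ic : I c.
  apply: Ic; rewrite (bigD1 s) //= eqxx (bigD1 t) /=; last by rewrite st eq_sym.
  rewrite eq_sym (negPf sNt) eqxx big1 ?addr0 // => u /andP[/andP[_ us] ut].
  by rewrite (negPf us) (negPf ut).
have Bcv := gr_mulV (supp_sub ss) Bc Bv.
have Jcv : J (c * v).
  apply/gr_ideal_1 => //; apply: (ts_right tI) => //.
  by apply: (gr_sum_in (suppV ss)).
by rewrite -[e](subKr (c * v)); apply: (ts_sub tJ).
Qed.

Lemma gr_deg_qcls s c : s \in supp -> B s c -> gr_hU e B St (qcls I c) ->
  gr_deg B St (qcls I c) = s.
Proof.
move=> ss Bc UX; have Hs : gr_homog B St s (qcls I c) by split=> //; exists c.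
by apply: (gr_homog_inj UX) => //; apply: (@xgetPex _ 1%g (fun s => gr_homog B St s _)); exists s.
Qed.

Lemma qlift_qcls x : qlift I (qcls J x) = qcls I x.
Proof.
apply/seteqP; split=> z; rewrite qclsE.
  move=> [y [i [+ Ii ->]]]; rewrite qclsE => Jxy.
  rewrite addrAC; apply: (ts_add tI) => //; apply/gr_ideal_1 => //.
  exact: (ts_incl tJ).
move=> Iz; exists x, (z - x); split=> //; first by apply: (qcls_refl tJ).
by rewrite addrC subrK.
Qed.

(** The element e - v u of the commutative ring B 1 annihilates B s, hence also
    setprod (B s^-1) (B s), which contains e. *)
Lemma homog_one_sided s u v : s \in supp -> B s u -> B s^-1%g v ->
  u * v = e -> v * u = e.
Proof.
move=> ss Bu Bv uv; have Ss := supp_sub ss; have B1e := gr_one gB.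
have Bf := gr_Vmul Ss Bv Bu; set f := v * u in Bf *.
have Bef : B 1%g (e - f) by apply: (gr_sub gB).
have uf : u * (e - f) = 0.
  by rewrite mulrBr (gr_mulr1 gB Ss Bu) /f mulrA uv (gr_mul1 gB Ss Bu) subrr.
have xf x : B s x -> x * (e - f) = 0.
  move=> Bx; have -> : x * (e - f) = u * (v * x * (e - f)).
    by rewrite !mulrA uv (gr_mul1 gB Ss Bx).
  by rewrite (gr_comm gB (gr_Vmul Ss Bv Bx) Bef) mulrA uf mul0r.
apply/esym/eqP; rewrite -subr_eq0 -[e - f](gr_mul1 gB (group1 St) Bef); apply/eqP.
have [_] := (mem_gr_supp s^-1%g).1 (suppV ss); rewrite invgK.
apply: (@setprod_ind _ _ _ [set z | z * (e - f) = 0]) => /= [|x y ex ey|x y Bx By].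
- by rewrite mul0r.
- by rewrite mulrDl ex ey addr0.
- by rewrite -mulrA (xf y By) mulr0.
Qed.

Hypothesis crossed : forall s, s \in supp ->
  exists u v, [/\ B s u, B s^-1%g v & u * v = e].

(** The hypothesis crossed gives the surjectivity of the degree map, and e <> 0
    makes degrees of homogeneous units unique. *)
Theorem gr_is_extension : is_extension (gr_ext e B St).
Proof.
have B1e := gr_one gB; have ss1 := supp1.
have kerP X : qunits (B 1%g) e J X -> exists x v,
  [/\ B 1%g x, B 1%g v, X = qcls J x, J (x * v - e) & J (v * x - e)].
  by move/(qunitsP _ tJ).
have hU1 x v : B 1%g x -> B 1%g v -> J (x * v - e) -> J (v * x - e) ->
  gr_hU e B St (qcls I x).
  by move=> Bx Bv; apply: (@homog_unit_intro 1%g x v); rewrite ?invg1.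
have hUM s t c d : s \in supp -> t \in supp -> B s c -> B t d ->
  gr_hU e B St (qcls I c) -> gr_hU e B St (qcls I d) ->
  gr_hU e B St (qcls I (c * d)).
  move=> ss st Bc Bd [Uc _] [Ud _]; split; last first.
    exists (s * t)%g; split; first exact: suppM.
    by exists (c * d) => //; apply: (gr_mul gB) => //; apply: supp_sub.
  rewrite -(qmul_qcls tI (gr_sum_in ss Bc) (gr_sum_in st Bd)).
  by have [+ _ _] := qunits_group rT tI; apply.
split.
- split; [exact: (qunits_group rB tJ)| |exact: gr_supp_group_set].
  apply: (quot_subgroup rT tI) => [X []//||x y Tx Ty|x y Tx Ty xy yx].
  + apply: (hU1 e e) => //; rewrite (gr_mul1 gB _ B1e) // subrr; exact: (ts_0 tJ).
  + move=> Hx Hy; have [s [c [_ [ss Bc _ Ec _]]]] := homog_unitP Hx.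
    have [t [d [_ [st Bd _ Ed _]]]] := homog_unitP Hy.
    rewrite -(qmul_qcls tI) // Ec Ed (qmul_qcls tI (gr_sum_in ss Bc) (gr_sum_in st Bd)).
    by apply: (hUM s t); rewrite -?Ec -?Ed.
  + move=> Hx; have [s [c [v [ss Bc Bv Ec [cv vc]]]]] := homog_unitP Hx.
    have Tc := gr_sum_in ss Bc; have Tv := gr_sum_in (suppV ss) Bv.
    have Hv : gr_hU e B St (qcls I v).
      by apply: (@homog_unit_intro s^-1%g v c); rewrite ?invgK //; apply: suppV.
    have -> : qcls I y = qcls I v; last by [].
    have Ixc : I (x - c) by apply/(qcls_eqP tI).
    have IJ z : J z -> I z.
      by move=> Jz; apply/gr_ideal_1 => //; apply: (ts_incl tJ).
    apply/(qcls_eqP tI).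
    have -> : y - v = v * (x * y - e) - (v * (x - c) * y + (v * c - e) * y).
      rewrite mulrBr (usr_mulr1 rT Tv) mulrBr mulrBl mulrBl (usr_mul1 rT Ty).
      by rewrite addrA subrK !mulrA opprB addrCA addrAC subrr sub0r.
    apply: (ts_sub tI); first exact: (ts_left tI).
    apply: (ts_add tI); apply: (ts_right tI) => //; last exact: IJ.
    exact: (ts_left tI).
- move=> X Y /kerP [x [_ [Bx _ -> _ _]]] /kerP [y [_ [By _ -> _ _]]] /=.
  rewrite (qmul_qcls tJ) // !qlift_qcls (qmul_qcls tI) //; exact: (gr_sum_in ss1).
- move=> X Y /= HX HY.
  have [s [c [_ [ss Bc _ EX _]]]] := homog_unitP HX.
  have [t [d [_ [st Bd _ EY _]]]] := homog_unitP HY.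
  rewrite EX in HX *; rewrite EY in HY *.
  rewrite (qmul_qcls tI (gr_sum_in ss Bc) (gr_sum_in st Bd)).
  rewrite (gr_deg_qcls ss Bc HX) (gr_deg_qcls st Bd HY).
  apply: gr_deg_qcls; [exact: suppM| |exact: (hUM s t)].
  by apply: (gr_mul gB) => //; apply: supp_sub.
- move=> X Y /set_mem /kerP [x [_ [Bx _ -> _ _]]] /set_mem /kerP [y [_ [By _ -> _ _]]] /=.
  rewrite !qlift_qcls => /(qcls_eqP tI) Ixy; apply/(qcls_eqP tJ).
  by apply/gr_ideal_1 => //; apply: (gr_sub gB).
split; apply/seteqP; split.
- move=> _ [_ /kerP [x [v [Bx Bv -> xv vx]]] <-] /=; rewrite qlift_qcls.
  have Hx := hU1 _ _ Bx Bv xv vx; split=> //; exact: gr_deg_qcls.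
- move=> X /= [HX dX]; have [s [c [v [ss Bc Bv EX [cv vc]]]]] := homog_unitP HX.
  move: dX; rewrite EX in HX *; rewrite (gr_deg_qcls ss Bc HX) => s1.
  rewrite s1 in Bc; rewrite s1 invg1 in Bv.
  by exists (qcls J c); [apply/(qunitsP _ tJ); exists c, v|rewrite qlift_qcls].
- move=> _ [X HX <-] /=; have [s [c [v [ss Bc Bv EX _]]]] := homog_unitP HX.
  by rewrite EX in HX *; rewrite (gr_deg_qcls ss Bc HX).
- move=> s /= ss; have [u [v [Bu Bv uv]]] := crossed ss.
  have vu := homog_one_sided ss Bu Bv uv.
  have Hu : gr_hU e B St (qcls I u).
    by apply: (homog_unit_intro ss Bu Bv); rewrite ?uv ?vu subrr; apply: (ts_0 tJ).
  by exists (qcls I u) => //; apply: gr_deg_qcls.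
Qed.

End Grading.

(** * Graded rings with the same homogeneous images *)

Record graded_reduction (A A3 : nzRingType) (gT : finGroupType)
    (B : gT -> set A) (St : {set gT}) (phi : A -> A3) : Prop :=
  GradedReduction {
    grd_sub : forall x y, phi (x - y) = phi x - phi y;
    grd_mul : forall s t x y, s \in St -> t \in St -> B s x -> B t y ->
      phi (x * y) = phi x * phi y;
    grd_ker : forall x, B 1%g x -> phi x = 0 -> jacobson (B 1%g) x;
    grd_direct : forall c : gT -> A, (forall s, s \in St -> B s (c s)) ->
      \sum_(s in St) phi (c s) = 0 -> forall s, s \in St -> phi (c s) = 0 }.

Section GradedReduction.
Variables (A A3 : nzRingType) (gT : finGroupType) (e : A) (B : gT -> set A).
Variables (St : {group gT}) (phi : A -> A3).
Hypotheses (gB : grading e B St) (rd : graded_reduction B St phi).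

Let rB := gr1_subring gB.
Let cB := gr_comm gB.
Let supp := gr_supp B St.

Lemma grd_0 : phi 0 = 0.
Proof. by rewrite -(subrr (0 : A)) (grd_sub rd) subrr. Qed.

Lemma grd_add x y : phi (x + y) = phi x + phi y.
Proof. by rewrite -[y]opprK (grd_sub rd) -(sub0r (- y)) (grd_sub rd) grd_0 sub0r. Qed.

Lemma grd_sum (I : Type) (r : seq I) (P : pred I) (F : I -> A) :
  phi (\sum_(i <- r | P i) F i) = \sum_(i <- r | P i) phi (F i).
Proof. exact: (big_morph _ grd_add grd_0). Qed.

Lemma reduction_1 : reduction (B 1%g) (jacobson (B 1%g)) phi.
Proof.
split=> [x y _ _|x y Bx By|x]; first exact: (grd_sub rd).
  exact: (grd_mul rd (group1 St) (group1 St)).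
exact: (grd_ker rd).
Qed.

(** The difference e - x y lies in the kernel in degree 1, hence in the
    radical. *)
Lemma lift_unit x y : B 1%g x -> B 1%g y -> phi (x * y) = phi e ->
  exists2 w, B 1%g w & w * y = e.
Proof.
move=> Bx By xy; have Bxy := usr_mul rB Bx By; have B1e := gr_one gB.
have /(jacobsonP _ rB cB) [_ /(_ e B1e) [w Bw we]] :
    jacobson (B 1%g) (e - x * y).
  by apply: (grd_ker rd); [apply: (usr_sub rB)|rewrite (grd_sub rd) xy subrr].
exists (w * x); first exact: (usr_mul rB).
rewrite -mulrA -[RHS]we (usr_mul1 rB); first by rewrite subKr.
exact: (usr_sub rB).
Qed.

Let M1 x y : B 1%g x -> B 1%g y -> phi (x * y) = phi x * phi y.
Proof. exact: (grd_mul rd (group1 St) (group1 St)). Qed.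

Lemma image_subring : unital_subring (phi @` (B 1%g)) (phi e).
Proof.
have B1e := gr_one gB; split.
- move=> _ _ [x Bx <-] [y By <-]; exists (x - y); last exact: (grd_sub rd).
  exact: (usr_sub rB).
- move=> _ _ [x Bx <-] [y By <-]; exists (x * y); last exact: M1.
  exact: (usr_mul rB).
- by exists e.
- by move=> _ [x Bx <-]; rewrite -M1 // (usr_mul1 rB).
- by move=> _ [x Bx <-]; rewrite -M1 // (usr_mulr1 rB).
Qed.

Lemma image_comm : commutative_on (phi @` (B 1%g)).
Proof. by move=> _ _ [x Bx <-] [y By <-]; rewrite -!M1 // cB. Qed.

Lemma image_jacobson :
  phi @` jacobson (B 1%g) = jacobson (phi @` (B 1%g)).
Proof.
have B1e := gr_one gB; have rB3 := image_subring; have cB3 := image_comm.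
have phie a x : B 1%g a -> B 1%g x -> phi (e - a * x) = phi e - phi a * phi x.
  by move=> Ba Bx; rewrite (grd_sub rd) M1.
have Be a x : B 1%g a -> B 1%g x -> B 1%g (e - a * x).
  by move=> Ba Bx; apply: (usr_sub rB) => //; apply: (usr_mul rB).
apply/seteqP; split.
  move=> _ [x /(jacobsonP _ rB cB) [Bx Jx] <-]; apply/(jacobsonP _ rB3 cB3).
  split=> [|_ [a Ba <-]]; first by exists x.
  have [w Bw we] := Jx a Ba; exists (phi w); first by exists w.
  by rewrite -phie // -M1 ?we //; apply: Be.
move=> _ /(jacobsonP _ rB3 cB3) [[x Bx <-] Jx]; exists x => //.
apply/(jacobsonP _ rB cB); split=> // a Ba.
have [|_ [w Bw <-] we] := Jx (phi a); first by exists a.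
by apply: (lift_unit Bw); [exact: Be|rewrite M1 ?phie //; apply: Be].
Qed.

Lemma mem_supp_image s : s \in St ->
  (s \in supp) <-> setprod (phi @` B s) (phi @` B s^-1%g) (phi e).
Proof.
move=> Ss; have SV : s^-1%g \in St by rewrite groupV.
split=> [/(mem_gr_supp gB) [_ [n [x [y [Bx By ->]]]]]|].
  exists n, (phi \o x), (phi \o y); split=> [i|i|] /=; first by exists (x i).
    by exists (y i).
  by rewrite grd_sum; apply: eq_bigr => i _; rewrite (grd_mul rd Ss SV).
move=> es; have [z Vz ze] : (phi @` setprod (B s) (B s^-1%g)) (phi e).
  move: es; apply: setprod_ind => [|_ _ [x Vx <-] [y Vy <-]|_ _ [x Bx <-] [y By <-]].
  - by exists 0; [apply: setprod0|apply: grd_0].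
  - by exists (x + y); [apply: setprod_add|apply: grd_add].
  - by exists (x * y); [apply: setprod_mul|apply: (grd_mul rd Ss SV)].
have Bz : B 1%g z.
  move: Vz; apply: setprod_ind => [|x y|x y]; first exact: (usr_0 rB).
    exact: (usr_add rB).
  exact: (gr_mulV gB Ss).
have [|w Bw we] := @lift_unit e z (gr_one gB) Bz; first by rewrite (usr_mul1 rB).
apply/(mem_gr_supp gB); split=> //; rewrite -we; move: Vz.
apply: (@setprod_ind _ _ _ [set z | setprod (B s) (B s^-1%g) (w * z)]) => /=.
- by rewrite mulr0; apply: setprod0.
- by move=> x y Vx Vy; rewrite mulrDr; apply: setprod_add.
- by move=> x y Bx By; rewrite mulrA; apply: setprod_mul => //; apply: (gr_act gB).
Qed.

Lemma gr_supp_image (F : gT -> set A3) :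
  (forall s, s \in St -> F s = phi @` B s) -> gr_supp F St = supp.
Proof.
move=> FE; apply/setP=> s; rewrite [LHS]inE.
have [Ss|Ss] := boolP (s \in St); last by rewrite inE (negPf Ss).
have SV : s^-1%g \in St by rewrite groupV.
rewrite /= !FE //; apply/asboolP/idP => [FF|ss].
  apply/(mem_supp_image Ss); rewrite FF; exists e => //; exact: (gr_one gB).
have /andP[_ /asboolP BB] : (s \in St) && `[< setprod (B s) (B s^-1%g) = B 1%g >].
  by move: ss; rewrite inE.
rewrite -BB; apply/seteqP; split.
  apply: setprod_ind => [|_ _ [x Vx <-] [y Vy <-]|_ _ [x Bx <-] [y By <-]].
  - by exists 0; [apply: setprod0|apply: grd_0].
  - by exists (x + y); [apply: setprod_add|apply: grd_add].
  - by exists (x * y); [apply: setprod_mul|apply: (grd_mul rd Ss SV)].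
move=> _ [x Vx <-]; move: x Vx.
apply: (@setprod_ind _ _ _ [set z | setprod (phi @` B s) (phi @` B s^-1%g) (phi z)]) => /=.
- by rewrite grd_0; apply: setprod0.
- by move=> x y Vx Vy; rewrite grd_add; apply: setprod_add.
- by move=> x y Bx By; rewrite (grd_mul rd Ss SV) //; apply: setprod_mul; [exists x|exists y].
Qed.

Lemma lift_crossed s : s \in St ->
  (exists u v, [/\ (phi @` B s) u, (phi @` B s^-1%g) v & u * v = phi e]) ->
  exists u v, [/\ B s u, B s^-1%g v & u * v = e].
Proof.
move=> Ss [_ [_ [[u Bu <-] [v Bv <-] uv]]]; have SV : s^-1%g \in St by rewrite groupV.
have Buv := gr_mulV gB Ss Bu Bv.
have [|w Bw we] := @lift_unit e (u * v) (gr_one gB) Buv.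
  by rewrite (usr_mul1 rB) // (grd_mul rd Ss SV).
by exists (w * u), v; rewrite -mulrA we; split=> //; apply: (gr_act gB).
Qed.

(** The kernel in degree s is generated by the kernel in degree 1: write
    e as a sum of products u v with u in B s, v in B s^-1; then x is the sum
    of the u (v x), and phi (v x) = 0 when phi x = 0. *)
Lemma reduction_sum : reduction (gr_sum B St) (gr_ideal B St) phi.
Proof.
have rT := gr_sum_subring gB.
split=> [x y _ _|x y Tx|x]; first exact: (grd_sub rd).
  move: y; apply: (gr_sum_ind (V := [set y | phi (x * y) = phi x * phi y])) => /=.
  - by rewrite mulr0 grd_0 mulr0.
  - by move=> y z xy xz; rewrite mulrDr !grd_add mulrDr xy xz.
  move=> t y st Bty; move: x Tx.
  apply: (gr_sum_ind (V := [set x | phi (x * y) = phi x * phi y])) => /=.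
  - by rewrite mul0r grd_0 mul0r.
  - by move=> x1 x2 xy xz; rewrite mulrDl !grd_add mulrDl xy xz.
  move=> s x1 ss Bsx; apply: (grd_mul rd (supp_sub ss) (supp_sub st)) => //.
move=> [c [Bc ->]]; rewrite grd_sum => c0.
pose d s := if s \in supp then c s else 0.
have Bd s : s \in St -> B s (d s).
  by move=> Ss; rewrite /d; case: ifP => [/Bc//|_]; apply: (gr_0 gB).
have d0 : \sum_(s in St) phi (d s) = 0.
  rewrite -[RHS]c0 [RHS](eq_bigl (fun s => (s \in St) && (s \in supp))) => [|s].
    rewrite big_mkcondr /=; apply: eq_bigr => s _; rewrite /d.
    by case: ifP => // _; rewrite grd_0.
  by rewrite andbC andb_idr // => /supp_sub.
have tI := gr_ideal_two_sided gB.
apply: (closed_sum _ (ts_0 tI) (ts_sub tI)) => s ss.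
have Ss := supp_sub ss; have SV : s^-1%g \in St by rewrite groupV.
have cs0 : phi (c s) = 0.
  by have := grd_direct rd Bd d0 Ss; rewrite /d -/supp ss.
have Bcs := Bc s ss; rewrite -(gr_mul1 gB Ss Bcs).
have [_] := (mem_gr_supp gB s).1 ss.
apply: (@setprod_ind _ _ _ [set z | gr_ideal B St (z * c s)]) => /=.
- by rewrite mul0r; apply: (ts_0 tI).
- by move=> u v Iu Iv; rewrite mulrDl; apply: (ts_add tI).
move=> u v Bu Bv; rewrite -mulrA; apply: setprod_mul; first exact: (gr_sum_in gB ss).
apply: (grd_ker rd); first exact: (gr_Vmul gB Ss).
by rewrite (grd_mul rd SV Ss Bv Bcs) cs0 mulr0.
Qed.

End GradedReduction.

Section CompareHalf.
Variables (A1 A2 A3 : nzRingType) (gT1 gT2 : finGroupType) (e1 : A1) (e2 : A2).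
Variables (B1 : gT1 -> set A1) (B2 : gT2 -> set A2).
Variables (St1 : {group gT1}) (St2 : {group gT2}).
Variables (phi1 : A1 -> A3) (phi2 : A2 -> A3).
Hypotheses (gB1 : grading e1 B1 St1) (gB2 : grading e2 B2 St2).
Hypotheses (rd1 : graded_reduction B1 St1 phi1).
Hypotheses (rd2 : graded_reduction B2 St2 phi2).
Hypothesis eqJ : phi1 @` jacobson (B1 1%g) = phi2 @` jacobson (B2 1%g).
Hypothesis match_supp : forall s, s \in gr_supp B1 St1 ->
  exists2 t, t \in gr_supp B2 St2 & phi1 @` B1 s = phi2 @` B2 t.

Lemma sub_image_sum : phi1 @` gr_sum B1 St1 `<=` phi2 @` gr_sum B2 St2.
Proof.
have rT2 := gr_sum_subring gB2; move=> _ [x Tx <-]; move: x Tx.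
apply: (gr_sum_ind (V := [set x | (phi2 @` gr_sum B2 St2) (phi1 x)])) => /=.
- by exists 0; [apply: (usr_0 rT2)|rewrite (grd_0 rd1) (grd_0 rd2)].
- move=> x y [x' Tx xx'] [y' Ty yy'].
  rewrite (grd_add rd1) -xx' -yy' -(grd_add rd2).
  by exists (x' + y') => //; apply: (usr_add rT2).
move=> s x ss Bx; have [t st eqs] := match_supp ss.
have [y By <-] : (phi2 @` B2 t) (phi1 x) by rewrite -eqs; exists x.
by exists y => //; apply: (gr_sum_in gB2 st).
Qed.

Lemma sub_image_ideal : phi1 @` gr_ideal B1 St1 `<=` phi2 @` gr_ideal B2 St2.
Proof.
have tI2 := gr_ideal_two_sided gB2.
have r1 := reduction_sum gB1 rd1; have r2 := reduction_sum gB2 rd2.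
have TJ1 j : jacobson (B1 1%g) j -> gr_sum B1 St1 j.
  by move=> Jj; apply: (gr_sum_in gB1 (supp1 gB1)); apply: (ts_incl (gr_jacobson_ideal gB1)).
have TJ2 j : jacobson (B2 1%g) j -> gr_sum B2 St2 j.
  by move=> Jj; apply: (gr_sum_in gB2 (supp1 gB2)); apply: (ts_incl (gr_jacobson_ideal gB2)).
move=> _ [x Tx <-]; move: x Tx.
apply: (setprod_ind (V := [set x | (phi2 @` gr_ideal B2 St2) (phi1 x)])) => /=.
- by exists 0; [apply: (ts_0 tI2)|rewrite (grd_0 rd1) (grd_0 rd2)].
- move=> x y [x' Tx xx'] [y' Ty yy'].
  rewrite (grd_add rd1) -xx' -yy' -(grd_add rd2).
  by exists (x' + y') => //; apply: (ts_add tI2).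
move=> x j Tx Jj.
have [y Ty xy] : (phi2 @` gr_sum B2 St2) (phi1 x) by apply: sub_image_sum; exists x.
have [j' Jj' jj'] : (phi2 @` jacobson (B2 1%g)) (phi1 j) by rewrite -eqJ; exists j.
exists (y * j'); first exact: setprod_mul.
by rewrite (red_mul r2) //; [rewrite (red_mul r1) ?xy ?jj' //; apply: TJ1|apply: TJ2].
Qed.

End CompareHalf.

Section Compare.
Variables (A1 A2 A3 : nzRingType) (gT1 gT2 : finGroupType) (e1 : A1) (e2 : A2).
Variables (B1 : gT1 -> set A1) (B2 : gT2 -> set A2).
Variables (St1 : {group gT1}) (St2 : {group gT2}).
Variables (phi1 : A1 -> A3) (phi2 : A2 -> A3) (q : gT1 -> gT2).
Hypotheses (gB1 : grading e1 B1 St1) (gB2 : grading e2 B2 St2).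
Hypotheses (rd1 : graded_reduction B1 St1 phi1).
Hypotheses (rd2 : graded_reduction B2 St2 phi2).
Hypotheses (n1 : e1 <> 0) (n2 : e2 <> 0).
Hypothesis eqe : phi1 e1 = phi2 e2.
Hypothesis qSt : forall s, s \in St1 -> q s \in St2.
Hypothesis qM : {in St1 &, {morph q : s t / (s * t)%g}}.
Hypothesis q_inj : {in St1 &, injective q}.
Hypothesis qB : forall s, s \in St1 -> phi1 @` B1 s = phi2 @` B2 (q s).
Hypothesis q_onto : forall t, t \in gr_supp B2 St2 -> exists2 s, s \in St1 & t = q s.

Lemma compare_q1 : q 1%g = 1%g.
Proof. by apply: (mulIg (q 1%g)); rewrite -qM ?group1 // !mul1g. Qed.

Lemma compare_qV s : s \in St1 -> q s^-1%g = (q s)^-1%g.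
Proof.
move=> Ss; apply: (mulIg (q s)).
by rewrite mulVg -qM ?groupV // mulVg compare_q1.
Qed.

Lemma compare_supp s : s \in St1 ->
  (s \in gr_supp B1 St1) <-> (q s \in gr_supp B2 St2).
Proof.
move=> Ss; rewrite (mem_supp_image gB1 rd1) // (mem_supp_image gB2 rd2) ?qSt //.
by rewrite -compare_qV // -!qB ?groupV // eqe.
Qed.

Lemma compare_supp_imset : gr_supp B2 St2 = [set q s | s in gr_supp B1 St1]%SET.
Proof.
apply/setP=> t; apply/idP/imsetP => [st|[s ss ->]].
  have [s Ss ts] := q_onto st; exists s => //.
  by apply/(compare_supp Ss); rewrite -ts.
by apply/compare_supp => //; apply: (supp_sub ss).
Qed.

Lemma compare_image_jacobson :
  phi1 @` jacobson (B1 1%g) = phi2 @` jacobson (B2 1%g).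
Proof.
by rewrite (image_jacobson gB1 rd1) (image_jacobson gB2 rd2) qB ?group1 ?compare_q1.
Qed.

Lemma compare_match1 s : s \in gr_supp B1 St1 ->
  exists2 t, t \in gr_supp B2 St2 & phi1 @` B1 s = phi2 @` B2 t.
Proof.
by move=> ss; have Ss := supp_sub ss; exists (q s); [apply/compare_supp|apply: qB].
Qed.

Lemma compare_match2 t : t \in gr_supp B2 St2 ->
  exists2 s, s \in gr_supp B1 St1 & phi2 @` B2 t = phi1 @` B1 s.
Proof.
move=> st; have [s Ss ts] := q_onto st; exists s; last by rewrite qB // ts.
by apply/(compare_supp Ss); rewrite -ts.
Qed.

Let T1 := gr_sum B1 St1.
Let T2 := gr_sum B2 St2.
Let I1 := gr_ideal B1 St1.
Let I2 := gr_ideal B2 St2.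

(** Both isomorphisms, on the units of the components of degree 1 and on the
    homogeneous units, are instances of transfer. *)
Theorem gr_ext_iso : ext_iso (gr_ext e1 B1 St1) (gr_ext e2 B2 St2) q.
Proof.
have [rT1 rT2] := (gr_sum_subring gB1, gr_sum_subring gB2).
have [tI1 tI2] := (gr_ideal_two_sided gB1, gr_ideal_two_sided gB2).
have [r1 r2] := (reduction_sum gB1 rd1, reduction_sum gB2 rd2).
have [rB1 rB2] := (gr1_subring gB1, gr1_subring gB2).
have [tJ1 tJ2] := (gr_jacobson_ideal gB1, gr_jacobson_ideal gB2).
have [s1 s2] := (reduction_1 rd1, reduction_1 rd2).
have eqT : phi1 @` T1 = phi2 @` T2.
  apply/seteqP; split.
    exact: (sub_image_sum gB2 rd1 rd2 compare_match1).
  exact: (sub_image_sum gB1 rd2 rd1 compare_match2).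
have eqI : phi1 @` I1 = phi2 @` I2.
  apply/seteqP; split.
    exact: (sub_image_ideal gB1 gB2 rd1 rd2 compare_image_jacobson compare_match1).
  exact: (sub_image_ideal gB2 gB1 rd2 rd1 (esym compare_image_jacobson) compare_match2).
have eqB : phi1 @` (B1 1%g) = phi2 @` (B2 1%g) by rewrite qB ?group1 ?compare_q1.
have eqJ := compare_image_jacobson.
(* Transfer sends a homogeneous unit of degree s to one of degree q s. *)
have hom12 X : gr_hU e1 B1 St1 X -> exists s c d,
    [/\ s \in gr_supp B1 St1, B1 s c, B2 (q s) d, X = qcls I1 c &
        transfer T2 phi1 phi2 X = qcls I2 d /\ gr_hU e2 B2 St2 (qcls I2 d)].
  move=> HX; have [s [c [v [ss Bc _ EX _]]]] := homog_unitP gB1 HX.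
  have Ss := supp_sub ss; have qs := (compare_supp Ss).1 ss.
  have [d Bd cd] : (phi2 @` B2 (q s)) (phi1 c) by rewrite -qB //; exists c.
  have Tc := gr_sum_in gB1 ss Bc; have Td := gr_sum_in gB2 qs Bd.
  have trX := transfer_qcls rT1 rT2 tI1 tI2 r1 r2 eqI Tc Td (esym cd).
  exists s, c, d; split=> //; rewrite EX; split=> //.
  split; last by exists (q s); split=> //; exists d.
  rewrite -trX -EX; case: HX => UX _.
  exact: (transfer_qunits rT1 rT2 tI1 tI2 r1 r2 eqT eqI eqe).
have hom21 X : gr_hU e2 B2 St2 X -> gr_hU e1 B1 St1 (transfer T1 phi2 phi1 X).
  move=> HX; have [t [c [v [st Bc _ EX _]]]] := homog_unitP gB2 HX.
  have [s ss eqs] := compare_match2 st.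
  have [d Bd cd] : (phi1 @` B1 s) (phi2 c) by rewrite -eqs; exists c.
  have Tc := gr_sum_in gB2 st Bc; have Td := gr_sum_in gB1 ss Bd.
  have trX := transfer_qcls rT2 rT1 tI2 tI1 r2 r1 (esym eqI) Tc Td (esym cd).
  split; last by exists s; split=> //; exists d => //; rewrite EX.
  case: HX => UX _.
  exact: (transfer_qunits rT2 rT1 tI2 tI1 r2 r1 (esym eqT) (esym eqI) (esym eqe)).
split.
- split=> [s ss|s t /set_mem ss /set_mem st|t st].
  + by apply/compare_supp => //; apply: (supp_sub ss).
  + by apply: q_inj; apply: supp_sub; [exact: ss|exact: st].
  + have [s Ss ts] := q_onto st; exists s => //.
    by apply/(compare_supp Ss); rewrite -ts.
- by move=> s t ss st; apply: qM; apply: supp_sub; [exact: ss|exact: st].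
exists (transfer (B2 1%g) phi1 phi2), (transfer T2 phi1 phi2); split.
- split=> [|X Y [qX _] [qY _]]; last exact: (transfer_qmul rB1 rB2 tJ1 tJ2 s1 s2).
  apply: (transfer_bij rB1 rB2 tJ1 tJ2 s1 s2 eqB eqJ) => [X []//|X []//|X|X].
    exact: (transfer_qunits rB1 rB2 tJ1 tJ2 s1 s2).
  exact: (transfer_qunits rB2 rB1 tJ2 tJ1 s2 s1).
- split=> [|X Y [[qX _] _] [[qY _] _]]; last exact: (transfer_qmul rT1 rT2 tI1 tI2 r1 r2).
  apply: (transfer_bij rT1 rT2 tI1 tI2 r1 r2 eqT eqI) => [X [[]]//|X [[]]//|X HX|X].
    by have [s [c [d [_ _ _ _ [-> ]]]]] := hom12 X HX.
  exact: hom21.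
- move=> X [/quotP [x Bx ->] _] /=.
  have [y By xy] := match12 eqB Bx.
  rewrite (transfer_qcls rB1 rB2 tJ1 tJ2 s1 s2 eqJ Bx By xy).
  rewrite (qlift_qcls gB1) (qlift_qcls gB2).
  apply: (transfer_qcls rT1 rT2 tI1 tI2 r1 r2 eqI) => //.
    exact: (gr_sum_in gB1 (supp1 gB1)).
  exact: (gr_sum_in gB2 (supp1 gB2)).
- move=> X HX /=; have [s [c [d [ss Bc Bd EX [-> Hd]]]]] := hom12 X HX.
  have qs := (compare_supp (supp_sub ss)).1 ss.
  rewrite EX in HX *.
  by rewrite (gr_deg_qcls gB2 n2 qs Bd Hd) (gr_deg_qcls gB1 n1 ss Bc HX).
Qed.

End Compare.

(** * Group algebras *)

Section GroupAlgebra.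
Variables (R : comNzRingType) (gT : finGroupType).
Local Notation A := (galg R gT).
Implicit Types (a b c e : A) (x y g : gT) (S T V : {set gT}).

Lemma galgE a b g : (a * b) g = \sum_(h : gT) a h * b (h^-1 * g)%g.
Proof. by rewrite ffunE. Qed.

Lemma galg1E g : (1 : A) g = (g == 1%g)%:R.
Proof. by rewrite ffunE. Qed.

Lemma galgDE a b g : (a + b) g = a g + b g. Proof. by rewrite ffunE. Qed.
Lemma galgNE a g : (- a) g = - a g. Proof. by rewrite ffunE. Qed.
Lemma galgBE a b g : (a - b) g = a g - b g. Proof. by rewrite !ffunE. Qed.
Lemma galg0E g : (0 : A) g = 0. Proof. by rewrite ffunE. Qed.
Lemma galg_sumE (I : Type) (r : seq I) (P : pred I) (F : I -> A) g :
  (\sum_(i <- r | P i) F i) g = \sum_(i <- r | P i) F i g.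
Proof. exact: (big_morph (fun a : A => a g) (fun a b => galgDE a b g) (galg0E g)). Qed.

Lemma gconjE a x g : gconj a x g = a (g ^ x^-1)%g.
Proof. by rewrite ffunE. Qed.

Lemma gconjB a b x : gconj (a - b) x = gconj a x - gconj b x.
Proof. by apply/ffunP=> g; rewrite gconjE !galgBE !gconjE. Qed.

Lemma gconj0 x : gconj (0 : A) x = 0.
Proof. by apply/ffunP=> g; rewrite gconjE !galg0E. Qed.

Lemma gconjD a b x : gconj (a + b) x = gconj a x + gconj b x.
Proof. by apply/ffunP=> g; rewrite gconjE !galgDE !gconjE. Qed.

Lemma gconj_sum (I : Type) (r : seq I) (P : pred I) (F : I -> A) x :
  gconj (\sum_(i <- r | P i) F i) x = \sum_(i <- r | P i) gconj (F i) x.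
Proof. exact: (big_morph (fun a => gconj a x) (fun a b => gconjD a b x) (gconj0 x)). Qed.

Lemma gconjM a b x : gconj (a * b) x = gconj a x * gconj b x.
Proof.
apply/ffunP=> g; rewrite gconjE !galgE (reindex_inj (conjg_inj x^-1%g)).
by apply: eq_bigr => h _; rewrite !gconjE conjMg conjVg.
Qed.

Lemma gconj1 x : gconj (1 : A) x = 1.
Proof.
apply/ffunP=> g; rewrite gconjE !galg1E; congr (_%:R).
by rewrite -(inj_eq (conjg_inj x)) conjgKV conj1g.
Qed.

Lemma gconj_comp a x y : gconj (gconj a x) y = gconj a (x * y)%g.
Proof. by apply/ffunP=> g; rewrite !gconjE invMg conjgM. Qed.

Lemma gconj_id a : gconj a 1%g = a.
Proof. by apply/ffunP=> g; rewrite gconjE invg1 conjg1. Qed.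

Lemma gconjK a x : gconj (gconj a x) x^-1%g = a.
Proof. by rewrite gconj_comp mulgV gconj_id. Qed.

Lemma gconj_fixV a x : gconj a x = a -> gconj a x^-1%g = a.
Proof. by move=> ax; rewrite -{1}ax gconjK. Qed.

Lemma gconj_fixE a x g : gconj a x = a -> a (g ^ x)%g = a g.
Proof. by move=> ax; rewrite -[in LHS]ax gconjE conjgK. Qed.

Lemma gstab_group_set (X : {group gT}) a : group_set (gstab X a).
Proof.
apply/group_setP; split=> [|x y]; rewrite !inE; first by rewrite group1 gconj_id eqxx.
move=> /andP[Xx /eqP ax] /andP[Xy /eqP ay].
by rewrite groupM // -gconj_comp ax ay eqxx.
Qed.
Canonical gstab_group (X : {group gT}) a := Group (gstab_group_set X a).

Lemma gstabP (X : {set gT}) a x : reflect (x \in X /\ gconj a x = a) (x \in gstab X a).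
Proof. by rewrite inE; apply: (iffP andP) => -[Xx /eqP]. Qed.

(** ** Supports *)

Lemma gspan0 S : gspan S (0 : A).
Proof. by move=> g _; rewrite galg0E. Qed.

Lemma gspanB S a b : gspan S a -> gspan S b -> gspan S (a - b).
Proof. by move=> Sa Sb g Sg; rewrite galgBE Sa // Sb // subrr. Qed.

Lemma gspanM S T V a b : (forall x y, x \in S -> y \in T -> (x * y)%g \in V) ->
  gspan S a -> gspan T b -> gspan V (a * b).
Proof.
move=> STV Sa Tb g Vg; rewrite galgE big1 // => h _.
have [Sh|/Sa ->] := boolP (h \in S); last by rewrite mul0r.
have [Th|/Tb ->] := boolP ((h^-1 * g)%g \in T); last by rewrite mulr0.
by move: (STV _ _ Sh Th); rewrite mulKVg (negPf Vg).
Qed.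

Lemma gspanW S T a : S \subset T -> gspan S a -> gspan T a.
Proof. by move=> /fintype.subsetP ST Sa g Tg; apply: Sa; apply: contra Tg => /ST. Qed.

(** In coordinates, a (g u^-1) = a (u^-1 g) for u in the support of c. *)
Lemma fixed_comm a c : (forall x, c x != 0 -> gconj a x = a) -> a * c = c * a.
Proof.
move=> ca; apply/ffunP=> g; rewrite !galgE.
rewrite (reindex_inj (inj_comp (mulgI g) invg_inj)) /=; apply: eq_bigr => u _.
rewrite invMg invgK mulgKV mulrC.
have [->|/ca au] := eqVneq (c u) 0; first by rewrite !mul0r.
by rewrite -(gconj_fixE (u^-1 * g)%g (gconj_fixV au)) conjgE invgK -mulgA mulKVg.
Qed.

Lemma gspan_comm a c S : gspan S c -> (forall x, x \in S -> gconj a x = a) ->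
  a * c = c * a.
Proof.
move=> Sc aS; apply: fixed_comm => x; have [/aS//|/Sc ->] := boolP (x \in S).
by rewrite eqxx.
Qed.

Lemma gspan_direct (I : finType) (D : {set I}) (S : I -> {set gT}) (c : I -> A) :
  (forall i j x, x \in S i -> x \in S j -> i = j) ->
  (forall i, i \in D -> gspan (S i) (c i)) -> \sum_(i in D) c i = 0 ->
  forall i, i \in D -> c i = 0.
Proof.
move=> SI Sc c0 i Di; apply/ffunP=> g; rewrite galg0E.
have [Sg|/(Sc i Di)//] := boolP (g \in S i).
have := congr1 (fun a : A => a g) c0; rewrite galg_sumE galg0E (bigD1 i) //=.
rewrite big1 ?addr0 // => j /andP[Dj ji]; apply: (Sc j Dj).
by apply: contraNN ji => Sj; rewrite (SI _ _ _ Sg Sj).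
Qed.

(** ** Fixed points *)

Lemma gfix0 S (X : {set gT}) : gfix S X (0 : A).
Proof. by split=> [|x _]; [apply: gspan0|apply: gconj0]. Qed.

Lemma gfixB S (X : {set gT}) a b : gfix S X a -> gfix S X b -> gfix S X (a - b).
Proof.
move=> [Sa Xa] [Sb Xb]; split; first exact: gspanB.
by move=> x Xx; rewrite gconjB Xa // Xb.
Qed.

Lemma gfixM S T V (X : {set gT}) a b :
  (forall x y, x \in S -> y \in T -> (x * y)%g \in V) ->
  gfix S X a -> gfix T X b -> gfix V X (a * b).
Proof.
move=> STV [Sa Xa] [Tb Xb]; split; first exact: (gspanM STV Sa Tb).
by move=> x Xx; rewrite gconjM Xa // Xb.
Qed.

Lemma gfix1 (L : {group gT}) (X : {set gT}) : gfix L X (1 : A).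
Proof.
split=> [g Lg|x _]; last exact: gconj1.
by rewrite galg1E; case: eqP Lg => // ->; rewrite group1.
Qed.

(** ** Scalars *)

Definition gscale (r : R) a : A := [ffun g => r * a g].

Lemma gscaleE r a g : gscale r a g = r * a g. Proof. by rewrite ffunE. Qed.

Lemma gscale_mulr r a b : a * gscale r b = gscale r (a * b).
Proof.
apply/ffunP=> g; rewrite gscaleE !galgE mulr_sumr; apply: eq_bigr => h _.
by rewrite gscaleE mulrCA.
Qed.

Lemma gscale_mull r a b : gscale r a * b = gscale r (a * b).
Proof.
apply/ffunP=> g; rewrite gscaleE !galgE mulr_sumr; apply: eq_bigr => h _.
by rewrite gscaleE mulrA.
Qed.

Lemma gscale_gfix S (X : {set gT}) r a : gfix S X a -> gfix S X (gscale r a).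
Proof.
move=> [Sa Xa]; split=> [g Sg|x Xx]; first by rewrite gscaleE Sa ?mulr0.
by apply/ffunP=> g; rewrite gconjE !gscaleE -gconjE Xa.
Qed.

Lemma galg_intE (r : int) : r%:~R = gscale r%:~R 1.
Proof.
have nat n : n%:R = gscale n%:R 1.
  apply/ffunP=> g; rewrite gscaleE; elim: n => [|n IHn]; first by rewrite mul0r galg0E.
  by rewrite mulrS galgDE IHn mulrS mulrDl mul1r.
case: r => n; first exact: nat.
rewrite NegzE !mulrNz -!pmulrn nat; apply/ffunP=> g.
by rewrite galgNE !gscaleE mulNr.
Qed.

End GroupAlgebra.

(** ** Fixed points supported on cosets form a graded ring *)

Lemma coset_disjoint (gT : finGroupType) (L : {group gT}) (s t : coset_of L) (x : gT) :
  x \in (s : {set gT}) -> x \in (t : {set gT}) -> s = t.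
Proof. by move=> /coset_mem <- /coset_mem <-. Qed.

Lemma coset_oneE (gT : finGroupType) (L : {group gT}) :
  ((1%g : coset_of L) : {set gT}) = L.
Proof. by rewrite -(coset_id (group1 L)) coset1. Qed.

Lemma mem_cosetM (gT : finGroupType) (L : {group gT}) (s t : coset_of L) (x y : gT) :
  x \in (s : {set gT}) -> y \in (t : {set gT}) ->
  (x * y)%g \in ((s * t)%g : {set gT}).
Proof. exact: mem_mulg. Qed.

Lemma coset_subset (gT : finGroupType) (L M : {group gT}) (s : coset_of L) :
  L \subset M -> s \in (M / L)%g -> (s : {set gT}) \subset M.
Proof.
move=> LM /morphimP [x Nx Mx ->]; rewrite val_coset //.
by rewrite mul_subG // finset.sub1set.
Qed.

Section CosetGrading.
Variables (R : comNzRingType) (gT : finGroupType) (L X M : {group gT}).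
Variable e : galg R gT.
Hypotheses (sLX : L \subset X) (sLM : L \subset M).
Hypotheses (Le : gfix L X e) (idem : e * e = e).
Hypothesis Me : forall x, x \in M -> gconj e x = e.

Let B (s : coset_of L) := gcomp e s X.

Lemma gcomp_mul1 s (a : galg R gT) : B s a -> e * a = a.
Proof. by move=> [b _ <-]; rewrite mulrA idem. Qed.

Lemma gcomp_mulr1 s (a : galg R gT) : s \in (M / L)%g -> B s a -> a * e = a.
Proof.
move=> Ms [b [sb _] <-]; rewrite -mulrA -(@gspan_comm _ _ e b s) ?mulrA ?idem //.
by move=> x sx; apply: Me; apply: (fintype.subsetP (coset_subset sLM Ms)).
Qed.

Lemma gcomp_fix s (a : galg R gT) : B s a -> gfix s X a.
Proof.
move=> [b sb <-]; apply: gfixM Le sb => x y Lx sy.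
rewrite -[s]mul1g; apply: mem_cosetM => //.
by rewrite coset_oneE.
Qed.

Lemma gcompP s (a : galg R gT) : B s a <-> gfix s X a /\ e * a = a.
Proof.
split=> [Ba|[sa ea]]; last by exists a.
by split; [apply: gcomp_fix|apply: gcomp_mul1 Ba].
Qed.

(** The component of degree 1 is commutative because its elements are supported
    on L and fixed by L. *)
Lemma gcomp_grading : grading e B (M / L)%G.
Proof.
split.
- by move=> s Ms; exists 0; [apply: gfix0|rewrite mulr0].
- move=> s x y Ms [a sa <-] [b sb <-]; exists (a - b); last by rewrite mulrBr.
  exact: gfixB.
- move=> s t x y Ms Mt Bx By; exists (x * y); last by rewrite mulrA (gcomp_mul1 Bx).
  by apply: gfixM (gcomp_fix Bx) (gcomp_fix By) => g h; apply: mem_cosetM.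
- by exists 1; [rewrite coset_oneE; apply: gfix1|rewrite mulr1].
- by move=> s x _; apply: gcomp_mul1.
- by move=> s x Ms; apply: gcomp_mulr1.
- move=> x y /gcomp_fix [_ Xx] /gcomp_fix [Ly _].
  apply: (gspan_comm Ly) => g; rewrite coset_oneE => Lg.
  by apply: Xx; apply: (fintype.subsetP sLX).
- move=> c Bc; apply: gspan_direct => [s t x|s Ms]; first exact: coset_disjoint.
  by have [] := gcomp_fix (Bc s Ms).
Qed.

End CosetGrading.

(** * The Brauer homomorphism *)

Section PGroupSum.
Variables (k : fieldType) (p : nat) (gT : finGroupType) (P : {group gT}).
Hypotheses (chk : p \in [pchar k]) (pP : p.-group P).

(** Orbits of P other than fixed points have length divisible by p, and f is
    constant on them. *)
Lemma pgroup_sum_fix (T : finType) (to : {action gT &-> T}) (S : {set T})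
    (f : T -> k) : [acts P, on S | to] ->
  (forall x u, x \in S -> u \in P -> f (to x u) = f x) ->
  \sum_(x in S) f x = \sum_(x in 'Fix_(S | to)(P)) f x.
Proof.
move=> actsP fP.
have fix0 : \sum_(x in S) (if x \in 'Fix_to(P) then 0 else f x) = 0.
  rewrite -(cover_partition (orbit_partition actsP)).
  have /and3P[_ tiO _] := orbit_partition actsP.
  rewrite big_trivIset //= big1 // => _ /imsetP[x Sx ->].
  have [fx|nfx] := boolP (x \in 'Fix_to(P)).
    by move: (fx) => /orbit1P ->; rewrite big_set1 fx.
  rewrite (eq_bigr (fun=> f x)) => [|y /imsetP[u Pu ->]]; last first.
    rewrite fP // ifN //; apply: contra nfx => /afixP fy.
    by have := fy _ (groupVr Pu); rewrite actK => ->; apply/afixP.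
  rewrite sumr_const; have [n On] := p_natP (pnat_dvd (dvdn_orbit to P x) pP).
  rewrite On; case: n On => [O1|n _].
    by case/negP: nfx; apply/orbit1P; apply: card_orbit1; rewrite O1.
  by rewrite expnS mulrnA (mulrn_pchar chk) mul0rn.
rewrite -[LHS]subr0 -[X in _ - X]fix0 -sumrB.
rewrite [RHS](eq_bigl (fun x => (x \in S) && (x \in 'Fix_to(P)))) => [|x].
  rewrite big_mkcondr /=; apply: eq_bigr => x _.
  by case: ifP; rewrite ?subr0 ?subrr.
by rewrite inE.
Qed.

End PGroupSum.

Section Trace.
Variables (R : comNzRingType) (gT : finGroupType) (P K : {group gT}).
Hypothesis sPK : P \subset K.
Implicit Types (a : galg R gT) (x y g : gT).

Definition fixed_by (S : {set gT}) a := forall x, x \in S -> gconj a x = a.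

Lemma gconj_repr a (X : {set gT}) x : fixed_by P a -> X \in rcosets P K ->
  x \in X -> gconj a x = gconj a (repr X).
Proof.
move=> Pa /rcosetsP[y Ky ->] /rcosetP[u Pu ->].
have /rcosetP[v Pv ->] := mem_repr_rcoset P y.
by rewrite -!gconj_comp (Pa u Pu) (Pa v Pv).
Qed.

Lemma rtrace_fixed a : fixed_by P a -> fixed_by K (rtrace P K a).
Proof.
move=> Pa x Kx; rewrite /rtrace gconj_sum.
have Kx' (X : {set gT}) : (X :* x \in rcosets P K) = (X \in rcosets P K).
  by rewrite -rcosetE; apply: (acts_act (actsRs_rcosets P K) Kx X).
rewrite [RHS](reindex_inj (act_inj 'Rs x)) /=.
apply: eq_big => [X|X PX]; first by rewrite rcosetE Kx'.
rewrite gconj_comp rcosetE; apply: gconj_repr; rewrite ?Kx' //.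
apply: mem_mulg; last by rewrite finset.inE.
by have /rcosetsP[y _ ->] := PX; apply: mem_repr_rcoset.
Qed.

Lemma repr_rcosets (X : {set gT}) : X \in rcosets P K -> repr X \in K.
Proof.
move=> /rcosetsP[y Ky ->]; have /rcosetP[u Pu ->] := mem_repr_rcoset P y.
by rewrite groupM // (fintype.subsetP sPK).
Qed.

Lemma rtrace_span a (S : {set gT}) : (forall x g, x \in K -> (g ^ x)%g \in S -> g \in S) ->
  gspan S a -> gspan S (rtrace P K a).
Proof.
move=> KS Sa g Sg; rewrite /rtrace galg_sumE big1 // => X PX.
rewrite gconjE Sa //; apply: contra Sg; apply: KS; rewrite groupV.
exact: repr_rcosets.
Qed.

Lemma rtrace_mulr a c : fixed_by K c -> rtrace P K (a * c) = rtrace P K a * c.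
Proof.
move=> Kc; rewrite /rtrace mulr_suml; apply: eq_bigr => X PX.
by rewrite gconjM Kc //; apply: repr_rcosets.
Qed.

End Trace.

Section Brauer.
Variables (O : idomainType) (k : fieldType) (res : {rmorphism O -> k}) (p : nat).
Variables (gT : finGroupType) (P : {group gT}).
Hypotheses (chk : p \in [pchar k]) (pP : p.-group P).
Implicit Types (a b c : galg O gT) (x y g : gT).
Local Notation br := (brauer res P).

Lemma brauerE a g : br a g = if g \in 'C(P) then res (a g) else 0.
Proof. by rewrite ffunE. Qed.

Lemma brauerB a b : br (a - b) = br a - br b.
Proof.
apply/ffunP=> g; rewrite galgBE !brauerE galgBE.
by case: ifP; rewrite ?subr0 // rmorphB.
Qed.

Lemma brauer0 : br 0 = 0.
Proof. by rewrite -(subrr 0) brauerB subrr. Qed.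

Lemma brauer_span a (S : {set gT}) : gspan S a -> gspan (S :&: 'C(P))%SET (br a).
Proof.
move=> Sa g; rewrite finset.inE brauerE; case: ifP => //; rewrite andbT => _ /Sa ->.
exact: rmorph0.
Qed.

(** For g in C(P) the group P permutes the summands a h * b (h^-1 g), with
    fixed points the h in C(P). *)
Lemma brauerM a b : fixed_by P a -> fixed_by P b -> br (a * b) = br a * br b.
Proof.
move=> Pa Pb; apply/ffunP=> g; rewrite brauerE galgE [RHS]galgE.
have [Cg|nCg] := boolP (g \in 'C(P)); last first.
  rewrite big1 // => h _; rewrite !brauerE.
  case: ifP => Ch; rewrite ?mul0r //; case: ifP => Chg; rewrite ?mulr0 //.
  by case/negP: nCg; rewrite -(mulKVg h g) groupM.
rewrite rmorph_sum /=.
rewrite (eq_bigl (mem [set: gT]%SET)) => [|h]; last by rewrite /= finset.inE.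
rewrite (pgroup_sum_fix chk pP (to := 'J)).
- rewrite finset.setTI afixJ [RHS]big_mkcond [LHS]big_mkcond /=.
  apply: eq_bigr => h _; rewrite !brauerE; case: ifP => Ch; last by rewrite mul0r.
  by rewrite groupM ?groupV // rmorphM.
- by apply/actsP=> u Pu h; rewrite !finset.inE.
move=> h u _ Pu /=; have gu : (g ^ u)%g = g by apply/conjg_fixP/commgP; apply: (centP Cg).
by rewrite (gconj_fixE _ (Pa _ Pu)) -{1}gu -conjVg -conjMg (gconj_fixE _ (Pb _ Pu)).
Qed.

Lemma brauer_conj a x : x \in 'N(P) -> br (gconj a x) = gconj (br a) x.
Proof.
move=> Nx; apply/ffunP=> g; rewrite gconjE !brauerE gconjE.
have NC : x^-1%g \in 'N('C(P)) by rewrite groupV (fintype.subsetP (cent_norm _)).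
by rewrite memJ_norm.
Qed.

(** For g in C(P) the group P permutes the cosets P x without changing the
    coefficient of g in the conjugate of a by x; the fixed cosets are those in
    the normalizer of P. *)
Lemma brauer_rtrace a (K : {group gT}) : P \subset K -> fixed_by P a ->
  br (rtrace P K a) = rtrace P 'N_K(P) (br a).
Proof.
move=> sPK Pa; apply/ffunP=> g; rewrite brauerE /rtrace !galg_sumE.
have sPN : P \subset 'N_K(P) by rewrite finset.subsetI sPK normG.
have NC x : x \in 'N(P) -> x^-1%g \in 'N('C(P)).
  by move=> Nx; rewrite groupV (fintype.subsetP (cent_norm _)).
have reprN X : X \in rcosets P 'N_K(P) -> repr X \in 'N(P).
  by move=> /(repr_rcosets sPN); rewrite finset.inE => /andP[].
have [Cg|nCg] := boolP (g \in 'C(P)); last first.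
  rewrite big1 // => X /reprN NX.
  by rewrite gconjE brauerE memJ_norm ?NC // (negPf nCg).
pose f (X : {set gT}) := res (a (g ^ (repr X)^-1)%g).
have fE X x : X \in rcosets P K -> x \in X -> f X = res (a (g ^ x^-1)%g).
  by move=> PX Xx; rewrite /f -!gconjE (gconj_repr Pa PX Xx).
rewrite rmorph_sum /= (eq_bigr f) => [|X _]; last by rewrite gconjE.
have actsP : [acts P, on rcosets P K | 'Rs].
  exact: fintype.subset_trans sPK (actsRs_rcosets P K).
rewrite (pgroup_sum_fix chk pP actsP) => [|X u PX Pu]; last first.
  have PXu : X :* u \in rcosets P K.
    have := acts_act actsP Pu X; rewrite /= rcosetE => ->; exact: PX.
  have Xr : repr X \in X by have /rcosetsP[y _ ->] := PX; apply: mem_repr_rcoset.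
  rewrite /= rcosetE (fE _ (repr X * u)%g PXu); last first.
    by apply: mem_mulg => //; rewrite finset.inE.
  rewrite /f invMg conjgM; congr (res (a (_ ^ _)%g)).
  by apply/conjg_fixP/commgP; apply: (centP Cg); rewrite groupV.
have sub X : X \in rcosets P 'N_K(P) -> X \in rcosets P K.
  by move=> /rcosetsP[y /setIP[Ky _] ->]; apply/rcosetsP; exists y.
rewrite afixRs_rcosets; apply: eq_bigr => X PX.
have NX := reprN X PX; rewrite gconjE brauerE memJ_norm ?NC // Cg.
by rewrite (fE X (repr X)) ?sub //; have /rcosetsP[y _ ->] := PX; apply: mem_repr_rcoset.
Qed.

End Brauer.

Section BrauerImage.
Variables (O : idomainType) (k : fieldType) (res : {rmorphism O -> k}) (p : nat).
Variables (gT : finGroupType) (H K P : {group gT}) (b : galg O gT).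
Hypotheses (res_onto : forall y : k, exists x : O, res x = y).
Hypotheses (chk : p \in [pchar k]) (nKH : K <| H).
Hypotheses (Kb : gfix K K b) (bb : b * b = b).
Hypothesis dP : is_defect_group res p K P b.
Local Notation br := (brauer res P).
Let bbar := br b.

Lemma fixed_by_gfix (R : comNzRingType) (S X Y : {set gT}) (a : galg R gT) :
  X \subset Y -> gfix S Y a -> fixed_by X a.
Proof. by move=> /fintype.subsetP XY [_ Ya] x /XY; apply: Ya. Qed.

Let sPK : P \subset K. Proof. by case: dP. Qed.
Let pP : p.-group P. Proof. by case: dP. Qed.

Lemma brauer_idem : bbar * bbar = bbar.
Proof.
have Pb := fixed_by_gfix sPK Kb.
by rewrite -(brauerM res chk pP Pb Pb) bb.
Qed.

Lemma brauer_fix (S : {set gT}) (a : galg O gT) : S \subset H -> gfix S K a ->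
  gfix (S :&: 'C_H(P))%SET 'N_K(P) (br a).
Proof.
move=> SH [Sa Ka]; split.
  apply: (gspanW _ (brauer_span res Sa)); apply/fintype.subsetP=> x.
  by rewrite !finset.inE => /andP[Sx ->]; rewrite Sx (fintype.subsetP SH).
by move=> x /setIP[Kx Nx]; rewrite -brauer_conj // Ka.
Qed.

(** Write b = Tr_P^K(a). For x in the right-hand side, let y lift the
    coefficients of x; it is fixed by P, being supported on C(P), and
    b Tr_P^K(a y) has image bbar Tr_P^N(Br_P(a)) x = bbar x. *)
Lemma brauer_gcomp (s : coset_of K) : s \in (H / K)%g ->
  br @` gcomp b s K = gcomp bbar ((s : {set gT}) :&: 'C_H(P))%SET 'N_K(P).
Proof.
move=> Hs; have sH := coset_subset (normal_sub nKH) Hs.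
have Pb := fixed_by_gfix sPK Kb.
apply/seteqP; split=> [_ [_ [z sz <-] <-]|_ [x [Sx Nx] <-]].
  exists (br z); first exact: brauer_fix.
  by rewrite (brauerM res chk pP) //; apply: fixed_by_gfix sz.
have [_ _ [a [Ka Pa] bE] _] := dP.
have [lift liftK] := choice res_onto.
pose S := ((s : {set gT}) :&: 'C_H(P))%SET.
pose y : galg O gT := [ffun g => if g \in S then lift (x g) else 0].
have yE g : y g = if g \in S then lift (x g) else 0 by rewrite ffunE.
have SC g : g \in S -> g \in 'C(P) by rewrite !finset.inE => /and3P[].
have ys : gspan (s : {set gT}) y.
  by move=> g; rewrite yE finset.inE; case: (g \in _).
have Py : fixed_by P y.
  move=> u Pu; apply/ffunP=> g; rewrite gconjE.
  have [Cg|nCg] := boolP (g \in 'C(P)).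
    congr (y _); apply/conjg_fixP/commgP; apply: (centP Cg); by rewrite groupV.
  have NC : u^-1%g \in 'N('C(P)).
    by rewrite groupV (fintype.subsetP (cent_norm _)) // (fintype.subsetP (normG P)).
  rewrite !yE !ifN //; apply: contra nCg => /SC //.
  by rewrite memJ_norm.
have bry : br y = x.
  apply/ffunP=> g; rewrite brauerE yE; have [Sg|Sg] := boolP (g \in S).
    by rewrite SC // liftK.
  by rewrite (Sx g Sg) rmorph0 if_same.
have Pay : fixed_by P (a * y) by move=> u Pu; rewrite gconjM Pa // Py.
have sTr : gfix s K (rtrace P K (a * y)).
  split; last exact: rtrace_fixed.
  apply: (rtrace_span sPK) => [u g Ku|].
    have /morphimP [z Nz Hz ->] := Hs; rewrite val_coset // => /rcosetP[v Kv gx].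
    have gE : g = (u * (v * z) * u^-1)%g.
      by rewrite -gx conjgE !mulgA mulgV mul1g mulgK.
    have {gE} -> : g = (u * v * (u^-1) ^ z^-1 * z)%g.
      by rewrite [LHS]gE conjgE invgK !mulgA mulgKV.
    apply/rcosetP; exists (u * v * (u^-1) ^ z^-1)%g => //.
    by apply: groupM; [apply: groupM|rewrite memJ_norm ?groupV].
  apply: gspanM Ka ys => g h Kg sh; rewrite -[s]mul1g; apply: mem_cosetM => //.
  by rewrite coset_oneE.
exists (b * rtrace P K (a * y)); first by exists (rtrace P K (a * y)).
have Ptr : fixed_by P (rtrace P K (a * y)).
  by move=> u Pu; apply: (rtrace_fixed Pay); apply: (fintype.subsetP sPK).
rewrite (brauerM res chk pP Pb Ptr) (brauer_rtrace res chk pP sPK Pay).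
rewrite (brauerM res chk pP) // bry rtrace_mulr ?finset.subsetI ?sPK ?normG //.
by rewrite -(brauer_rtrace res chk pP sPK Pa) bE mulrA -/bbar brauer_idem.
Qed.

End BrauerImage.

(** * Left multiplication as a matrix *)

Section LeftMultiplication.
Variables (R : comNzRingType) (gT : finGroupType).
Implicit Types z w : galg R gT.

Definition galg_mx z : 'M[R]_#|gT| :=
  \matrix_(i, j) z (enum_val i * (enum_val j)^-1)%g.
Definition galg_col w : 'cV[R]_#|gT| := \col_i w (enum_val i).
Local Notation M := galg_mx.
Local Notation C := galg_col.

Lemma mulmx_galg z w : M z *m C w = C (z * w).
Proof.
apply/colP=> i; rewrite !mxE galgE (reindex_inj (inj_comp (mulgI (enum_val i)) invg_inj)) /=.
rewrite (reindex (fun j : 'I_#|gT| => enum_val j)) /=; last first.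
  by apply: onW_bij; apply: enum_val_bij.
by apply: eq_bigr => j _; rewrite !mxE invMg invgK mulgKV.
Qed.

Lemma galg_col_inj : injective C.
Proof.
move=> w1 w2 /colP E; apply/ffunP=> g; have := E (enum_rank g).
by rewrite !mxE enum_rankK.
Qed.

Lemma galg_mxM z w : M (z * w) = M z *m M w.
Proof.
apply/matrixP=> i j; rewrite !mxE galgE.
rewrite (reindex_inj (inj_comp (mulgI (enum_val i)) invg_inj)) /=.
rewrite (reindex (fun j : 'I_#|gT| => enum_val j)) /=; last first.
  by apply: onW_bij; apply: enum_val_bij.
by apply: eq_bigr => l _; rewrite !mxE invMg invgK -mulgA mulKg.
Qed.

End LeftMultiplication.

(** * Reduction modulo the maximal ideal of the base ring *)

(** The kernel of res is a maximal ideal, hence the only one, and a non-unit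
    generates an ideal contained in a maximal one. *)
Lemma res_unit (O : idomainType) (k : fieldType) (res : {rmorphism O -> k}) :
  (is_dvr O \/ GRing.field_axiom O) -> (forall y : k, exists x : O, res x = y) ->
  forall x, res x != 0 -> x \is a GRing.unit.
Proof.
move=> dvrO res_onto x rx; case: dvrO => [|fO]; last first.
  by apply: fO; apply: contraNneq rx => ->; rewrite rmorph0.
have rO : unital_subring [set: O] 1.
  by split=> // y _; rewrite ?mul1r ?mulr1.
move=> [_ [m [maxm uniqm]] _].
have maxker : max_left_ideal [set: O] [set y | res y = 0].
  split.
  - split=> //= [|y z ry rz|a y _ ry]; first exact: rmorph0.
      by rewrite rmorphB ry rz subrr.
    by rewrite rmorphM ry mulr0.
  - move=> kerT; have : [set y | res y = 0] 1 by rewrite kerT.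
    by move=> /= /eqP; rewrite rmorph1 oner_eq0.
  - move=> L [_ L0 LB LM] kerL; have [|nL] := pselect (L `<=` [set y | res y = 0]).
      by left; apply/seteqP.
    right; apply/seteqP; split=> // z _.
    have [y Ly ry] : exists2 y, L y & res y != 0.
      apply: contrapT => nex; apply: nL => y Ly /=; apply/eqP.
      by apply: contrapT => /negP ry; apply: nex; exists y.
    have [t rt] := res_onto (res y)^-1.
    have L1 : L (1 - t * y) by apply: kerL; rewrite /= rmorphB rmorphM rt mulVf // rmorph1 subrr.
    have {}L1 : L 1.
      by rewrite -[1](subrK (t * y)); apply: (closed_add L0 LB) => //; apply: LM.
    by rewrite -[z]mulr1; apply: LM.
apply: contrapT => ux.
have iL : left_ideal [set: O] [set a * x | a in [set: O]].
  split=> //= [|_ _ [a _ <-] [c _ <-]|c _ _ [a _ <-]]; first by exists 0; rewrite ?mul0r.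
    by exists (a - c); rewrite ?mulrBl.
  by exists (c * a); rewrite ?mulrA.
have [|M maxM [LM _]] := max_left_ideal_exists rO iL.
  by move=> [a _ ax]; apply: ux; apply/unitrPr; exists a; rewrite mulrC.
have : M x by apply: LM; exists 1; rewrite ?mul1r.
rewrite -(uniqm _ maxM) (uniqm _ maxker) /= => /eqP.
exact/negP.
Qed.

Section Nakayama.
Variables (O : idomainType) (k : fieldType) (res : {rmorphism O -> k}).
Variable gT : finGroupType.
Hypothesis unitP : forall x, res x != 0 -> x \is a GRing.unit.
Implicit Types (z w a : galg O gT).

Let M := @galg_mx O gT.
Let C := @galg_col O gT.

(** The matrix of left multiplication by z reduces to the identity matrix, so its
    determinant is invertible in the local ring O. *)
Lemma unit_lift z : (forall g, res (z g) = (g == 1%g)%:R) ->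
  exists w, w * z = 1 /\ z * w = 1.
Proof.
move=> z1; have uM : M z \in unitmx.
  rewrite unitmxE unitP // -det_map_mx.
  suff -> : map_mx res (M z) = 1%:M by rewrite det1 oner_eq0.
  apply/matrixP=> i j; rewrite !mxE z1; congr ((nat_of_bool _)%:R).
  by rewrite -eq_mulgV1 (inj_eq enum_val_inj).
pose w : galg O gT := [ffun g => (invmx (M z) *m C 1) (enum_rank g) 0].
have Cw : C w = invmx (M z) *m C 1.
  by apply/colP=> i; rewrite mxE ffunE enum_valK.
have zw : z * w = 1 by apply: galg_col_inj; rewrite -mulmx_galg -/M -/C Cw mulKVmx.
exists w; split=> //; apply: galg_col_inj; rewrite -[LHS](mulKmx uM) mulmx_galg.
by rewrite mulrA zw mul1r -[X in galg_col X]mulr1 -mulmx_galg mulKmx.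
Qed.

Lemma unit_lift_fix (L X : {group gT}) z :
  (forall g, res (z g) = (g == 1%g)%:R) -> gfix L X z ->
  exists2 w, gfix L X w & w * z = 1.
Proof.
move=> /unit_lift [w [wz zw]] [Lz Xz]; exists w => //.
have uniq v : z * v = 1 -> v = w.
  by move=> zv; rewrite -[v]mul1r -wz -mulrA zv mulr1.
split=> [g Lg|x Xx]; last first.
  by apply: uniq; rewrite -(Xz x Xx) -gconjM zw gconj1.
pose v : galg O gT := [ffun g => if g \in L then w g else 0].
suff <- : v = w by rewrite ffunE (negPf Lg).
apply: uniq; apply/ffunP=> h; rewrite galgE galg1E.
have [Lh|nLh] := boolP (h \in L).
  rewrite -galg1E -zw galgE; apply: eq_bigr => u _.
  have [Lu|/Lz ->] := boolP (u \in L); last by rewrite !mul0r.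
  by rewrite ffunE groupM ?groupV.
rewrite big1 => [|u _].
  by case: eqP nLh => // ->; rewrite group1.
have [Lu|/Lz ->] := boolP (u \in L); last by rewrite mul0r.
by rewrite ffunE groupMl ?groupV // (negPf nLh) mulr0.
Qed.

(** Nakayama's lemma: 1 - a x reduces to 1 and is therefore invertible, with
    an inverse that is unique and so has the same support and fixed points. *)
Lemma ker_res_jacobson (L X : {group gT}) (e x : galg O gT) :
  L \subset X -> gfix L X e -> e * e = e ->
  gcomp e (1%g : coset_of L) X x -> (forall g, res (x g) = 0) ->
  jacobson (gcomp e (1%g : coset_of L) X) x.
Proof.
move=> sLX Le ee Bx x0.
have eL y : y \in L -> gconj e y = e.
  by move=> Ly; have [_ Xe] := Le; apply: Xe; apply: (fintype.subsetP sLX).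
have gB := gcomp_grading sLX (fintype.subxx L) Le ee eL.
have rB := gr1_subring gB; have cB := gr_comm gB.
apply/(jacobsonP _ rB cB); split=> // a Ba.
have Bax := usr_mul rB Ba Bx.
have [||w Lw wz] := @unit_lift_fix L X (1 - a * x).
- move=> g; rewrite galgBE galg1E rmorphB rmorph_nat galgE rmorph_sum.
  by rewrite big1 ?subr0 // => h _; rewrite rmorphM x0 mulr0.
- apply: gfixB; first exact: gfix1.
  by have := gcomp_fix Le Bax; rewrite coset_oneE.
exists (e * w); first by exists w; rewrite ?coset_oneE.
have -> : e - a * x = (1 - a * x) * e.
  by rewrite mulrBl mul1r (usr_mulr1 rB Bax).
by rewrite -mulrA (mulrA w) wz mul1r ee.
Qed.

End Nakayama.

(** * Homogeneous units over a field *)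

Section FieldUnits.
Variables (k : fieldType) (gT : finGroupType).
Local Notation A := (galg k gT).
Implicit Types (a f w x y z t u v : A).

Variables (S : set A) (e : A).
Hypotheses (rS : unital_subring S e) (cS : commutative_on S).
Hypothesis kS : forall c x, S x -> S (gscale c x).

Let SX w i : S w -> S (e * w ^+ i).
Proof.
move=> Sw; elim: i => [|i IHi]; first by rewrite mulr1; apply: (usr_one rS).
by rewrite exprSr mulrA; apply: (usr_mul rS).
Qed.

(** The powers of w are linearly dependent; solve a relation for its term of
    lowest degree. *)
Lemma power_divides_next w : S w -> exists m t, S t /\ e * w ^+ m = e * w ^+ m.+1 * t.
Proof.
move=> Sw; pose n := #|gT|.
pose V := \matrix_(i < n.+1, j < n) (e * w ^+ i) (enum_val j).
have : kermx V != 0.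
  rewrite kermx_eq0 -row_leq_rank -ltnNge ltnS; exact: rank_leq_col.
case/rowV0Pn=> c /sub_kermxP cV; case/rV0Pn=> i0 ci0.
have rel : \sum_(i < n.+1) gscale (c 0 i) (e * w ^+ i) = 0.
  apply/ffunP=> g; rewrite galg_sumE galg0E.
  have /rowP/(_ (enum_rank g)) := cV; rewrite !mxE => cVg.
  rewrite -[RHS]cVg; by apply: eq_bigr => i _; rewrite mxE gscaleE enum_rankK.
pose i1 := [arg min_(i < i0 | c 0 i != 0) i].
have [ci1 mini] : c 0 i1 != 0 /\ forall j : 'I_n.+1, c 0 j != 0 -> (i1 <= j)%N.
  by rewrite /i1; case: arg_minnP.
pose t := \sum_(i < n.+1 | (i1 < i)%N) gscale (- (c 0 i1)^-1 * c 0 i) (e * w ^+ (i - i1.+1)).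
exists i1, t; split.
  by apply: (closed_sum _ (usr_0 rS) (usr_sub rS)) => i _; apply: kS; apply: SX.
have -> : e * w ^+ i1.+1 * t = \sum_(i < n.+1 | (i1 < i)%N)
    gscale (- (c 0 i1)^-1 * c 0 i) (e * w ^+ i).
  rewrite mulr_sumr; apply: eq_bigr => i lti; rewrite gscale_mulr; congr gscale.
  rewrite mulrA (usr_mulr1 rS); last exact: SX.
  by rewrite -mulrA -exprD subnKC.
apply/ffunP=> g; move: rel => /ffunP/(_ g); rewrite !galg_sumE galg0E.
rewrite (bigID (fun i : 'I_n.+1 => (i1 < i)%N)) /= addrC (bigD1 i1) ?ltnn //=.
rewrite [X in _ + X + _]big1 => [|i /andP[]]; last first.
  rewrite -leqNgt => ii1 ine; have [c0|/mini] := eqVneq (c 0 i) 0.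
    by rewrite gscaleE c0 mul0r.
  by move=> i1i; case/eqP: ine; apply/val_inj/anti_leq; rewrite ii1 i1i.
rewrite addr0 gscaleE => /(canRL (addrK _)); rewrite sub0r => ce.
apply: (mulfI ci1); rewrite ce mulr_sumr -sumrN; apply: eq_bigr => i _.
by rewrite !gscaleE !mulNr mulrN !mulrA mulfV // mul1r.
Qed.

(** If w^m = w^m (w t) with m positive, then (w t)^m is an idempotent that is
    zero only if w^m is. *)
Lemma idempotent_or_nilpotent w : S w ->
  (exists n, w ^+ n.+1 = 0) \/
  exists t, [/\ S t, w * t * (w * t) = w * t & w * t <> 0].
Proof.
move=> Sw; have [m [t [St wt]]] := power_divides_next Sw.
have Swt : S (w * t) by apply: (usr_mul rS).
have powS x n : S x -> S (x ^+ n.+1).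
  by move=> Sx; elim: n => [|n IHn]; rewrite ?expr1 // exprS; apply: (usr_mul rS).
have {}wt : w ^+ m.+1 = w ^+ m.+1 * (w * t).
  move: (congr1 (fun z => z * w) wt) => /=.
  rewrite -!mulrA -exprSr (cS St Sw) [RHS]mulrA.
  by rewrite (usr_mul1 rS (powS w m Sw)).
have wtn n : w ^+ m.+1 = w ^+ m.+1 * (w * t) ^+ n.
  by elim: n => [|n IHn]; rewrite ?mulr1 // [(w * t) ^+ _]exprSr mulrA -IHn.
have ewt : (w * t) ^+ m.+1 = w ^+ m.+1 * t ^+ m.+1 by apply: exprMn_comm; apply: cS.
have [w0|wn0] := pselect (w ^+ m.+1 = 0); first by left; exists m.
right; exists (t * (w * t) ^+ m).
have -> : w * (t * (w * t) ^+ m) = (w * t) ^+ m.+1 by rewrite mulrA -exprS.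
split.
- case: (m) => [|n]; first by rewrite mulr1.
  by apply: (usr_mul rS) => //; apply: powS.
- by rewrite {1}ewt -mulrA (cS (powS t m St) (powS _ m Swt)) mulrA -wtn ewt.
- by move=> wt0; apply: wn0; rewrite (wtn m.+1) wt0 mulr0.
Qed.

Section Crossed.
Variables X Y : set A.
Hypotheses (X0 : X 0) (Y0 : Y 0).
Hypothesis XD : forall x y, X x -> X y -> X (x + y).
Hypothesis YD : forall x y, Y x -> Y y -> Y (x + y).
Hypothesis SXl : forall a x, S a -> X x -> X (a * x).
Hypothesis YSr : forall a y, S a -> Y y -> Y (y * a).
Hypothesis XY : forall x y, X x -> Y y -> S (x * y).

(** Let f be the idempotent complementary to u v. Not every f x y is nilpotent,
    since f is a sum of such elements; so f x y t is a nonzero idempotent for some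
    x, y, t, and it can be added to u v. The rank of left multiplication by
    the complementary idempotent decreases. *)
Lemma crossed_step (u v : A) : X u -> Y v -> u * v * (u * v) = u * v ->
  u * v <> e -> setprod X Y e ->
  exists u' v', [/\ X u', Y v', u' * v' * (u' * v') = u' * v' &
    (\rank (galg_mx (e - u' * v')%R) < \rank (galg_mx (e - u * v)%R))%N].
Proof.
move=> Xu Yv idE nE eXY; set E := u * v in idE nE *; set f := e - E.
have SE : S E by apply: XY.
have Se := usr_one rS; have Sf : S f by apply: (usr_sub rS).
have Ef : E * f = 0 by rewrite mulrBr (usr_mulr1 rS SE) idE subrr.
have ff : f * f = f by rewrite {1}/f mulrBl Ef subr0 (usr_mul1 rS Sf).
have tJ := jacobson_ideal rS cS.
have [x [y [Xx Yy nJ]]] : exists x y, [/\ X x, Y y & ~ jacobson S (f * (x * y))].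
  apply: contrapT => nex; apply: nE.
  have Jf : jacobson S f.
    rewrite -(usr_mulr1 rS Sf); move: eXY.
    apply: (setprod_ind (V := [set z | jacobson S (f * z)])) => /=.
    - by rewrite mulr0; apply: (ts_0 tJ).
    - by move=> x y Jx Jy; rewrite mulrDr; apply: (ts_add tJ).
    - move=> x y Xx Yy; apply: contrapT => nJ; apply: nex; by exists x, y.
  have [_ /(_ e Se) [w Sw we]] := (jacobsonP _ rS cS).1 Jf.
  have f0 : f = 0.
    rewrite -(usr_mul1 rS Sf) -we (usr_mul1 rS Sf) -mulrA mulrBl.
    by rewrite (usr_mul1 rS Sf) ff subrr mulr0.
  by apply/esym/eqP; rewrite -subr_eq0 -/f f0.
have Sw : S (f * (x * y)) by apply: (usr_mul rS) => //; apply: XY.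
have [[n w0]|[t [St idE' nE']]] := idempotent_or_nilpotent Sw.
  by case: nJ; apply: (jacobson_root (n := n) rS cS) => //; rewrite w0; apply: (ts_0 tJ).
set E' := f * (x * y) * t in idE' nE'.
have SE' : S E' by apply: (usr_mul rS).
have fE' : f * E' = E' by rewrite /E' !mulrA ff.
have EE' : E * E' = 0 by rewrite -fE' mulrA Ef mul0r.
have E'E : E' * E = 0 by rewrite cS.
have Xu' : X (f * x) by apply: SXl.
have Yv' : Y (y * t) by apply: YSr.
have E'uv : f * x * (y * t) = E' by rewrite /E' !mulrA.
exists (E * u + E' * (f * x)), (v * E + (y * t) * E').
have -> : (E * u + E' * (f * x)) * (v * E + (y * t) * E') = E + E'.
  have h1 : E * u * (v * E) = E by rewrite -mulrA (mulrA u) -/E !idE.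
  have h2 : E * u * (y * t * E') = 0.
    by rewrite -mulrA (mulrA u) (cS (XY Xu Yv') SE') (mulrA E) EE' mul0r.
  have h3 : E' * (f * x) * (v * E) = 0.
    by rewrite -mulrA (mulrA (f * x)) (cS (XY Xu' Yv) SE) (mulrA E') E'E mul0r.
  have h4 : E' * (f * x) * (y * t * E') = E'.
    by rewrite -mulrA (mulrA (f * x)) E'uv !idE'.
  by rewrite mulrDl !mulrDr h1 h2 h3 h4 addr0 add0r.
split.
- by apply: XD; apply: SXl.
- by apply: YD; apply: YSr.
- by rewrite mulrDl !mulrDr idE idE' EE' E'E addr0 add0r.
have f2E : e - (E + E') = f - E' by rewrite opprD addrA.
have f2f : (f - E') * f = f - E' by rewrite mulrBl ff cS // fE'.
have f2E' : (f - E') * E' = 0 by rewrite mulrBl fE' idE' subrr.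
rewrite f2E; apply: rank_ltmx; rewrite ltmxE -{1}f2f galg_mxM submxMl /=.
apply/negP=> /submxP[D fD]; apply: nE'; apply: galg_col_inj.
have c0 : galg_col (0 : A) = 0 by apply/colP=> i; rewrite !mxE galg0E.
by rewrite -fE' -mulmx_galg fD -mulmxA mulmx_galg f2E' c0 mulmx0.
Qed.

Lemma crossed_pair : setprod X Y e -> exists u v, [/\ X u, Y v & u * v = e].
Proof.
move=> eXY.
suff main n : forall u v, X u -> Y v -> u * v * (u * v) = u * v ->
    (\rank (galg_mx (e - u * v)%R) <= n)%N -> exists u v, [/\ X u, Y v & u * v = e].
  by apply: (main _ 0 0) => //; rewrite !mulr0.
elim: n => [|n IHn] u v Xu Yv idE rk.
  have [uv|uv] := pselect (u * v = e); first by exists u, v.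
  have [u' [v' [_ _ _]]] := crossed_step Xu Yv idE uv eXY.
  by rewrite ltnNge (leq_trans rk).
have [uv|uv] := pselect (u * v = e); first by exists u, v.
have [u' [v' [Xu' Yv' idE' lt]]] := crossed_step Xu Yv idE uv eXY.
by apply: (IHn u' v') => //; rewrite -ltnS (leq_trans lt).
Qed.

End Crossed.
End FieldUnits.

(** * Central characters of the integral group ring *)

Section CenterRing.
Variable aT : finGroupType.

(** The centre of the integral group ring of aT, that is, the ring of integral
    class functions under convolution, is made into a commutative ring in order to
    use polynomials with coefficients in it. *)
Definition zcenter_pred : {pred galg int aT} := fun a => [forall x, gconj a x == a].

Lemma zcenterP (a : galg int aT) :
  reflect (forall x, gconj a x = a) (a \in zcenter_pred).
Proof. by apply: (iffP forallP) => za x; apply/eqP/za. Qed.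

Fact zcenter_subring : subring_closed zcenter_pred.
Proof.
split.
- by apply/zcenterP=> x; apply: gconj1.
- by move=> a b /zcenterP za /zcenterP zb; apply/zcenterP=> x; rewrite gconjB za zb.
- by move=> a b /zcenterP za /zcenterP zb; apply/zcenterP=> x; rewrite gconjM za zb.
Qed.
HB.instance Definition _ :=
  GRing.isSubringClosed.Build (galg int aT) zcenter_pred zcenter_subring.

Record zcenter : Type := ZCenter { zcval :> galg int aT; _ : zcval \in zcenter_pred }.
HB.instance Definition _ := [isSub for zcval].
HB.instance Definition _ := [Choice of zcenter by <:].
HB.instance Definition _ := [SubChoice_isSubNzRing of zcenter by <:].

Lemma zcenter_conj (a : zcenter) x : gconj (zcval a) x = a.
Proof. by case: a => a za; apply: (zcenterP _ za). Qed.

Fact zcenter_mulC : commutative (@GRing.mul zcenter).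
Proof.
move=> a b; apply: val_inj; rewrite !rmorphM /=.
by apply: fixed_comm => x _; apply: zcenter_conj.
Qed.
HB.instance Definition _ :=
  GRing.PzSemiRing_hasCommutativeMul.Build zcenter zcenter_mulC.

End CenterRing.

Section CentralCharacters.
Variable aT : finGroupType.
Local Notation G := [set: aT]%G.
Implicit Types (a b : zcenter aT) (i : Iirr G) (g h x y : aT).

Definition zrep i (a : galg int aT) :=
  \sum_(g : aT) (a g)%:~R *: ('Chi_i g : 'M[algC]_(irr_degree (socle_of_Iirr i))).

Lemma zrepM i (a b : galg int aT) : zrep i (a * b) = zrep i a *m zrep i b.
Proof.
rewrite /zrep mulmx_suml (eq_bigr (fun g => \sum_h ((a h)%:~R * (b (h^-1 * g)%g)%:~R) *: 'Chi_i g)); last first.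
  by move=> g _; rewrite galgE rmorph_sum scaler_suml; apply: eq_bigr => h _; rewrite rmorphM.
rewrite exchange_big; apply: eq_bigr => h _ /=.
rewrite mulmx_sumr (reindex_inj (mulgI h)); apply: eq_bigr => g _ /=.
by rewrite mulKg -scalemxAl -scalemxAr scalerA -repr_mxM ?finset.inE.
Qed.

(** The central character of the irreducible character of index i. *)
Definition zomega i a : algC := (\sum_g (zcval a g)%:~R * 'chi_i g) / 'chi_i 1%g.

Lemma zrep_scalar i a : zrep i a = (zomega i a)%:M.
Proof.
have /is_scalar_mxP[c ac] : is_scalar_mx (zrep i a).
  apply: (mx_abs_irr_cent_scalar (groupC (socle_irr _))).
  apply/centgmxP=> x Gx; rewrite /zrep mulmx_suml mulmx_sumr.
  rewrite [RHS](reindex_inj (conjg_inj x)) /=; apply: eq_bigr => g _.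
  rewrite gconj_fixE; last exact: zcenter_conj.
  rewrite -scalemxAl -scalemxAr -!repr_mxM ?finset.inE //.
  by congr (_ *: submod_repr _ _); apply: conjgC.
rewrite ac; congr (_%:M); rewrite /zomega; apply: (canRL (mulfK (irr1_neq0 i))).
have := congr1 mxtrace ac; rewrite mxtrace_scalar /zrep raddf_sum /= => tr.
rewrite irr1_degree mulr_natr -tr; apply: eq_bigr => g _.
by rewrite mxtraceZ -irrRepr cfunE finset.inE.
Qed.

Fact zomega_sub i : zmod_morphism (zomega i).
Proof.
move=> a b; rewrite /zomega -mulrBl -sumrB; congr (_ / _); apply: eq_bigr => g _.
by rewrite -mulrBl -rmorphB; congr (_%:~R * _); rewrite [zcval (a - b)]/= galgBE.
Qed.

Fact zomega_monoid i : monoid_morphism (zomega i).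
Proof.
split=> [|a b].
  rewrite /zomega (bigD1 1%g) //= big1 => [|g g1].
    by rewrite galg1E eqxx mul1r addr0 divff ?irr1_neq0.
  by rewrite galg1E (negPf g1) mul0r.
have := congr1 mxtrace (zrepM i a b).
rewrite -[zcval a * zcval b]/(zcval (a * b)) !zrep_scalar -scalar_mxM.
rewrite !mxtrace_scalar => tr; apply: (mulIf (irr1_neq0 i)).
by rewrite irr1_degree !mulr_natr.
Qed.

HB.instance Definition _ i :=
  GRing.isZmodMorphism.Build (zcenter aT) algC (zomega i) (zomega_sub i).
HB.instance Definition _ i :=
  GRing.isMonoidMorphism.Build (zcenter aT) algC (zomega i) (zomega_monoid i).

(** The irreducible characters span the class functions. *)
Lemma zomega_faithful a : (forall i, zomega i a = 0) -> a = 0.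
Proof.
move=> a0; apply: val_inj; apply/ffunP=> g.
have cla : is_class_fun <<G>> [ffun g => (zcval a g)%:~R : algC].
  apply: intro_class_fun => [x y _ _|x]; last by rewrite /= genGid finset.inE.
  by rewrite gconj_fixE //; apply: zcenter_conj.
pose phi : 'CF(G) := Cfun 0 cla.
have phiE x : phi x = (zcval a x)%:~R by rewrite cfunE.
suff phi0 : phi = 0.
  have /eqP := phiE g; rewrite phi0 cfunE eq_sym intr_eq0 => /eqP ->.
  by rewrite galg0E.
rewrite [phi]cfun_sum_cfdot big1 // => i _.
suff -> : '[phi, 'chi_i] = 0 by rewrite scale0r.
have -> : '[phi, 'chi_i] = #|G|%:R^-1 * ((zomega i a * 'chi_i 1%g)^* )%C.
  rewrite cfdotE; congr (_ * _); rewrite /zomega divfK ?irr1_neq0 // rmorph_sum.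
  rewrite (eq_bigl xpredT) => [|x]; last by rewrite finset.inE.
  by apply: eq_bigr => x _; rewrite rmorphM /= phiE rmorph_int.
by rewrite a0 mul0r rmorph0 mulr0.
Qed.

Lemma zomega_Aint i a : zomega i a \in Aint.
Proof.
have aJ : {in G &, forall g h, (zcval a (g ^ h)%g)%:~R * 'chi_i (g ^ h)%g
                              = (zcval a g)%:~R * 'chi_i g}.
  move=> g h Gg Gh; rewrite cfunJ // gconj_fixE //; exact: zcenter_conj.
rewrite /zomega (eq_bigl (mem G)) => [|g]; last by rewrite /= finset.inE.
rewrite (sum_by_classes aJ) mulr_suml rpred_sum // => C /imsetP[x Gx ->].
rewrite mulrCA -mulrA rpredM ?rpred_int //.
have [y _ ->] := repr_class G x; rewrite cfunJ ?finset.inE //.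
exact: Aint_class_div_irr1.
Qed.

(** ** Power sums over a class *)

Fact zcls_subproof m x : ([ffun h => \sum_(g in x ^: G) (g ^+ m == h)%g%:R] :
  galg int aT) \in @zcenter_pred aT.
Proof.
apply/zcenterP=> y; apply/ffunP=> h; rewrite gconjE !ffunE.
rewrite [RHS](reindex_inj (conjg_inj y)) /=; apply: eq_big => g.
  by rewrite memJ_norm // (fintype.subsetP (class_norm x G)) ?finset.inE.
by rewrite -conjXg -(inj_eq (conjg_inj y) _ (h ^ _)%g) conjgKV.
Qed.
(** The sum of the m-th powers of the conjugates of x; it is the class sum of
    x ^+ m when m is prime to the order of the group. Summing over the class of x
    makes the action of Galois automorphisms on its central character values
    immediate. *)
Definition zcls m x : zcenter aT := ZCenter (zcls_subproof m x).

Lemma zomega_zcls i m x :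
  zomega i (zcls m x) = (\sum_(g in x ^: G) 'chi_i (g ^+ m)%g) / 'chi_i 1%g.
Proof.
rewrite /zomega; congr (_ / _).
under eq_bigr => h _ do rewrite ffunE rmorph_sum mulr_suml.
rewrite exchange_big /=; apply: eq_bigr => g _.
rewrite (bigD1 (g ^+ m)%g) //= eqxx mul1r big1 ?addr0 // => h hg.
by rewrite eq_sym (negPf hg) mul0r.
Qed.

Lemma zomega_zcls_mod i m x :
  zomega i (zcls (m %% #|G|) x) = zomega i (zcls m x).
Proof.
rewrite !zomega_zcls; congr (_ / _); apply: eq_bigr => g _; congr ('chi_i _).
by rewrite expg_mod // expg_cardG ?finset.inE.
Qed.

(** Restricted to the cyclic group generated by g, a character is a sum of
    linear characters, whose values are roots of unity. *)
Lemma aut_irr (nu : {rmorphism algC -> algC}) k i g :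
  (forall z, z ^+ #|G| = 1 -> nu z = z ^+ k) -> nu ('chi_i g) = 'chi_i (g ^+ k)%g.
Proof.
move=> nuk; have Ng : g \in <[g]> := cycle_id g.
have sgG : <[g]> \subset G by apply/fintype.subsetP=> x _; rewrite finset.inE.
rewrite -!(cfResE _ sgG) ?groupX //.
have [r ->] := char_sum_irr (cfRes_char <[g]> (irr_char i)).
rewrite !sum_cfunE rmorph_sum; apply: eq_bigr => j _.
have lj : 'chi_j \is a linear_char by apply/char_abelianP/cycle_abelian.
rewrite lin_charX // nuk // -lin_charX //.
by rewrite expg_cardG ?finset.inE // lin_char1.
Qed.

Definition zclass_poly x : {poly zcenter aT} :=
  \prod_(m < #|G| | coprime #|G| m) ('X - (zcls m x)%:P).

(** A Galois automorphism raises the |G|-th roots of unity to some power k prime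
    to |G| and permutes the factors accordingly. *)
Lemma zclass_poly_rational x i j : zomega i (zclass_poly x)`_j \in Crat.
Proof.
have QE : map_poly (zomega i) (zclass_poly x)
    = \prod_(m < #|G| | coprime #|G| m) ('X - (zomega i (zcls m x))%:P).
  rewrite rmorph_prod; apply: eq_bigr => m _.
  by rewrite rmorphB /= map_polyX map_polyC.
rewrite -coef_map QE.
have [Qn galQn [QnC nuQn [w [pw _] vals]]] := group_num_field_exists G.
have val g : {a | QnC a = 'chi_i g}.
  by apply: vals; [apply: irr_char|apply: order_dvdG; rewrite finset.inE].
pose c m := (\sum_(g in x ^: G) sval (val (g ^+ m)%g)) / sval (val 1%g).
have cE m : QnC (c m) = zomega i (zcls m x).
  rewrite zomega_zcls /c fmorph_div rmorph_sum; case: (val 1%g) => /= a ->.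
  by congr (_ / _); apply: eq_bigr => g _; case: (val _).
pose Q' := \prod_(m < #|G| | coprime #|G| m) ('X - (c m)%:P).
have Q'E : map_poly QnC Q' = \prod_(m < #|G| | coprime #|G| m) ('X - (zomega i (zcls m x))%:P).
  rewrite rmorph_prod; apply: eq_bigr => m _.
  by rewrite rmorphB /= map_polyX map_polyC /= cE.
rewrite -Q'E coef_map /=.
suff /vlineP[q ->] : Q'`_j \in 1%VS.
  by rewrite alg_num_field fmorph_rat Crat_rat.
rewrite -(galois_fixedField galQn); apply/fixedFieldP; first exact: memvf.
move=> s Gs; have [nu nuE] := nuQn s.
have pz : #|G|.-primitive_root (QnC w) by rewrite fmorph_primitive_root.
have [k nuz] : {k : 'I_#|G| | nu (QnC w) = QnC w ^+ k}.
  by apply: (prim_rootP pz); rewrite -rmorphXn (prim_expr_order pz) rmorph1.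
have cok : coprime #|G| k.
  by rewrite coprime_sym -(prim_root_exp_coprime _ pz) -nuz fmorph_primitive_root.
have nuk z : z ^+ #|G| = 1 -> nu z = z ^+ k.
  by case/(prim_rootP pz) => l ->; rewrite rmorphXn /= nuz -!exprM mulnC.
have nuzcls m : nu (zomega i (zcls m x)) = zomega i (zcls (k * m) x).
  rewrite !zomega_zcls fmorph_div rmorph_sum /= (aut_irr _ _ nuk) expg1n.
  congr (_ / _); apply: eq_bigr => g _.
  by rewrite (aut_irr _ _ nuk) -expgM mulnC.
apply: (fmorph_inj QnC); rewrite nuE -!coef_map Q'E.
congr ((polyseq _)`_j); rewrite rmorph_prod /=.
pose h (m : 'I_#|G|) : 'I_#|G| := Ordinal (ltn_pmod (k * m) (cardG_gt0 G)).
have h_inj : injective h.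
  move=> m1 m2 /(congr1 (@nat_of_ord _)) /= /eqP mE; apply: val_inj => /=.
  wlog le12 : m1 m2 mE / (m1 <= m2)%N => [IH|].
    by case: (leqP m1 m2) => [|/ltnW] le; [apply: IH|apply/esym/IH; rewrite // eq_sym].
  move: mE; rewrite eq_sym eqn_mod_dvd ?leq_mul // -mulnBr Gauss_dvdr //.
  move=> /dvdn_leq; case: posnP => [/eqP|_ /(_ isT)].
    by rewrite subn_eq0 => le21 _; apply/anti_leq; rewrite le12.
  by rewrite leqNgt (leq_ltn_trans (leq_subr _ _)).
rewrite [RHS](reindex_inj h_inj); apply: eq_big => m.
  by rewrite /= coprime_modr coprimeMr cok.
by move=> _; rewrite rmorphB /= map_polyX map_polyC /= nuzcls zomega_zcls_mod.
Qed.

(** The value of a coefficient under each central character is rational and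
    integral over the integers, hence an integer; the product over these values
    vanishes under all central characters. *)
Lemma zclass_poly_coef_root x j : exists rs : seq int,
  \prod_(r <- rs) ((zclass_poly x)`_j - r%:~R) = 0.
Proof.
set a := (zclass_poly x)`_j.
have int i : {r : int | zomega i a = r%:~R}.
  apply: sig_eqW; apply/Num.Theory.intrP; apply: Cint_rat_Aint (zomega_Aint _ _).
  exact: zclass_poly_rational.
exists [seq sval (int i) | i : Iirr G]; apply: zomega_faithful => i.
rewrite rmorph_prod big_map (bigD1_seq i) ?mem_enum ?enum_uniq //=.
by rewrite rmorphB rmorph_int /=; case: (int i) => r /= ->; rewrite subrr mul0r.
Qed.

Lemma zclass_poly_root x : root (zclass_poly x) (zcls 1 x).
Proof.
rewrite /zclass_poly; have n0 := cardG_gt0 G.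
pose m1 : 'I_#|G| := Ordinal (ltn_pmod 1 n0).
have m1E : zcls m1 x = zcls 1 x.
  apply: val_inj; apply/ffunP=> h; rewrite !ffunE; apply: eq_bigr => g _.
  by rewrite /= expg_mod // expg_cardG ?finset.inE.
rewrite (bigD1 m1) /=; last by rewrite coprime_modr coprimen1.
by rewrite rootE hornerM hornerXsubC -m1E subrr mul0r.
Qed.

End CentralCharacters.

(** * The kernel of the Brauer homomorphism on a block *)

Section PushForward.
Variables (R : comNzRingType) (gT : finGroupType) (K : {group gT}).
Local Notation aT := (subg_of K).
Local Notation zK := (zcenter aT).
Implicit Types (a : zK) (g h x y : gT).

Lemma subgV x : x \in K -> subg K x^-1%g = (subg K x)^-1%g.
Proof. by move=> Kx; apply: subg_inj; rewrite /= !subgK ?groupV. Qed.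

Lemma subgJ x y : x \in K -> y \in K -> subg K (x ^ y)%g = (subg K x ^ subg K y)%g.
Proof. by move=> Kx Ky; rewrite !conjgE !subgM ?subgV ?groupM ?groupV. Qed.

(** Central characters are available for a group that is a whole type; this
    transports the centre of the integral group ring of the type subg_of K to the
    elements of the group algebra of gT supported on K. *)
Definition zpush a : galg R gT :=
  [ffun g => if g \in K then (zcval a (subg K g))%:~R else 0].

Lemma zpushE a g : zpush a g = if g \in K then (zcval a (subg K g))%:~R else 0.
Proof. by rewrite ffunE. Qed.

Lemma sum_subg (V : nmodType) (F : gT -> V) :
  \sum_(g in K) F g = \sum_(x : aT) F (sgval x).
Proof.
rewrite (reindex (@sgval gT K)); last first.
  by exists (subg K) => x; [rewrite sgvalK|apply: subgK].
by apply: eq_bigl => x; rewrite subgP.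
Qed.

Fact zpush_sub : zmod_morphism zpush.
Proof.
move=> a b; apply/ffunP=> g; rewrite galgBE !zpushE.
by case: ifP; rewrite ?subr0 // -rmorphB [zcval (a - b)]/= galgBE.
Qed.

Fact zpush_monoid : monoid_morphism zpush.
Proof.
split=> [|a b]; apply/ffunP=> g.
  rewrite zpushE !galg1E; case: ifP => Kg; last first.
    by case: eqP Kg => // ->; rewrite group1.
  rewrite -(inj_eq (@subg_inj _ K)) subgK //=.
  by case: eqP.
rewrite zpushE [RHS]galgE.
have [Kg|nKg] := boolP (g \in K); last first.
  rewrite big1 // => h _; rewrite !zpushE; case: ifP => Kh; rewrite ?mul0r //.
  by rewrite groupMl ?groupV // (negPf nKg) mulr0.
rewrite (bigID (mem K)) /= [X in _ + X]big1 ?addr0 => [|h nKh]; last first.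
  by rewrite zpushE (negPf nKh) mul0r.
rewrite sum_subg galgE rmorph_sum; apply: eq_bigr => x _.
rewrite !zpushE subgP groupM ?groupV ?subgP // rmorphM sgvalK.
by rewrite subgM ?groupV ?subgP // subgV ?subgP // sgvalK.
Qed.

HB.instance Definition _ := GRing.isZmodMorphism.Build zK (galg R gT) zpush zpush_sub.
HB.instance Definition _ :=
  GRing.isMonoidMorphism.Build zK (galg R gT) zpush zpush_monoid.

Lemma zpush_gfix a : gfix K K (zpush a).
Proof.
split=> [g nKg|x Kx]; first by rewrite zpushE (negPf nKg).
apply/ffunP=> g; rewrite gconjE !zpushE groupJr ?groupV //.
case: ifP => // Kg; rewrite subgJ ?groupV // ; congr (_%:~R).
by apply: gconj_fixE; apply: zcenter_conj.
Qed.

Lemma sgval_class x (h : aT) : x \in K ->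
  (h \in (subg K x) ^: [set: aT]%G) = (sgval h \in x ^: K).
Proof.
move=> Kx; apply/imsetP/imsetP=> [[y _ ->]|[y Ky hE]].
  exists (sgval y); first exact: subgP.
  by rewrite !conjgE /= subgK.
exists (subg K y); first by rewrite finset.inE.
by apply: subg_inj; rewrite hE /= !conjgE /= !subgK.
Qed.

Lemma zpush_zcls m x g : x \in K -> g \in K ->
  zpush (zcls m (subg K x)) g = \sum_(h in x ^: K) (h ^+ m == g)%g%:R.
Proof.
move=> Kx Kg; rewrite zpushE Kg ffunE rmorph_sum /=.
rewrite (eq_bigl (fun h => (h \in K) && (h \in x ^: K))) => [|h]; last first.
  by rewrite andb_idl // => /imsetP[y Ky ->]; rewrite groupJ.
rewrite big_mkcondr /= sum_subg [LHS]big_mkcond; apply: eq_bigr => h _ /=.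
rewrite sgval_class //; case: ifP => // _; rewrite -(inj_eq (@subg_inj _ K)) subgK //.
by rewrite (morphX (sgval_morphism K)) ?finset.inE // rmorph_nat.
Qed.

End PushForward.

Section Kernel.
Variables (O : idomainType) (k : fieldType) (res : {rmorphism O -> k}) (p : nat).
Variables (gT : finGroupType) (K P : {group gT}) (b : galg O gT).
Hypothesis unitP : forall x, res x != 0 -> x \is a GRing.unit.
Hypotheses (chk : p \in [pchar k]) (pP : p.-group P) (sPK : P \subset K).
Hypotheses (blb : is_block K b) (brb : brauer res P b != 0).
Local Notation br := (brauer res P).
Local Notation aT := (subg_of K).
Local Notation zK := (zcenter aT).
Implicit Types (a : zK).

Let Kb : gfix K K b. Proof. by case: blb. Qed.
Let bb : b * b = b. Proof. by case: blb. Qed.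
Let bK x : x \in K -> gconj b x = b. Proof. by case: Kb => _; apply. Qed.
Local Notation B := (fun s : coset_of K => gcomp b s K).
Local Notation B1 := (gcomp b (1%g : coset_of K) K).
Local Notation J := (jacobson B1).

Let gB : grading b B (K / K)%G.
Proof. exact: gcomp_grading (fintype.subxx K) (fintype.subxx K) Kb bb bK. Qed.
Let rB : unital_subring B1 b := gr1_subring gB.
Let cB : commutative_on B1 := gr_comm gB.
Let tJ : two_sided B1 J := gr_jacobson_ideal gB.

Lemma block_comp1P x : B1 x <-> gfix K K x /\ b * x = x.
Proof.
by rewrite (gcompP Kb bb) coset_oneE.
Qed.

Let N a := b * zpush O a.

Let comm_b x : gfix K K x -> b * x = x * b.
Proof. by move=> [Kx _]; apply: (gspan_comm Kx). Qed.

Lemma block_zpush a : B1 (N a).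
Proof.
apply/block_comp1P; split; last by rewrite mulrA bb.
by apply: gfixM Kb (zpush_gfix _ _) => x y; apply: groupM.
Qed.

Lemma block_zpushM a c : N (a * c) = N a * N c.
Proof.
have ba := comm_b (zpush_gfix O a).
by rewrite /N rmorphM /= [RHS]mulrA -(mulrA b _ b) -ba (mulrA b b) bb mulrA.
Qed.

Lemma block_zpush1 : N 1 = b.
Proof. by rewrite /N rmorph1 mulr1. Qed.

Lemma block_zpushB a c : N (a - c) = N a - N c.
Proof. by rewrite /N rmorphB mulrBr. Qed.

Lemma block_gscale (c : O) x : B1 x -> B1 (gscale c x).
Proof.
move=> /block_comp1P [Kx bx]; apply/block_comp1P; split; first exact: gscale_gfix.
by rewrite gscale_mulr bx.
Qed.

Lemma block_zpush_int (r : int) : N r%:~R = gscale r%:~R b.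
Proof. by rewrite /N rmorph_int galg_intE gscale_mulr mulr1. Qed.

Let NP (a : zK) (rs : seq int) := N (\prod_(r <- rs) (a - r%:~R)).

Let comaximal x y := exists u v, [/\ B1 u, B1 v & u * x + v * y = b].

Lemma comaximalM x y z : B1 x -> B1 y -> B1 z ->
  comaximal x z -> comaximal y z -> comaximal (x * y) z.
Proof.
move=> Bx By Bz [u [v [Bu Bv ux]]] [u' [v' [Bu' Bv' uy]]].
have M := usr_mul rB; have D := usr_add rB.
exists (u * u'), (u * x * v' + v * (u' * y) + v * z * v'); split; first exact: (M).
  by apply: (D); [apply: (D)|]; repeat apply: (M).
rewrite -[RHS]bb -{1}ux -uy !mulrDl !mulrDr -!addrA; congr (_ + _).
  by rewrite !mulrA -(mulrA u x u') (cB Bx Bu') !mulrA.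
rewrite !mulrA; congr (_ + (_ + _)).
by rewrite -!mulrA; congr (v * _); rewrite (cB Bz (M _ _ Bu' By)) !mulrA.
Qed.

Lemma comaximalC x y : comaximal x y -> comaximal y x.
Proof. by move=> [u [v [Bu Bv E]]]; exists v, u; rewrite addrC. Qed.

Lemma comaximal_prod a (rs : seq int) y : B1 y ->
  (forall r, r \in rs -> comaximal (N (a - r%:~R)) y) -> comaximal (NP a rs) y.
Proof.
move=> By; elim: rs => [|r rs IH] ary.
  rewrite /NP big_nil block_zpush1; exists b, 0; split; first exact: (usr_one rB).
    exact: (usr_0 rB).
  by rewrite mul0r addr0 bb.
rewrite /NP big_cons block_zpushM; apply: comaximalM => //; try exact: block_zpush.
  by apply: ary; rewrite mem_head.
by apply: IH => s rss; apply: ary; rewrite inE rss orbT.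
Qed.

Lemma comaximal_sub a (r s : int) : res r%:~R = 0 -> res s%:~R != 0 ->
  comaximal (N (a - r%:~R)) (N (a - s%:~R)).
Proof.
move=> r0 s0; have Bb := usr_one rB; have M := usr_mul rB.
have usr : (s%:~R - r%:~R : O) \is a GRing.unit.
  by apply: unitP; rewrite rmorphB r0 subr0.
exists (gscale (s%:~R - r%:~R)^-1 b), (- gscale (s%:~R - r%:~R)^-1 b); split.
- exact: block_gscale.
- by apply: (usr_opp rB); apply: block_gscale.
rewrite mulNr -mulrBr -block_zpushB.
have -> : a - r%:~R - (a - s%:~R) = s%:~R - r%:~R by rewrite opprB addrC addrA subrK.
rewrite block_zpushB.
rewrite !block_zpush_int gscale_mull; apply/ffunP=> g.
rewrite gscaleE mulrBr galgBE !gscale_mulr !gscaleE bb -mulrBl mulrA mulVr //.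
by rewrite mul1r.
Qed.

Let Pfix x : B1 x -> fixed_by P x.
Proof. by move=> /block_comp1P [Kx _]; apply: fixed_by_gfix sPK Kx. Qed.

Let brM x y : B1 x -> B1 y -> br (x * y) = br x * br y.
Proof. by move=> Bx By; apply: (brauerM res chk pP); apply: Pfix. Qed.

Lemma brauer_gscale (c : O) x : br (gscale c x) = gscale (res c) (br x).
Proof.
apply/ffunP=> g; rewrite gscaleE !brauerE gscaleE.
by case: ifP => _; rewrite ?mulr0 ?rmorphM.
Qed.

Lemma brauer_zpush_prod a (rs : seq int) : br (N a) = 0 ->
  br (NP a rs) = gscale (\prod_(r <- rs) - res r%:~R) (br b).
Proof.
move=> a0; have bb3 : br b * br b = br b by rewrite -brM ?bb //; apply: (usr_one rB).
elim: rs => [|r rs IH].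
  rewrite /NP !big_nil block_zpush1; apply/ffunP=> g.
  by rewrite gscaleE mul1r.
rewrite /NP !big_cons block_zpushM brM; try exact: block_zpush.
rewrite -/(NP a rs) IH block_zpushB brauerB a0 sub0r block_zpush_int brauer_gscale.
rewrite mulNr gscale_mulr gscale_mull bb3; apply/ffunP=> g.
by rewrite galgNE !gscaleE !mulNr mulrA [X in - (X * _)]mulrC.
Qed.

Lemma ker_res_J x : B1 x -> (forall g, res (x g) = 0) -> J x.
Proof. exact: (ker_res_jacobson unitP (fintype.subxx K) Kb bb). Qed.

(** Split rs into the integers that vanish in k and those that do not. The two
    corresponding products f0 and f1 of factors a - r are comaximal, because the
    differences of the integers involved are units of O, and f0 f1 = 0; this
    decomposes b into two orthogonal idempotents. Since b is primitive, b f0 = 0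
    or b f1 = 0. In the second case, applying Br_P would give a unit multiple of
    Br_P(b), so b f0 = 0, and modulo the maximal ideal of O the element b f0 is a
    power of b a. *)
Lemma rational_ker_jacobson a (rs : seq int) :
  \prod_(r <- rs) (a - r%:~R) = 0 -> br (N a) = 0 -> J (N a).
Proof.
move=> ars a0; have Bb := usr_one rB; have M := usr_mul rB.
pose rs0 := [seq r <- rs | res (r%:~R) == 0].
pose rs1 := [seq r <- rs | res (r%:~R) != 0].
have B0 : B1 (NP a rs0) by apply: block_zpush.
have B1' : B1 (NP a rs1) by apply: block_zpush.
have y01 : NP a rs0 * NP a rs1 = 0.
  rewrite /NP -block_zpushM -big_cat /= (perm_big rs) /=.
    by rewrite ars /N rmorph0 mulr0.
  exact/permPl/perm_filterC.
have [u [v [Bu Bv uv]]] : comaximal (NP a rs0) (NP a rs1).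
  apply: comaximal_prod => // r; rewrite mem_filter => /andP[/eqP r0 _].
  apply: comaximalC; apply: comaximal_prod; first exact: block_zpush.
  move=> s; rewrite mem_filter => /andP[s0 _]; apply: comaximalC.
  exact: comaximal_sub.
have Ky x : B1 x -> gfix K K x by move=> /block_comp1P[].
set al := u * NP a rs0 in uv; set ga := v * NP a rs1 in uv.
have Bal : B1 al by apply: M.
have Bga : B1 ga by apply: M.
have alga : al * ga = 0.
  rewrite /al /ga (cB Bv B1') -mulrA (mulrA (NP a rs0)) y01 mul0r.
  by rewrite mulr0.
have idal : al * al = al.
  by rewrite -[RHS](usr_mulr1 rB Bal) -uv mulrDr alga addr0.
have idga : ga * ga = ga.
  by rewrite -[RHS](usr_mul1 rB Bga) -uv mulrDl alga add0r.
have [_ _ _ prim] := blb.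
have [al0|ga0] := prim al ga (Ky _ Bal) (Ky _ Bga) idal idga alga (esym uv).
  have N0 : NP a rs0 = 0.
    rewrite -[LHS](usr_mulr1 rB B0) -uv al0 add0r mulrA (cB B0 Bv) -mulrA y01.
    by rewrite mulr0.
  have Bn := block_zpush a; have JN (r : int) : res r%:~R = 0 -> J (gscale r%:~R b).
    move=> r0; apply: ker_res_J; first exact: block_gscale.
    by move=> g; rewrite gscaleE rmorphM r0 mul0r.
  have BX n : B1 (b * N a ^+ n).
    elim: n => [|n IHn]; first by rewrite mulr1.
    by rewrite exprSr mulrA; apply: (M).
  have Jd : forall rs', {subset rs' <= rs0} ->
      J (b * N a ^+ size rs' - NP a rs').
    elim=> [|r rs' IH] sub; first by rewrite /NP big_nil block_zpush1 mulr1 subrr; apply: (ts_0 tJ).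
    have r0 : res r%:~R = 0.
      by have := sub r (mem_head _ _); rewrite mem_filter => /andP[/eqP].
    have IH' := IH (fun s ss => sub s (mem_behead (s := r :: rs') ss)).
    have BNP : B1 (NP a rs') by apply: block_zpush.
    have -> : b * N a ^+ size (r :: rs') - NP a (r :: rs') =
       N a * (b * N a ^+ size rs' - NP a rs') + gscale r%:~R b * NP a rs'.
      rewrite /NP big_cons block_zpushM block_zpushB block_zpush_int mulrBr mulrBl.
      rewrite opprB addrA addrAC; congr (_ - _ + _).
      by rewrite /= exprS (mulrA b (N a)) (mulrA (N a) b) (usr_mulr1 rB Bn) (usr_mul1 rB Bn).
    apply: (ts_add tJ); first exact: (ts_left tJ).
    by apply: (ts_right tJ) => //; apply: JN.
  have := Jd rs0 (fun _ => id); rewrite N0 subr0.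
  case: (size rs0) => [|n].
    rewrite mulr1 => Jb; rewrite -(usr_mulr1 rB Bn); exact: (ts_left tJ).
  have -> : b * N a ^+ n.+1 = N a ^+ n.+1 by rewrite exprS mulrA (usr_mul1 rB Bn).
  exact: jacobson_root rB cB Bn.
exfalso; case/eqP: brb.
have z0 : NP a rs1 = 0.
  rewrite -[LHS](usr_mulr1 rB B1') -uv ga0 addr0 /al mulrA (cB B1' Bu) -mulrA.
  by rewrite (cB B1' B0) y01 mulr0.
have := brauer_zpush_prod rs1 a0; rewrite z0 brauer0 => /ffunP E.
apply/ffunP=> g; have := E g; rewrite galg0E gscaleE => /esym/eqP.
rewrite mulf_eq0 => /orP[|/eqP //]; rewrite prodf_seq_eq0 => /hasP[r].
by rewrite mem_filter /= oppr_eq0 => /andP[/negPf ->].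
Qed.

(** ** Class sums *)

Lemma brauer_zpush_mul a c : br (N c) = 0 -> br (N (a * c)) = 0.
Proof.
by move=> c0; rewrite block_zpushM brM ?c0 ?mulr0 //; apply: block_zpush.
Qed.

(** For m prime to |K| an element of K is a power of its m-th power, so the m-th
    powers of a class that avoids C(P) avoid C(P). *)
Lemma brauer_zcls m x : x \in K -> coprime #|K| m ->
  (forall h, h \in x ^: K -> h \notin 'C(P)) ->
  br (N (zcls m (subg K x))) = 0.
Proof.
move=> Kx com nC; rewrite (brauerM res chk pP); last 2 first.
- by apply: Pfix; apply: (usr_one rB).
- by apply: fixed_by_gfix sPK (zpush_gfix _ _).
suff -> : br (zpush O (zcls m (subg K x))) = 0 by rewrite mulr0.
apply/ffunP=> g; rewrite brauerE galg0E; case: ifP => // Cg.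
have [Kg|nKg] := boolP (g \in K); last by rewrite zpushE (negPf nKg) rmorph0.
rewrite zpush_zcls // big1 ?rmorph0 // => h xh; case: eqP => // hg.
have Kh : h \in K by have /imsetP[y Ky ->] := xh; rewrite groupJ.
by case/negP: (nC h xh); rewrite -(expgK com Kh) /= hg groupX.
Qed.

(** The class sum c is a root of zclass_poly, which is congruent to a power of
    the indeterminate modulo the kernel of Br_P; by rational_ker_jacobson, a power
    of b c is in J. *)
Lemma class_sum_jacobson x : x \in K ->
  (forall h, h \in x ^: K -> h \notin 'C(P)) -> J (N (zcls 1 (subg K x))).
Proof.
move=> Kx nC; pose Q := zclass_poly (subg K x); set c := zcls 1 _.
have cardK : #|[set: aT]%G| = #|K| := esym (card_isog (isog_subg K)).
have [d Qd] : exists d, forall j, br (N (Q - 'X^d)`_j) = 0.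
  rewrite /Q /zclass_poly; elim/big_rec: _ => [|m q com [d pd]].
    by exists 0%N => j; rewrite expr0 subrr coef0 /N rmorph0 mulr0 brauer0.
  exists d.+1 => j; have c0 : br (N (zcls m (subg K x))) = 0.
    by apply: brauer_zcls; rewrite -?cardK.
  have -> : ('X - (zcls m (subg K x))%:P) * q - 'X^(d.+1)
      = 'X * (q - 'X^d) - (zcls m (subg K x))%:P * q.
    by rewrite mulrBl mulrBr exprS addrAC.
  rewrite coefB block_zpushB brauerB coefXM coefCM mulrC brauer_zpush_mul // subr0.
  by case: ifP => _ //; rewrite /N rmorph0 mulr0 brauer0.
have Jq j : J (N (Q - 'X^d)`_j).
  have [rs Qrs] := zclass_poly_coef_root (subg K x) j.
  apply: (@rational_ker_jacobson _ [seq r - (j == d)%:R | r <- rs]) => //.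
  rewrite big_map -[RHS]Qrs; apply: eq_bigr => r _.
  by rewrite coefB coefXn rmorphB rmorph_nat opprB addrA subrK.
have JQc : J (N (Q - 'X^d).[c]).
  rewrite horner_coef /N rmorph_sum mulr_sumr.
  apply: (closed_sum _ (ts_0 tJ) (ts_sub tJ)) => j _.
  rewrite -/(N _) block_zpushM; apply: (ts_right tJ) => //; exact: block_zpush.
have Bc := block_zpush c; have Bb := usr_one rB.
have Ncd : J (N (c ^+ d)).
  have /rootP Qc := zclass_poly_root (subg K x).
  have : J (- N (Q - 'X^d).[c]) by apply: (ts_opp tJ).
  by rewrite hornerD hornerN hornerXn Qc sub0r /N rmorphN mulrN opprK.
case: d Ncd {Qd Jq JQc} => [|d].
  rewrite expr0 block_zpush1 => Jb.
  by rewrite -(usr_mulr1 rB Bc); apply: (ts_left tJ).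
have -> : N (c ^+ d.+1) = N c ^+ d.+1.
  by elim: d => [|d IHd]; rewrite ?expr1 // exprS block_zpushM IHd -exprS.
exact: jacobson_root rB cB Bc.
Qed.

Lemma block_mem_gscale (c : O) x : J x -> J (gscale c x).
Proof.
move=> Jx; have Bx := ts_incl tJ Jx.
rewrite -[x](usr_mul1 rB Bx) -gscale_mull; apply: (ts_left tJ) => //.
by apply: block_gscale; apply: (usr_one rB).
Qed.

(** The coefficients of x on the classes that meet C(P) vanish in k, and the other
    classes are treated by class_sum_jacobson. *)
Theorem brauer_ker_jacobson x : B1 x -> br x = 0 -> J x.
Proof.
move=> Bx brx; have [[Kx xK] bx] := (block_comp1P x).1 Bx.
pose D := [set C in classes K | [disjoint C & 'C(P)]]%SET.
pose x0 := \sum_(C in D) gscale (x (repr C)) (zpush O (zcls 1 (subg K (repr C)))).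
have DP C : C \in D -> [/\ C \in classes K, repr C \in K, C = repr C ^: K &
    forall h, h \in repr C ^: K -> h \notin 'C(P)].
  rewrite finset.inE => /andP[KC dC]; have /imsetP[y Ky yC] := KC.
  have [u Ku uC] := repr_class K y; rewrite -yC in uC.
  have CE : C = repr C ^: K by rewrite uC classGidl.
  split=> //; first by rewrite uC groupJ.
  by move=> h; rewrite -CE => Ch; rewrite (disjointFr dC Ch).
have zE C g : C \in D -> g \in K ->
    zpush O (zcls 1 (subg K (repr C))) g = (g \in C)%:R.
  move=> DC Kg; have [_ Kr CE _] := DP C DC; rewrite zpush_zcls // {2}CE.
  have [gC|gC] := boolP (g \in _); last first.
    by rewrite big1 // => h hC; case: eqP => // hg; rewrite -hg expg1 hC in gC.
  rewrite (bigD1 g) //= expg1 eqxx big1 ?addr0 // => h /andP[_ /negPf hg].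
  by rewrite expg1 hg.
have Kx0 : gfix K K x0.
  have F0 := gfix0 O K K; have FB y z := @gfixB O gT K K y z.
  apply: (closed_sum _ F0 FB) => C DC; apply: gscale_gfix; exact: zpush_gfix.
have x0E g : g \in K -> x0 g = if g ^: K \in D then x g else 0.
  move=> Kg; rewrite /x0 galg_sumE.
  have term C : C \in D -> gscale (x (repr C)) (zpush O (zcls 1 (subg K (repr C)))) g
      = if C == g ^: K then x g else 0.
    move=> DC; rewrite gscaleE zE //; have [_ Kr CE _] := DP C DC.
    have [->|ne] := eqVneq C (g ^: K).
      rewrite class_refl mulr1; have [u Ku ->] := repr_class K g.
      exact: gconj_fixE (xK u Ku).
    rewrite [g \in C](negbTE _) ?mulr0 //; apply: contra ne.
    by rewrite CE => /class_eqP ->.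
  rewrite (eq_bigr _ term) -big_mkcondr /=; case: ifP => Dg.
    rewrite (big_pred1 (g ^: K)) // => C; rewrite /= andb_idl // => /eqP ->.
    exact: Dg.
  rewrite big1 // => C /andP[DC /eqP CE]; move: DC; rewrite CE => DC.
  by move: Dg; rewrite DC.
have res0 g : res ((x - x0) g) = 0.
  rewrite galgBE; have [Kg|nKg] := boolP (g \in K); last first.
    by rewrite Kx // (proj1 Kx0) // subrr rmorph0.
  rewrite x0E //; case: ifP => Dg; first by rewrite subrr rmorph0.
  move: Dg; rewrite finset.inE mem_classes //= => /negbT /pred0Pn [h /= /andP[gh Ch]].
  have [y Ky hE] := imsetP gh; rewrite subr0 -(gconj_fixE g (xK y Ky)) -hE.
  by have := congr1 (fun z : galg k gT => z h) brx; rewrite brauerE Ch galg0E.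
have Bd : B1 (b * (x - x0)) by exists (x - x0); rewrite ?coset_oneE //; apply: gfixB.
rewrite -bx -[x](subrK x0) mulrDr; apply: (ts_add tJ).
  apply: ker_res_J => // g; rewrite galgE rmorph_sum big1 // => h _.
  by rewrite rmorphM res0 mulr0.
rewrite /x0 mulr_sumr; apply: (closed_sum _ (ts_0 tJ) (ts_sub tJ)) => C DC.
have [_ Kr _ nC] := DP C DC; rewrite gscale_mulr; apply: block_mem_gscale.
exact: class_sum_jacobson.
Qed.

End Kernel.

(** * Homogeneous units over the residue field *)

Lemma graded_crossed (A : nzRingType) (k : fieldType) (gT hT : finGroupType)
    (e : A) (B : gT -> set A) (St : {group gT}) (phi : A -> galg k hT) :
  grading e B St -> graded_reduction B St phi ->
  (forall c x, (phi @` B 1%g) x -> (phi @` B 1%g) (gscale c x)) ->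
  forall s, s \in gr_supp B St ->
  exists u v, [/\ B s u, B s^-1%g v & u * v = e].
Proof.
move=> gB rd kB s ss; have Ss := supp_sub ss.
have SV : s^-1%g \in St by rewrite groupV.
apply: (lift_crossed gB rd Ss).
have M := grd_mul rd; have S1 := group1 St.
apply: (crossed_pair (image_subring gB rd) (image_comm gB rd) kB).
- by exists 0; [apply: (gr_0 gB)|apply: (grd_0 rd)].
- by exists 0; [apply: (gr_0 gB)|apply: (grd_0 rd)].
- move=> _ _ [x Bx <-] [y By <-]; exists (x + y); last exact: (grd_add rd).
  exact: (gr_add gB).
- move=> _ _ [x Bx <-] [y By <-]; exists (x + y); last exact: (grd_add rd).
  exact: (gr_add gB).
- move=> _ _ [a Ba <-] [x Bx <-]; exists (a * x); last exact: (M 1%g s).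
  exact: (gr_act gB).
- move=> _ _ [a Ba <-] [x Bx <-]; exists (x * a); last exact: (M s^-1%g 1%g).
  exact: (gr_ract gB).
- move=> _ _ [x Bx <-] [y By <-]; exists (x * y); last exact: (M s s^-1%g).
  exact: (gr_mulV gB Ss).
- by apply/(mem_supp_image gB rd Ss).
Qed.

(** * Blocks with a given image under the Brauer homomorphism *)

Lemma gfix_conj (R : comNzRingType) (gT : finGroupType) (K : {group gT})
    (a : galg R gT) x : x \in 'N(K) -> gfix K K a -> gfix K K (gconj a x).
Proof.
move=> Nx [Ka aK]; split=> [g nKg|y Ky].
  by rewrite gconjE Ka // memJ_norm ?groupV.
rewrite gconj_comp; have -> : (x * y = y ^ x^-1 * x)%g.
  by rewrite conjgE invgK !mulgA mulgKV.
by rewrite -gconj_comp aK // memJ_norm ?groupV.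
Qed.

Lemma block_conj (R : comNzRingType) (gT : finGroupType) (K : {group gT})
    (b : galg R gT) x : x \in 'N(K) -> is_block K b -> is_block K (gconj b x).
Proof.
move=> Nx [Kb bb b0 prim]; split.
- exact: gfix_conj.
- by rewrite -gconjM bb.
- by apply: contraNneq b0 => bx; rewrite -[b](gconjK _ x) bx gconj0.
have NV : x^-1%g \in 'N(K) by rewrite groupV.
have cV0 (a : galg R gT) : gconj a x^-1%g = 0 -> a = 0.
  by move=> a0; rewrite -[a](gconjK _ x^-1%g) a0 gconj0.
move=> e f Ke Kf ee ff ef bE.
have [||||||/cV0|/cV0] := prim (gconj e x^-1%g) (gconj f x^-1%g); [..|by left|by right].
- exact: gfix_conj.
- exact: gfix_conj.
- by rewrite -gconjM ee.
- by rewrite -gconjM ff.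
- by rewrite -gconjM ef gconj0.
- by rewrite -gconjD -bE gconjK.
Qed.

(** If b c is not zero then b = b c, since b is the sum of the orthogonal
    idempotents b c and b - b c; likewise c = c b. *)
Lemma block_eq (R : comNzRingType) (gT : finGroupType) (K : {group gT})
    (b c : galg R gT) : is_block K b -> is_block K c -> b * c != 0 -> b = c.
Proof.
have half (b' c' : galg R gT) : is_block K b' -> is_block K c' -> b' * c' != 0 -> b' = b' * c'.
  move=> [Kb bb _ prim] [Kc cc _ _] bc0.
  have bc : b' * c' = c' * b'.
    have [[Kc' _] [_ bK]] := (Kc, Kb).
    exact: (gspan_comm Kc' bK).
  have Kbc : gfix K K (b' * c') by apply: gfixM Kb Kc => x y; apply: groupM.
  have bbc : b' * (b' * c') = b' * c' by rewrite mulrA bb.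
  have idbc : b' * c' * (b' * c') = b' * c'.
    by rewrite {1}bc -mulrA bbc bc mulrA cc.
  have bcb : b' * c' * b' = b' * c' by rewrite {1}bc -mulrA bb.
  have Kd : gfix K K (b' - b' * c') by apply: gfixB.
  have [|||/eqP|/eqP] := prim (b' * c') (b' - b' * c') Kbc Kd idbc.
  - by rewrite mulrBl !mulrBr bb bbc bcb idbc subrr subr0.
  - by rewrite mulrBr bcb idbc subrr.
  - by rewrite addrC subrK.
  - by rewrite (negPf bc0).
  - by rewrite subr_eq0 => /eqP.
move=> bl cl bc0; have comm : b * c = c * b.
  have [[Kb _ _ _] [[Kc' _] _ _ _]] := (bl, cl); have [_ bK] := Kb.
  exact: (gspan_comm Kc' bK).
by rewrite (half b c bl cl bc0) {1}comm -(half c b cl bl) // -comm.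
Qed.

(** * The extensions attached to a block *)

Section BlockSetup.
Variables (O : idomainType) (k : fieldType) (res : {rmorphism O -> k}) (p : nat).
Variables (gT : finGroupType) (H K P : {group gT}) (b : galg O gT).
Hypothesis unitP : forall x, res x != 0 -> x \is a GRing.unit.
Hypothesis res_onto : forall y : k, exists x : O, res x = y.
Hypotheses (chk : p \in [pchar k]) (nKH : K <| H).
Hypotheses (blb : is_block K b) (dP : is_defect_group res p K P b).
Local Notation br := (brauer res P).
Let bbar := br b.

Let Kb : gfix K K b. Proof. by case: blb. Qed.
Let bb : b * b = b. Proof. by case: blb. Qed.
Let b0 : b != 0. Proof. by case: blb. Qed.
Let sPK : P \subset K. Proof. by case: dP. Qed.
Let pP : p.-group P. Proof. by case: dP. Qed.
Let sKH : K \subset H. Proof. exact: normal_sub. Qed.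

Lemma stab_sub : K \subset gstab H b.
Proof.
apply/fintype.subsetP=> x Kx; apply/gstabP; split; first exact: (fintype.subsetP sKH).
by have [_ bK] := Kb; apply: bK.
Qed.

Lemma stab_quotient_sub s : s \in (gstab H b / K)%g -> s \in (H / K)%g.
Proof.
have sub : gstab H b \subset H by apply/fintype.subsetP=> x /gstabP[].
exact: (fintype.subsetP (quotientS K sub)).
Qed.

Lemma block_grading : grading b (@Ccomp O gT K b) (gstab_group H b / K)%G.
Proof.
apply: (gcomp_grading (fintype.subxx K) stab_sub Kb bb) => x.
by case/gstabP.
Qed.

Lemma block_image s : s \in (gstab H b / K)%g ->
  br @` (@Ccomp O gT K b s) = Fcomp H P bbar s.
Proof. by move/stab_quotient_sub; exact: (brauer_gcomp res_onto chk nKH Kb bb dP). Qed.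

Lemma block_fixed (s : coset_of K) x : Ccomp b s x -> fixed_by P x.
Proof. by move=> /(gcomp_fix Kb); exact: fixed_by_gfix sPK. Qed.

Lemma block_reduction :
  graded_reduction (@Ccomp O gT K b) (gstab_group H b / K)%G br.
Proof.
split.
- exact: brauerB.
- move=> s t x y _ _ Bx By.
  by apply: (brauerM res chk pP); [apply: block_fixed Bx|apply: block_fixed By].
- move=> x; apply: (brauer_ker_jacobson unitP chk pP sPK blb).
  by case: dP.
- move=> c Bc; apply: (gspan_direct (S := fun s : coset_of K => s)) => [s t x|s Ms].
    exact: coset_disjoint.
  have [sc _] := gcomp_fix Kb (Bc s Ms).
  by apply: gspanW (brauer_span res sc); apply: finset.subsetIl.
Qed.

Lemma block_crossed s : s \in gr_supp (@Ccomp O gT K b) (gstab_group H b / K)%G ->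
  exists u v, [/\ Ccomp b s u, Ccomp b s^-1%g v & u * v = b].
Proof.
apply: (graded_crossed block_grading block_reduction) => c x.
rewrite block_image ?group1 // => -[y Fy <-].
by exists (gscale c y); [apply: gscale_gfix|rewrite gscale_mulr].
Qed.

Lemma block_extension : is_extension (ext1 H K b).
Proof.
exact: (gr_is_extension block_grading (elimN eqP b0) block_crossed).
Qed.

(** If x fixes bbar, then b times its conjugate by x has image bbar bbar = bbar,
    so the two blocks are not orthogonal. *)
Lemma brauer_stab x : x \in 'N(K) -> x \in 'N(P) ->
  gconj bbar x = bbar <-> gconj b x = b.
Proof.
move=> NK NP; split=> [bx|bx]; last by rewrite /bbar -brauer_conj // bx.
apply/esym/(block_eq blb (block_conj NK blb)).
have [_ _ _ br0] := dP; apply: contraNneq br0 => bbx.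
have Pb := fixed_by_gfix sPK Kb.
have Pbx : fixed_by P (gconj b x).
  by apply: fixed_by_gfix sPK (gfix_conj NK Kb).
have := brauerM res chk pP Pb Pbx; rewrite bbx brauer0 brauer_conj // -/bbar bx.
by rewrite (brauer_idem chk Kb bb dP) /bbar => E0; rewrite -E0 ?eqxx.
Qed.

End BlockSetup.

(** * Cosets of a subgroup containing the centralizer *)

Section NatCoset.
Variables (gT : finGroupType) (H K A L : {group gT}).
Hypotheses (nKH : K <| H) (sAH : A \subset H) (LE : L :=: K :&: A).

Lemma nat_coset_norm : L <| A.
Proof.
rewrite LE; apply/andP; split; first exact: finset.subsetIr.
by rewrite normsI ?normG // (fintype.subset_trans sAH) ?normal_norm.
Qed.

Lemma nat_cosetE x : x \in A -> nat_coset K (coset L x) = coset K x.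
Proof.
move=> Ax; rewrite /nat_coset.
have NL := fintype.subsetP (normal_norm nat_coset_norm) x Ax.
have := mem_repr_coset (coset L x); rewrite val_coset // => /rcosetP[l Ll ->].
by apply: coset_kerl; move: Ll; rewrite LE finset.inE => /andP[].
Qed.

Lemma nat_cosetP s : s \in (A / L)%g -> exists x, [/\ x \in A, x \in 'N(L),
  x \in 'N(K), s = coset L x & nat_coset K s = coset K x].
Proof.
move=> /morphimP[x NL Ax ->]; exists x; split=> //; last exact: nat_cosetE.
by apply: (fintype.subsetP (normal_norm nKH)); apply: (fintype.subsetP sAH).
Qed.

Lemma nat_cosetM : {in (A / L)%g &, {morph @nat_coset gT L K : s t / (s * t)%g}}.
Proof.
move=> _ _ /nat_cosetP[x [Ax NLx NKx -> ->]] /nat_cosetP[y [Ay NLy NKy -> ->]].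
by rewrite -coset_morphM // nat_cosetE ?groupM // coset_morphM.
Qed.

Lemma nat_coset_inj : {in (A / L)%g &, injective (@nat_coset gT L K)}.
Proof.
move=> _ _ /nat_cosetP[x [Ax NLx NKx -> ->]] /nat_cosetP[y [Ay NLy NKy -> ->]].
move=> /(rcoset_kercosetP NKx NKy) xy; apply/(rcoset_kercosetP NLx NLy).
move: xy; rewrite !mem_rcoset => Kxy.
by rewrite LE finset.inE Kxy groupM ?groupV.
Qed.

Lemma nat_coset_setI s (C : {set gT}) : C \subset A -> s \in (A / L)%g ->
  (s : {set gT}) :&: C = (nat_coset K s : {set gT}) :&: C.
Proof.
move=> /fintype.subsetP CA /nat_cosetP[x [Ax NLx NKx -> ->]].
rewrite !val_coset //; apply/setP=> y; rewrite !finset.inE.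
have [Cy|] := boolP (y \in C); rewrite ?andbF // !andbT !mem_rcoset.
rewrite LE finset.inE andb_idr // => _.
by apply: groupM; [apply: CA|rewrite groupV].
Qed.

End NatCoset.

(** * Comparison with the extension of a block *)

(** If s does not meet C_H(P), its component is zero. *)
Lemma Fcomp_meets (k : fieldType) (gT : finGroupType) (H K P : {group gT})
    (e : galg k gT) (s : coset_of K) (Y : set (galg k gT)) :
  e != 0 -> setprod (Fcomp H P e s) Y e ->
  exists2 y, y \in (s : {set gT}) & y \in 'C_H(P)%g.
Proof.
move=> e0 FYe; have [|[y /finset.setIP[sy Cy]]] := set_0Vmem ((s : {set gT}) :&: 'C_H(P)%g)%SET.
  move=> S0; case/eqP: e0; move: FYe.
  apply: (setprod_ind (V := [set z | z = 0])) => //= [x y -> ->|x y [z [Sz _] <-] _].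
    by rewrite addr0.
  have -> : z = 0.
    by apply/ffunP=> g; rewrite galg0E Sz // S0 finset.inE.
  by rewrite mulr0 mul0r.
by exists y.
Qed.

Section BlockCompare.
Variables (O : idomainType) (k : fieldType) (res : {rmorphism O -> k}) (p : nat).
Variables (gT : finGroupType) (H K P : {group gT}) (b : galg O gT).
Hypothesis unitP : forall x, res x != 0 -> x \is a GRing.unit.
Hypothesis res_onto : forall y : k, exists x : O, res x = y.
Hypotheses (chk : p \in [pchar k]) (nKH : K <| H).
Hypotheses (blb : is_block K b) (dP : is_defect_group res p K P b).
Local Notation br := (brauer res P).
Let bbar := br b.

Let gC := block_grading nKH blb.
Let rC := block_reduction H unitP chk blb dP.
Let b0 : b <> 0. Proof. by apply/eqP; case: blb. Qed.
Let bbar0 : bbar != 0. Proof. by case: dP. Qed.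

Lemma supp_meets t : t \in gr_supp (@Ccomp O gT K b) (G_b H K b) ->
  exists y, [/\ y \in (t : {set gT}), y \in 'C_H(P)%g & y \in gstab H b].
Proof.
move=> st; have St := supp_sub st.
have := (mem_supp_image gC rC St).1 st.
rewrite (block_image res_onto chk nKH blb dP) // => /(Fcomp_meets bbar0)[y ty Cy].
exists y; split=> //.
exact: (fintype.subsetP (coset_subset (stab_sub nKH blb) St)).
Qed.

Variables (A L : {group gT}) (R : comNzRingType) (e1 : galg R gT).
Variables (B1 : coset_of L -> set (galg R gT)) (phi1 : galg R gT -> galg k gT).
Hypotheses (LE : L :=: (K :&: A)%SET) (CA : 'C_H(P)%g \subset A) (AN : A \subset 'N_H(P)%g).
Let St1 := (gstab_group A e1 / L)%G.
Hypotheses (gB1 : grading e1 B1 St1) (rd1 : graded_reduction B1 St1 phi1).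
Hypotheses (n1 : e1 <> 0) (eqe : phi1 e1 = bbar).
Hypothesis stab1 : forall x, x \in A -> gconj e1 x = e1 <-> gconj b x = b.
Hypothesis im1 : forall s, s \in St1 ->
  phi1 @` B1 s = gcomp bbar ((s : {set gT}) :&: 'C_H(P)%g)%SET 'N_K(P)%g.

Let sAH : A \subset H.
Proof. exact: fintype.subset_trans AN (finset.subsetIl _ _). Qed.

Let St1A s : s \in St1 -> s \in (A / L)%g.
Proof.
have sub : gstab A e1 \subset A by apply/fintype.subsetP=> x /gstabP[].
exact: (fintype.subsetP (quotientS L sub)).
Qed.

Let qSt s : s \in St1 -> nat_coset K s \in (gstab_group H b / K)%G.
Proof.
move=> /morphimP[x NL /gstabP[Ax ex] ->]; rewrite (nat_cosetE nKH sAH LE) //.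
apply: mem_quotient; apply/gstabP; split; first exact: (fintype.subsetP sAH).
exact/stab1.
Qed.

Let qB s : s \in St1 -> phi1 @` B1 s = br @` (@Ccomp O gT K b (nat_coset K s)).
Proof.
move=> Ss; rewrite im1 // (block_image res_onto chk nKH blb dP); last exact: qSt.
by rewrite /Fcomp (nat_coset_setI nKH sAH LE CA) //; apply: St1A.
Qed.

Let q_onto t : t \in gr_supp (@Ccomp O gT K b) (gstab_group H b / K)%G ->
  exists2 s, s \in St1 & t = nat_coset K s.
Proof.
move=> /supp_meets[y [ty Cy /gstabP[Hy yb]]]; have Ay := fintype.subsetP CA y Cy.
exists (coset L y); last by rewrite (nat_cosetE nKH sAH LE) // (coset_mem ty).
by apply: mem_quotient; apply/gstabP; split=> //; apply/stab1.
Qed.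

(** Used for A = N_H(P) and for A = C_H(P), where L is the intersection of K
    with A. *)
Theorem block_compare :
  ext_iso (gr_ext e1 B1 St1) (ext1 H K b) (@nat_coset gT L K) /\
  gr_supp (@Ccomp O gT K b) (G_b H K b)
    = [set nat_coset K s | s in gr_supp B1 St1]%SET.
Proof.
have qM : {in St1 &, {morph @nat_coset gT L K : s t / (s * t)%g}}.
  by move=> s t /St1A As /St1A At; apply: (nat_cosetM nKH sAH LE).
have qI : {in St1 &, injective (@nat_coset gT L K)}.
  by move=> s t /St1A As /St1A At; apply: (nat_coset_inj nKH sAH LE).
split; first exact: (gr_ext_iso gB1 gC rd1 rC n1 b0 eqe qSt qM qI qB q_onto).
exact: (compare_supp_imset gB1 gC rd1 rC eqe qSt qM qB q_onto).
Qed.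

End BlockCompare.

(** * The three extensions of a block *)

Local Close Scope classical_set_scope.

Theorem mainTheorem2 (p : nat) (O : idomainType) (k : fieldType)
    (res : {rmorphism O -> k}) (gT : finGroupType) (H K P : {group gT})
    (b b1 : galg O gT) :
  (is_dvr O \/ GRing.field_axiom O) ->
  (forall y : k, exists x : O, res x = y) ->
  p \in [pchar k] ->
  K <| H ->
  is_block K b ->
  is_defect_group res p K P b ->
  is_block 'N_K(P) b1 ->
  is_defect_group res p 'N_K(P) P b1 ->
  brauer res P b1 = brauer res P b ->
  let bbar := brauer res P b in
  let Gb := gr_supp (Ccomp b) (G_b H K b) in
  let Gb1 := gr_supp (Ecomp b1) (NH_b H K P b1) in
  let CHbbar := gr_supp (Dcomp bbar) (CH_b H K P bbar) in
  let Gbbar := gr_supp (Fcomp H P bbar) (G_b H K b) in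
  let NHbbar := gr_supp (Fcomp H P bbar) ((gstab 'N_H(P) b * K) / K)%g in
  [/\ is_extension (ext1 H K b),
      is_extension (ext2 H K P b1)
    & is_extension (ext3 H K P bbar)] /\
  [/\ ext_iso (ext2 H K P b1) (ext1 H K b) (@nat_coset gT 'N_K(P) K),
      ext_iso (ext3 H K P bbar) (ext1 H K b) (@nat_coset gT 'C_K(P) K)
    & [/\ Gb = Gbbar,
          Gb = [set nat_coset K s | s in Gb1],
          Gb = NHbbar
        & Gb = [set nat_coset K t | t in CHbbar]]].
Proof.
move=> dvrO res_onto chk nKH blb dP blb1 dP1 brb bbar Gb Gb1 CHbbar Gbbar NHbbar.
have unitP := res_unit dvrO res_onto.
have sKH := normal_sub nKH.
have [pP sPK _ bbar0] := dP; have [Kb bb b0 _] := blb.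
have PN : P \subset 'N(P) := normG P.
(* The second extension is the first one for N_K(P) <| N_H(P) and b1. *)
have nNN : 'N_K(P)%G <| 'N_H(P)%G.
  apply/andP; split; first exact: finset.setSI.
  apply: normsI; last exact: normsG (finset.subsetIr _ _).
  exact: fintype.subset_trans (finset.subsetIl _ _) (normal_norm nKH).
have HN x : x \in 'N_H(P) -> x \in 'N(K) /\ x \in 'N(P).
  by case/finset.setIP=> Hx Nx; rewrite Nx (fintype.subsetP (normal_norm nKH)).
have gC := block_grading nKH blb.
have rC := block_reduction H unitP chk blb dP.
have gE := block_grading nNN blb1.
have rE := block_reduction 'N_H(P)%G unitP chk blb1 dP1.
have stabb x : x \in 'N_H(P) -> gconj bbar x = bbar <-> gconj b x = b.
  by move=> /HN[NK NP]; apply: (brauer_stab chk blb dP).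
have stabb1 x : x \in 'N_H(P) -> gconj b1 x = b1 <-> gconj b x = b.
  move=> Nx; rewrite -stabb // /bbar -brb; apply: iff_sym.
  apply: (brauer_stab chk blb1 dP1); last by case: (HN x Nx).
  exact: (fintype.subsetP (normal_norm nNN)).
have CN : 'C_H(P) \subset 'N_H(P) by apply: finset.setIS; apply: cent_sub.
have setN : 'N_K(P) = (K :&: 'N_H(P))%SET.
  by rewrite finset.setIA (finset.setIidPl sKH).
have setC : 'C_K(P) = (K :&: 'C_H(P))%SET.
  by rewrite finset.setIA (finset.setIidPl sKH).
have imE s : s \in (gstab 'N_H(P) b1 / 'N_K(P))%g ->
    (brauer res P @` (@Ccomp O gT 'N_K(P)%G b1 s))%classic
    = gcomp bbar ((s : {set gT}) :&: 'C_H(P))%SET 'N_K(P).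
  move=> Ss; rewrite (block_image res_onto chk nNN blb1 dP1) // /Fcomp brb.
  congr (gcomp _ (_ :&: _)%SET _); rewrite /=.
    by rewrite -finset.setIA (finset.setIidPr (cent_sub P)).
  by rewrite -finset.setIA finset.setIid.
have n1 : b1 <> 0 by apply/eqP; case: blb1.
have [isoE suppE] := block_compare unitP res_onto chk nKH blb dP setN CN
  (fintype.subxx _) gE rE n1 brb stabb1 imE.
(* The third extension is compared with the first one through the identity. *)
have Nbbar : gfix 'C_K(P) 'N_K(P) bbar.
  have := brauer_fix res P sKH Kb; rewrite finset.setIA (finset.setIidPl sKH).
  exact.
have bbK : bbar * bbar = bbar := brauer_idem chk Kb bb dP.
have sCN : 'C_K(P) \subset 'N_K(P) by apply: finset.setIS; apply: cent_sub.
have CbE x : x \in gstab 'C_H(P) bbar -> gconj bbar x = bbar by case/gstabP.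
have sCM : 'C_K(P) \subset gstab 'C_H(P) bbar.
  apply/fintype.subsetP=> x Cx; apply/gstabP; split.
    exact: (fintype.subsetP (finset.setSI _ sKH)).
  by have [_ Nb] := Nbbar; apply: Nb; apply: (fintype.subsetP sCN).
have gD : grading bbar (@Dcomp k gT K P bbar) (gstab_group 'C_H(P)%G bbar / 'C_K(P))%G.
  exact: (gcomp_grading sCN sCM Nbbar bbK CbE).
have rD : graded_reduction (@Dcomp k gT K P bbar)
    (gstab_group 'C_H(P)%G bbar / 'C_K(P))%G id.
  split=> // [x Dx ->|c Dc c0]; last exact: (gr_direct gD Dc c0).
  exact: (ts_0 (gr_jacobson_ideal gD)).
have imD s : s \in (gstab 'C_H(P) bbar / 'C_K(P))%g ->
    (id @` (@Dcomp k gT K P bbar s))%classic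
    = gcomp bbar ((s : {set gT}) :&: 'C_H(P))%SET 'N_K(P).
  move=> Ss; have sC : (s : {set gT}) \subset 'C_H(P).
    apply: fintype.subset_trans (coset_subset sCM Ss) _.
    by apply/fintype.subsetP=> x /gstabP[].
  by rewrite image_id ((finset.setIidPl sC)).
have stabD x : x \in 'C_H(P) -> gconj bbar x = bbar <-> gconj b x = b.
  by move=> Cx; apply: stabb; apply: (fintype.subsetP CN).
have [isoD suppD] := block_compare unitP res_onto chk nKH blb dP setC
  (fintype.subxx _) CN gD rD (elimN eqP bbar0) erefl stabD imD.
have crossedD : forall s, s \in gr_supp (@Dcomp k gT K P bbar)
      (gstab_group 'C_H(P)%G bbar / 'C_K(P))%G ->
    exists u v, [/\ Dcomp bbar s u, Dcomp bbar s^-1%g v & u * v = bbar].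
  apply: (graded_crossed gD rD) => c x; rewrite image_id => -[y Fy <-].
  by exists (gscale c y); [apply: gscale_gfix|rewrite gscale_mulr].
have GbE : Gb = Gbbar.
  by rewrite /Gbbar (gr_supp_image gC rC) // => s Ss; rewrite (block_image res_onto chk nKH blb dP).
split; first split.
- exact: (block_extension unitP res_onto chk nKH blb dP).
- exact: (block_extension unitP res_onto chk nNN blb1 dP1).
- exact: (gr_is_extension gD (elimN eqP bbar0) crossedD).
split=> //; split=> //.
(* A degree s in one of the supports contains an element of C_H(P), which
   normalises P, so the two groups of candidate degrees give the same support. *)
rewrite GbE; apply/setP=> s; rewrite [LHS]inE [RHS]inE; apply: andb_id2r => /asboolP FF.
have Fb : setprod (Fcomp H P bbar s) (Fcomp H P bbar s^-1%g) bbar.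
  rewrite FF; exists 1; last by rewrite mulr1.
  rewrite coset_oneE finset.setIA (finset.setIidPl sKH).
  exact: (gfix1 _ 'C_K(P)%G 'N_K(P)%g).
have [y sy Cy] := Fcomp_meets bbar0 Fb; have yN := fintype.subsetP CN y Cy.
have Hy : y \in H by case/finset.setIP: yN.
have sE := coset_mem sy; have [NKy _] := HN y yN.
apply/idP/idP=> [Ss|].
  have /gstabP[_ yb] := fintype.subsetP (coset_subset (stab_sub nKH blb) Ss) y sy.
  rewrite -sE; apply: mem_morphim => //; rewrite -[y]mulg1; apply: mem_mulg => //.
  exact/gstabP.
apply: (fintype.subsetP (quotientS K _)); apply/fintype.subsetP=> _ /mulsgP[u v Su Kv ->].
have sub := fintype.subsetP (stab_sub nKH blb).
apply: groupM; last exact: sub.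
by move: Su => /gstabP[/finset.setIP[Hu _] ub]; apply/gstabP.
Qed.
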